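(* Moderate dimensional $\mathsf{OV}$ is in truly subquadratic time if and only if moderate dimensional $\mathsf{MA\text{-}Min\text{-}IP}$ is in truly subquadratic time.
   Context: For sets $A,B\subseteq\{0,1\}^d$ with $|A|=|B|=n$: $\mathsf{OV}_{n,d}$ asks whether some $(a,b)\in A\times B$ has $\langle a,b\rangle=0$; $\mathsf{MA\text{-}Min\text{-}IP}_{n,d}$ asks to output a number in $[\mathrm{MIN}(A,B),2\cdot\mathrm{MIN}(A,B)]$ where $\mathrm{MIN}(A,B)=\min_{(a,b)\in A\times B}\langle a,b\rangle$. A problem $\Pi$ on Boolean vectors is, in moderate dimension, in truly subquadratic time if there are constants $\varepsilon,\delta>0$ such that $\Pi$ is solvable in $n^{2-\varepsilon}$ time on $n$ vectors with $n^{\delta}$ dimensions. *)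

(* Defs.v *)
From HB Require Import structures.
From mathcomp Require Import all_boot all_order all_algebra.
From mathcomp Require Import boolp reals exp.

Set Implicit Arguments.
Unset Strict Implicit.
Unset Printing Implicit Defensive.

Import Order.TTheory GRing.Theory Num.Theory.

Definition bitvec (d : nat) := d.-tuple bool.

Definition ip (d : nat) (a b : bitvec d) : nat :=
  \sum_(i < d) (tnth a i && tnth b i).

(* A problem relates an instance (A, B) to its valid outputs. *)
Definition problem := forall d : nat, {set bitvec d} -> {set bitvec d} -> nat -> Prop.

(* The answers "yes" and "no" are output as 1 and 0. *)
Definition OV : problem := fun d A B out =>
  out = [exists a in A, exists b in B, ip a b == 0] :> nat.

(* Since ip a b <= d, the neutral element d does not affect the minimum
   when A and B are nonempty. *)
Definition minIP (d : nat) (A B : {set bitvec d}) : nat :=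
  \big[minn/d]_(a in A) \big[minn/d]_(b in B) ip a b.

(* A natural-number output loses no generality: rounding down a real number
   of [MIN, 2 MIN] stays in this interval. *)
Definition MA_MinIP : problem := fun d A B out =>
  minIP A B <= out <= 2 * minIP A B.

(* Probabilistic unit-cost word RAM, with structured control flow: finitely
   many registers are used by a program, the memory is accessed by indirect
   addressing, and Flip draws a fair coin from the random tape. *)
Inductive binop := OpAdd | OpSub | OpMul | OpDiv | OpMod | OpLt | OpEq.

Definition eval_binop (o : binop) (m n : nat) : nat :=
  match o with
  | OpAdd => m + n
  | OpSub => m - n
  | OpMul => m * n
  | OpDiv => m %/ n
  | OpMod => m %% n
  | OpLt => m < n
  | OpEq => m == n
  end.

Inductive com :=
  | Skip
  | Const of nat & nat                 (* Const x v   : x <- v *)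
  | Op of binop & nat & nat & nat      (* Op o x y z  : x <- y o z *)
  | Read of nat & nat                  (* Read x y    : x <- cells[y] *)
  | Write of nat & nat                 (* Write x y   : cells[x] <- y *)
  | Flip of nat                        (* Flip x      : x <- random bit *)
  | Seq of com & com
  | If of nat & com & com              (* tests x != 0 *)
  | While of nat & com.                (* tests x != 0 *)

Record state := State { reg : nat -> nat; cells : nat -> nat; tape : seq bool }.

Definition upd (f : nat -> nat) (x v : nat) : nat -> nat :=
  fun y => if y == x then v else f y.

Definition set_reg (s : state) (x v : nat) : state :=
  State (upd (reg s) x v) (cells s) (tape s).

Definition set_mem (s : state) (i v : nat) : state :=
  State (reg s) (upd (cells s) i v) (tape s).

(* [exec W c s s' t]: from s, the program c halts in s' after t steps, and all
   the words it writes are < W. There is no rule for overflowing words or for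
   flipping a coin on an exhausted tape: such runs are stuck, hence fail. *)
Inductive exec (W : nat) : com -> state -> state -> nat -> Prop :=
  | ExecSkip s : exec W Skip s s 1
  | ExecConst x v s : v < W -> exec W (Const x v) s (set_reg s x v) 1
  | ExecOp o x y z s :
      eval_binop o (reg s y) (reg s z) < W ->
      exec W (Op o x y z) s (set_reg s x (eval_binop o (reg s y) (reg s z))) 1
  | ExecRead x y s :
      cells s (reg s y) < W ->
      exec W (Read x y) s (set_reg s x (cells s (reg s y))) 1
  | ExecWrite x y s :
      reg s x < W -> reg s y < W ->
      exec W (Write x y) s (set_mem s (reg s x) (reg s y)) 1
  | ExecFlip x r m (b : bool) l :
      b < W ->
      exec W (Flip x) (State r m (b :: l)) (State (upd r x b) m l) 1
  | ExecSeq c1 c2 s1 s2 s3 t1 t2 :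
      exec W c1 s1 s2 t1 -> exec W c2 s2 s3 t2 ->
      exec W (Seq c1 c2) s1 s3 (t1 + t2)
  | ExecIfTrue x c1 c2 s s' t :
      reg s x != 0 -> exec W c1 s s' t -> exec W (If x c1 c2) s s' t.+1
  | ExecIfFalse x c1 c2 s s' t :
      reg s x = 0 -> exec W c2 s s' t -> exec W (If x c1 c2) s s' t.+1
  | ExecWhileTrue x c s1 s2 s3 t1 t2 :
      reg s1 x != 0 -> exec W c s1 s2 t1 -> exec W (While x c) s2 s3 t2 ->
      exec W (While x c) s1 s3 (t1 + t2).+1
  | ExecWhileFalse x c s :
      reg s x = 0 -> exec W (While x c) s s 1.

(* Input layout: registers 0 and 1 hold n and d; the memory holds the n vectors
   of A, then the n vectors of B, one coordinate per cell; everything else is 0. *)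
Definition input (n d : nat) (sA sB : seq (bitvec d)) (r : seq bool) : state :=
  State (nth 0 [:: n; d])
        (nth 0 [seq nat_of_bool b | b <- flatten (map val (sA ++ sB))])
        r.

Definition listing (d : nat) (s : seq (bitvec d)) (A : {set bitvec d}) : Prop :=
  uniq s /\ s =i A.

(* The output is the final value of register 0. *)
Definition run (W T : nat) (P : com) (s : state) (out : nat) : Prop :=
  exists (s' : state) (t : nat), [/\ exec W P s s' t, t <= T & reg s' 0 = out].

(* Worst-case time T over all inputs, all listings of the input sets and all coin
   tosses (at most T coins can be tossed in T steps), with error probability
   at most 1/3. *)
Definition solves (P : com) (Pi : problem) (n d W T : nat) : Prop :=
  forall (A B : {set bitvec d}) (sA sB : seq (bitvec d)),
    #|A| = n -> #|B| = n -> listing sA A -> listing sB B ->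
    (forall r : T.-tuple bool, exists out, run W T P (input n sA sB r) out) /\
    2 * 2 ^ T <= 3 * #|[set r : T.-tuple bool |
      `[< exists2 out, run W T P (input n sA sB r) out & Pi d A B out >]]|.

Local Open Scope ring_scope.

(* Words have k * log2 (n + 1) bits, for a constant k. *)
Definition moderate_truly_subquadratic (R : realType) (Pi : problem) : Prop :=
  exists eps delta : R, [/\ 0 < eps, 0 < delta &
    exists (P : com) (k : nat) (T : nat -> nat) (C : R),
      forall n : nat, (0 < n)%N ->
        (T n)%:R <= C * n%:R `^ (2 - eps) /\
        forall d : nat, d%:R <= n%:R `^ delta :> R ->
          solves P Pi n d (n.+1 ^ k)%N (T n)].

(* Main.v *)
(** Orthogonal vectors from approximate minimum: the approximation is 0 exactly
    when the minimum is 0.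

    Conversely, fix a threshold s = 2 tau + 1 and a constant k. A random column is the
    AND of k random coordinates, so it is hit by both a and b with probability
    p = (<a,b>/B)^k, where B is the range of the random coordinates. With L columns a
    pair becomes orthogonal with probability (1 - p)^L. Raising to the power k turns
    the gap between <a,b> <= s/2 and <a,b> >= s into a factor 2^k in p: L can be
    chosen so that far pairs become orthogonal with probability at most n^-8 and near
    pairs with probability at least n^-o(1), where o(1) is as small as we like for
    k large. Hence n^o(1) samples for each tau <= d, each decided by a majority of
    runs of the given algorithm in fresh regions of the memory, locate the minimum up
    to a factor 2. The dimension L is polynomial in d, because n <= 2^d and so
    log n <= d. For d >= 2 the bound d <= n^delta with delta small also makes n large
    compared to every fixed power of d; for d <= 1 the answer is the product of the
    first two input cells.

    Program correctness is expressed by [pw], a weakest-precondition transformer that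
    carries a bound on the failure probability of the rest of the run; total
    correctness and union bounds are then proved in one pass over the code. *)
Require Import Defs.
From mathcomp Require Import all_boot all_order all_algebra.
From mathcomp Require Import boolp reals exp.
From mathcomp Require Import zify ring lra.

Set Implicit Arguments.
Unset Strict Implicit.
Unset Printing Implicit Defensive.

Import Order.TTheory GRing.Theory Num.Theory.

(** * Runs and their failure probability *)

(** The two error probabilities are treated unevenly. One false alarm among n^2 pairs can spoil the
    output, so far pairs must be suppressed to a small power of 1/n; the single pair attaining the
    minimum may survive rarely, at the price of repetition. With [c = 2 ^ g], [k = g + 5] and l
    least such that n < 2^(c l), near pairs survive with probability at least 2^-l and far pairs
    with at most 2^-(8 c l). About 2^l samples then suffice per threshold, and 2^l is of order
    n^(1/c).

    Thresholds are tried in decreasing order and each success overwrites the output by 2 tau. For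
    tau above the minimum any answer is allowed, at the minimum one success is required, between
    half the minimum and the minimum a success is harmless, and only below half of it must all
    attempts be rejected.

    The given algorithm is guaranteed to work only on zeroed memory and may write anywhere below its
    word bound s. Cleaning up after a call could cost too much, so every call moves on by s cells;
    the word bound s^4 of the new program leaves room for all of them. *)

Record memory := Mem { mr : nat -> nat; mc : nat -> nat }.

Definition with_tape (m : memory) (l : seq bool) : state := State (mr m) (mc m) l.

Definition mem_of (s : state) : memory := Mem (reg s) (cells s).

Definition put_reg (m : memory) (x v : nat) : memory := Mem (upd (mr m) x v) (mc m).

Definition put_cell (m : memory) (a v : nat) : memory := Mem (mr m) (upd (mc m) a v).

(** A run depends only on the coins it consumes, so it can be replayed with any continuation of the
    tape. This is what allows a result to be attached to a finite coin prefix. *)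
Lemma exec_prefix W c s s' t : exec W c s s' t ->
  exists p, [/\ tape s = p ++ tape s', size p <= t &
    forall l, exec W c (with_tape (mem_of s) (p ++ l))
                       (with_tape (mem_of s') l) t].
Proof.
elim=> {c s s' t}.
- by move=> s; exists [::]; split=> // l; exact: ExecSkip.
- by move=> x v s hv; exists [::]; split=> // l; exact: ExecConst.
- move=> o x y z s h; exists [::]; split=> // l.
  exact: (ExecOp x (s := with_tape (mem_of s) l)).
- move=> x y s h; exists [::]; split=> // l.
  exact: (ExecRead x (s := with_tape (mem_of s) l)).
- move=> x y s h1 h2; exists [::]; split=> // l.
  exact: (ExecWrite (s := with_tape (mem_of s) l)).
- by move=> x r m b l hb; exists [:: b]; split=> // l'; exact: ExecFlip.
- move=> c1 c2 s1 s2 s3 t1 t2 _ [p1 [e1 z1 h1]] _ [p2 [e2 z2 h2]].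
  exists (p1 ++ p2); split; first by rewrite e1 e2 catA.
    by rewrite size_cat leq_add.
  by move=> l; rewrite -catA; exact: ExecSeq (h1 _) (h2 _).
- move=> x c1 c2 s s' t hx _ [p [e z h]]; exists p; split=> //; first exact: leqW.
  by move=> l; apply: ExecIfTrue (h l).
- move=> x c1 c2 s s' t hx _ [p [e z h]]; exists p; split=> //; first exact: leqW.
  by move=> l; apply: ExecIfFalse (h l).
- move=> x c s1 s2 s3 t1 t2 hx _ [p1 [e1 z1 h1]] _ [p2 [e2 z2 h2]].
  exists (p1 ++ p2); split; first by rewrite e1 e2 catA.
    by rewrite size_cat leqW // leq_add.
  by move=> l; rewrite -catA; apply: ExecWhileTrue (h1 _) (h2 _).
- by move=> x c s hx; exists [::]; split=> // l; exact: ExecWhileFalse.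
Qed.

Lemma exec_det W c s s1 t1 : exec W c s s1 t1 ->
  forall s2 t2, exec W c s s2 t2 -> s1 = s2 /\ t1 = t2.
Proof.
elim=> {c s s1 t1}.
- by move=> s s2 t2 h; inversion h; subst.
- by move=> x v s hv s2 t2 h; inversion h; subst.
- by move=> o x y z s hv s2 t2 h; inversion h; subst.
- by move=> x y s hv s2 t2 h; inversion h; subst.
- by move=> x y s h1 h2 s2 t2 h; inversion h; subst.
- by move=> x r m b l hb s2 t2 h; inversion h; subst.
- move=> c1 c2 s1 s2 s3 t1 t2 _ IH1 _ IH2 s4 t4 h; inversion h; subst.
  match goal with h1 : exec _ c1 _ _ _ |- _ => have [? ?] := IH1 _ _ h1 end; subst.
  by match goal with h2 : exec _ c2 _ _ _ |- _ => have [? ?] := IH2 _ _ h2 end; subst.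
- move=> x c1 c2 s s' t /eqP hx _ IH s4 t4 h; inversion h; subst; last by [].
  by match goal with h1 : exec _ c1 _ _ _ |- _ => have [? ?] := IH _ _ h1 end; subst.
- move=> x c1 c2 s s' t hx _ IH s4 t4 h; inversion h; subst.
    by match goal with h1 : is_true (reg s x != 0) |- _ => rewrite hx in h1 end.
  by match goal with h1 : exec _ c2 _ _ _ |- _ => have [? ?] := IH _ _ h1 end; subst.
- move=> x c s1 s2 s3 t1 t2 /eqP hx _ IH1 _ IH2 s4 t4 h; inversion h; subst; last by [].
  match goal with h1 : exec _ c _ _ _ |- _ => have [? ?] := IH1 _ _ h1 end; subst.
  by match goal with h2 : exec _ (While x c) _ _ _ |- _ => have [? ?] := IH2 _ _ h2 end; subst.
- move=> x c s hx s4 t4 h; inversion h; subst=> //.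
  by match goal with h1 : is_true (reg _ x != 0) |- _ => rewrite hx in h1 end.
Qed.

Lemma exec_leW W W' c s s' t : W <= W' -> exec W c s s' t -> exec W' c s s' t.
Proof.
move=> hW; elim=> {c s s' t}.
- exact: ExecSkip.
- by move=> x v s hv; apply: ExecConst; exact: leq_trans hW.
- by move=> o x y z s hv; apply: ExecOp; exact: leq_trans hW.
- by move=> x y s hv; apply: ExecRead; exact: leq_trans hW.
- by move=> x y s h1 h2; apply: ExecWrite; exact: leq_trans hW.
- by move=> x r m b l hb; apply: ExecFlip; exact: leq_trans hW.
- by move=> c1 c2 s1 s2 s3 t1 t2 _ IH1 _ IH2; exact: ExecSeq IH1 IH2.
- by move=> x c1 c2 s s' t hx _ IH; exact: ExecIfTrue.
- by move=> x c1 c2 s s' t hx _ IH; exact: ExecIfFalse.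
- by move=> x c s1 s2 s3 t1 t2 hx _ IH1 _ IH2; exact: ExecWhileTrue IH1 IH2.
- by move=> x c s hx; exact: ExecWhileFalse.
Qed.

Fixpoint reg_bound (c : com) : nat :=
  match c with
  | Skip => 0
  | Const x _ | Flip x => x.+1
  | Op _ x y z => maxn x.+1 (maxn y.+1 z.+1)
  | Read x y | Write x y => maxn x.+1 y.+1
  | Seq c1 c2 => maxn (reg_bound c1) (reg_bound c2)
  | If x c1 c2 => maxn x.+1 (maxn (reg_bound c1) (reg_bound c2))
  | While x c => maxn x.+1 (reg_bound c)
  end.

Lemma exec_reg_frame W c s s' t : exec W c s s' t ->
  forall x, reg_bound c <= x -> reg s' x = reg s x.
Proof.
elim=> {c s s' t} //=.
- by move=> x v s hv y hy; rewrite /upd; case: eqP => // ?; lia.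
- by move=> o x y z s hv w hw; rewrite /upd; case: eqP => // ?; lia.
- by move=> x y s hv w hw; rewrite /upd; case: eqP => // ?; lia.
- by move=> x r m b l hb w hw; rewrite /upd; case: eqP => // ?; lia.
- by move=> c1 c2 s1 s2 s3 t1 t2 _ IH1 _ IH2 x hx; rewrite IH2 ?IH1 //; lia.
- by move=> x c1 c2 s s' t hx _ IH y hy; apply: IH; lia.
- by move=> x c1 c2 s s' t hx _ IH y hy; apply: IH; lia.
- by move=> x c s1 s2 s3 t1 t2 hx _ IH1 _ IH2 y hy; rewrite IH2 ?IH1 //; lia.
Qed.

Section Expectation.
Variable R : realFieldType.
Local Open Scope ring_scope.

(* [pwr Phi E v]: E relates each coin prefix p to the results reached after
   reading exactly p. There is a finite binary tree of coin tosses whose leaves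
   x carry values r with [Phi x r], and the expected value is at most v. *)
Inductive pwr (X : Type) (Phi : X -> R -> Prop) : (seq bool -> X -> Prop) -> R -> Prop :=
  | PwLeaf (E : seq bool -> X -> Prop) x r v : E [::] x -> Phi x r -> r <= v -> pwr Phi E v
  | PwNode (E : seq bool -> X -> Prop) v0 v1 v :
      pwr Phi (fun p => E (false :: p)) v0 -> pwr Phi (fun p => E (true :: p)) v1 ->
      v0 + v1 <= 2 * v -> pwr Phi E v.

Lemma pwr_map X Y (Phi : X -> R -> Prop) (Psi : Y -> R -> Prop) E E' v :
  pwr Phi E v ->
  (forall p x r, E p x -> Phi x r -> exists2 y, E' p y & Psi y r) ->
  pwr Psi E' v.
Proof.
move=> h; elim: h E' => {E v}.
- move=> E x r v hE hP hr E' h; have [y h1 h2] := h _ _ _ hE hP.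
  exact: PwLeaf h1 h2 hr.
- move=> E v0 v1 v _ IH0 _ IH1 hv E' h.
  by apply: (PwNode (IH0 _ _) (IH1 _ _) hv) => p x r; apply: h.
Qed.

Lemma pwr_le X (Phi : X -> R -> Prop) E v v' : pwr Phi E v -> v <= v' -> pwr Phi E v'.
Proof.
case=> {E v}.
- by move=> E x r v hE hP hr hv; apply: PwLeaf hE hP (le_trans hr hv).
- by move=> E v0 v1 v h0 h1 hv hv'; apply: PwNode h0 h1 _; lra.
Qed.

(** Trees compose by grafting: a leaf value of the first computation is the bound for the second.
    Bounds thus pass backwards through a sequence of commands without conditional probabilities. *)
Lemma pwr_bind X Y (Phi : Y -> R -> Prop) (E1 : seq bool -> X -> Prop) E2 E v :
  pwr (fun x r => pwr Phi (E2 x) r) E1 v ->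
  (forall p q x y, E1 p x -> E2 x q y -> E (p ++ q) y) ->
  pwr Phi E v.
Proof.
move=> h; elim: h E => {E1 v}.
- move=> E1 x r v hE hP hr E h.
  apply: (pwr_le _ hr); apply: (pwr_map hP) => p y s h2 hPhi.
  by exists y => //; exact: (h [::] _ _ _ hE).
- move=> E1 v0 v1 v _ IH0 _ IH1 hv E h.
  by apply: (PwNode (IH0 _ _) (IH1 _ _) hv) => p q x y h1 h2; exact: (h (_ :: p) q _ _ h1 h2).
Qed.

(** Rescales a 0/1 failure indicator to two arbitrary values: with a = vg and b = vb - vg, a failure
    probability 1/3 becomes the expected value vg + (vb - vg) / 3. *)
Lemma pwr_affine X (Phi : X -> R -> Prop) E v (a b : R) : 0 <= b ->
  pwr Phi E v -> pwr (fun x r => exists2 r', Phi x r' & r = a + b * r') E (a + b * v).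
Proof.
move=> hb; elim=> {E v}.
- move=> E x r v hE hP hr; apply: (@PwLeaf _ _ _ x (a + b * r)) => //.
    by exists r.
  by rewrite lerD2l ler_wpM2l.
- move=> E v0 v1 v _ IH0 _ IH1 hv; apply: (PwNode IH0 IH1).
  have := ler_wpM2l hb hv; lra.
Qed.

Definition reaches W c m t (p : seq bool) (x : memory * nat) : Prop :=
  exists2 k, x.2 = (t + k)%N &
    forall l, exec W c (with_tape m (p ++ l)) (with_tape x.1 l) k.

(* Expectation transformer: the third argument of the postcondition Phi is a
   bound on the failure probability of the rest of the computation, and the
   second is the time elapsed, which is t at the start. *)
Definition pw W c m t (Phi : memory -> nat -> R -> Prop) (v : R) : Prop :=
  pwr (fun x r => Phi x.1 x.2 r) (reaches W c m t) v.

Lemma pw_conseq W c m t (Phi Psi : memory -> nat -> R -> Prop) v v' :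
  pw W c m t Phi v -> v <= v' -> (forall m' t' r, Phi m' t' r -> Psi m' t' r) ->
  pw W c m t Psi v'.
Proof.
move=> h hv hP; apply: pwr_le hv; apply: (pwr_map h) => p x r h1 h2.
by exists x => //; exact: hP.
Qed.

Lemma pw_affine W c m t (Phi : memory -> nat -> R -> Prop) v a b : 0 <= b ->
  pw W c m t Phi v ->
  pw W c m t (fun m' t' r => exists2 r', Phi m' t' r' & r = a + b * r') (a + b * v).
Proof. exact: pwr_affine. Qed.

Lemma pw_skip W m t (Phi : memory -> nat -> R -> Prop) v :
  Phi m t.+1 v -> pw W Skip m t Phi v.
Proof.
move=> h; apply: (@PwLeaf _ _ _ (m, t.+1) v) => //=.
by exists 1%N; rewrite ?addn1 // => l; exact: ExecSkip.
Qed.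

Lemma pw_const W x a m t (Phi : memory -> nat -> R -> Prop) v : (a < W)%N ->
  Phi (put_reg m x a) t.+1 v -> pw W (Const x a) m t Phi v.
Proof.
move=> ha h; apply: (@PwLeaf _ _ _ (put_reg m x a, t.+1) v) => //=.
by exists 1%N; rewrite ?addn1 // => l; exact: ExecConst.
Qed.

Lemma pw_op W o x y z m t (Phi : memory -> nat -> R -> Prop) v :
  (eval_binop o (mr m y) (mr m z) < W)%N ->
  Phi (put_reg m x (eval_binop o (mr m y) (mr m z))) t.+1 v ->
  pw W (Op o x y z) m t Phi v.
Proof.
move=> ha h; apply: (@PwLeaf _ _ _ (_, t.+1) v) h _ => //=.
exists 1%N; rewrite ?addn1 // => l.
exact: (ExecOp x (s := with_tape m l)).
Qed.

Lemma pw_read W x y m t (Phi : memory -> nat -> R -> Prop) v :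
  (mc m (mr m y) < W)%N -> Phi (put_reg m x (mc m (mr m y))) t.+1 v ->
  pw W (Read x y) m t Phi v.
Proof.
move=> ha h; apply: (@PwLeaf _ _ _ (_, t.+1) v) h _ => //=.
exists 1%N; rewrite ?addn1 // => l.
exact: (ExecRead x (s := with_tape m l)).
Qed.

Lemma pw_write W x y m t (Phi : memory -> nat -> R -> Prop) v :
  (mr m x < W)%N -> (mr m y < W)%N -> Phi (put_cell m (mr m x) (mr m y)) t.+1 v ->
  pw W (Write x y) m t Phi v.
Proof.
move=> ha hb h; apply: (@PwLeaf _ _ _ (_, t.+1) v) h _ => //=.
exists 1%N; rewrite ?addn1 // => l.
exact: (ExecWrite (s := with_tape m l)).
Qed.

Lemma pw_flip W x m t (Phi : memory -> nat -> R -> Prop) v v0 v1 : (1 < W)%N ->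
  Phi (put_reg m x 0) t.+1 v0 -> Phi (put_reg m x 1) t.+1 v1 -> v0 + v1 <= 2 * v ->
  pw W (Flip x) m t Phi v.
Proof.
move=> hW h0 h1; apply: PwNode.
- apply: (@PwLeaf _ _ _ (_, t.+1) v0) h0 _ => //=; exists 1%N; rewrite ?addn1 // => l.
  by apply: (ExecFlip _ _ _ (b := false)); lia.
- apply: (@PwLeaf _ _ _ (_, t.+1) v1) h1 _ => //=; exists 1%N; rewrite ?addn1 // => l.
  exact: (ExecFlip _ _ _ (b := true)).
Qed.

Lemma pw_seq W c1 c2 m t (Phi : memory -> nat -> R -> Prop) v :
  pw W c1 m t (fun m' t' r => pw W c2 m' t' Phi r) v -> pw W (Seq c1 c2) m t Phi v.
Proof.
move=> h; apply: (pwr_bind h) => p q [m1 t1] [m2 t2] /= [k1 /= e1 h1] [k2 /= e2 h2].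
exists (k1 + k2)%N => /=; first by rewrite e2 e1 addnA.
by move=> l; rewrite -catA; exact: ExecSeq (h1 _) (h2 _).
Qed.

Lemma pw_if W x c1 c2 m t (Phi : memory -> nat -> R -> Prop) v :
  (mr m x != 0 -> pw W c1 m t.+1 Phi v) -> (mr m x = 0 -> pw W c2 m t.+1 Phi v) ->
  pw W (If x c1 c2) m t Phi v.
Proof.
case: (eqVneq (mr m x) 0) => hx h1 h2.
- apply: (pwr_map (h2 hx)) => p [m' t'] r [k /= e h] hP; exists (m', t') => //.
  by exists k.+1 => /=; [rewrite e addSnnS | move=> l; exact: ExecIfFalse].
- apply: (pwr_map (h1 isT)) => p [m' t'] r [k /= e h] hP; exists (m', t') => //.
  by exists k.+1 => /=; [rewrite e addSnnS | move=> l; exact: ExecIfTrue].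
Qed.

(** The index of [Inv] is the number of iterations left, so one invariant yields termination along
    with the time and failure bounds. *)
Lemma pw_while W x c (Inv : nat -> memory -> nat -> R -> Prop)
    (Phi : memory -> nat -> R -> Prop) :
  (forall i m t v, Inv i.+1 m t v -> mr m x != 0 /\ pw W c m t.+1 (Inv i) v) ->
  (forall m t v, Inv 0 m t v -> mr m x = 0 /\ Phi m t.+1 v) ->
  forall i m t v, Inv i m t v -> pw W (While x c) m t Phi v.
Proof.
move=> hS h0; elim=> [|i IH] m t v hI.
  have [hx hP] := h0 _ _ _ hI.
  apply: (@PwLeaf _ _ _ (_, t.+1) v) hP _ => //=; exists 1%N; rewrite ?addn1 // => l.
  exact: ExecWhileFalse.
have [hx hc] := hS _ _ _ _ hI.
have {}hc : pw W c m t.+1 (fun m' t' r => pw W (While x c) m' t' Phi r) v.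
  by apply: pw_conseq hc (lexx _) _ => m' t' r; exact: IH.
apply: (pwr_bind hc) => p q [m1 t1] [m2 t2] /= [k1 /= e1 h1] [k2 /= e2 h2].
exists (k1 + k2).+1 => /=; first by rewrite e2 e1; lia.
by move=> l; rewrite -catA; apply: ExecWhileTrue (h1 _) (h2 _).
Qed.

Fixpoint iter_com (k : nat) (c : com) : com :=
  if k is k'.+1 then Seq c (iter_com k' c) else Skip.

Lemma pw_iter_com W c k (Inv : nat -> memory -> nat -> R -> Prop)
    (Phi : memory -> nat -> R -> Prop) :
  (forall i m t v, (i < k)%N -> Inv i m t v -> pw W c m t (Inv i.+1) v) ->
  (forall m t v, Inv k m t v -> Phi m t.+1 v) ->
  forall m t v, Inv 0 m t v -> pw W (iter_com k c) m t Phi v.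
Proof.
move=> hS h0.
have: forall j i m t v, (i + j = k)%N -> Inv i m t v -> pw W (iter_com j c) m t Phi v.
  elim=> [|j IH] i m t v hij hI.
    by apply: pw_skip; apply: h0; rewrite -hij addn0.
  apply: pw_seq; apply: pw_conseq (hS _ _ _ _ _ hI) (lexx _) _; first lia.
  by move=> m' t' r; apply: IH; lia.
by move=> h m t v; apply: h.
Qed.

End Expectation.

(** * Coin trees and counting of tapes *)

Definition count_tapes (f : seq bool -> bool) (k : nat) : nat :=
  #|[set r : k.-tuple bool | f r]|.

Lemma count_tapes0 f : count_tapes f 0 = f [::].
Proof.
rewrite /count_tapes; case hf: (f [::]).
  have -> : [set r : 0.-tuple bool | f r] = setT.
    by apply/setP=> r; rewrite !inE tuple0 hf.
  by rewrite cardsT card_tuple.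
have -> : [set r : 0.-tuple bool | f r] = set0.
  by apply/setP=> r; rewrite !inE tuple0 hf.
by rewrite cards0.
Qed.

Lemma count_tapesS f k : count_tapes f k.+1 =
  count_tapes (fun r => f (false :: r)) k + count_tapes (fun r => f (true :: r)) k.
Proof.
have cons_inj b : injective (fun t : k.-tuple bool => [tuple of b :: t]).
  by move=> t u /(congr1 val) /= [] /val_inj.
rewrite /count_tapes -(card_imset _ (cons_inj false)) -(card_imset _ (cons_inj true)).
set A := imset _ _; set B := imset _ _.
have AB0 : A :&: B = set0.
  apply/setP=> r; rewrite !inE; apply/negP=> /andP[/imsetP[x _ ->] /imsetP[y _]].
  by move/(congr1 val).
rewrite -cardsUI AB0 cards0 addn0.
apply: eq_card=> r; rewrite !inE.
case: (tupleP r) => b t; apply/idP/orP.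
  by case: b => h; [right | left]; apply/imsetP; exists t; rewrite ?inE.
by case=> /imsetP[u]; rewrite inE => h /(congr1 val) /= ->.
Qed.

Lemma count_tapes_le f k : count_tapes f k <= 2 ^ k.
Proof. by rewrite (leq_trans (max_card _)) // card_tuple card_bool. Qed.

Lemma eq_count_tapes f g k : (forall r, size r = k -> f r = g r) ->
  count_tapes f k = count_tapes g k.
Proof.
move=> h; rewrite /count_tapes; apply: eq_card => r.
by rewrite !inE h ?size_tuple.
Qed.

Lemma count_tapesC f k : count_tapes f k + count_tapes (fun r => ~~ f r) k = 2 ^ k.
Proof.
have := cardsC [set r : k.-tuple bool | f r].
rewrite card_tuple card_bool /count_tapes => <-; congr (_ + _).
by apply: eq_card => r; rewrite !inE.
Qed.

Section Tapes.
Variable R : realFieldType.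
Local Open Scope ring_scope.

Lemma pwr_leaf X (Phi : X -> R -> Prop) E v : pwr Phi E v ->
  exists p x r, E p x /\ Phi x r.
Proof.
elim=> {E v}; first by move=> E x r v h1 h2 _; exists [::], x, r.
by move=> E v0 v1 v _ [p [x [r [h1 h2]]]] _ _ _; exists (false :: p), x, r.
Qed.

(** [solves] demands that all tapes, not merely most of them, end in time: each tape follows a
    branch of the tree down to a leaf. *)
Lemma pwr_total X (Phi : X -> R -> Prop) E v : pwr Phi E v ->
  forall tp k, (forall p x r, E p x -> Phi x r -> (size p <= k)%N) -> size tp = k ->
  exists p q x r, [/\ tp = p ++ q, E p x & Phi x r].
Proof.
elim=> {E v}; first by move=> E x r v h1 h2 _ tp k _ _; exists [::], tp, x, r.
move=> E v0 v1 v H0 IH0 H1 IH1 _ [|b tp] [|k] //= hk.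
  have [p [x [r [h1 h2]]]] := pwr_leaf H0.
  by have := hk _ _ _ h1 h2.
move=> [sz]; case: b.
  have [p x r h1 h2|p [q [x [r [-> h1 h2]]]]] := IH1 tp k _ sz; first exact: (hk _ _ _ h1 h2).
  by exists (true :: p), q, x, r.
have [p x r h1 h2|p [q [x [r [-> h1 h2]]]]] := IH0 tp k _ sz; first exact: (hk _ _ _ h1 h2).
by exists (false :: p), q, x, r.
Qed.

(** Markov's inequality on the tree: a leaf with prefix p accounts for 2^(k - |p|) tapes, and it has
    value at least 1 as soon as one of them is bad. *)
Lemma pwr_count X (Phi : X -> R -> Prop) E v : pwr Phi E v ->
  forall k (bad : seq bool -> bool),
  (forall p x r, E p x -> Phi x r -> [/\ (size p <= k)%N, 0 <= r &
     forall q, size (p ++ q) = k -> bad (p ++ q) -> 1 <= r]) ->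
  (count_tapes bad k)%:R <= v * 2 ^+ k.
Proof.
elim=> {E v}.
  move=> E x r v h1 h2 hv k bad /(_ _ _ _ h1 h2) [_ r0 hb].
  apply: (@le_trans _ _ (r * 2 ^+ k)); last by rewrite ler_wpM2r ?exprn_ge0.
  case: (eqVneq (count_tapes bad k) 0%N) => [->|]; first by rewrite mulr_ge0 ?exprn_ge0.
  rewrite -lt0n card_gt0 => /set0Pn[q]; rewrite inE => hq.
  have r1 : 1 <= r by apply: (hb q) => //; rewrite size_tuple.
  apply: (@le_trans _ _ (1 * 2 ^+ k)); last by rewrite ler_wpM2r ?exprn_ge0.
  by rewrite mul1r -natrX ler_nat count_tapes_le.
move=> E v0 v1 v H0 IH0 H1 IH1 hv [|k] bad h.
  have [p [x [r [h1 h2]]]] := pwr_leaf H0.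
  by have [] := h _ _ _ h1 h2.
rewrite count_tapesS natrD exprS.
have {}IH0 : (count_tapes (fun r => bad (false :: r)) k)%:R <= v0 * 2 ^+ k.
  apply: IH0 => p x r h1 h2; have [a b c] := h _ _ _ h1 h2; split=> // q sz.
  by apply: c; rewrite /= sz.
have {}IH1 : (count_tapes (fun r => bad (true :: r)) k)%:R <= v1 * 2 ^+ k.
  apply: IH1 => p x r h1 h2; have [a b c] := h _ _ _ h1 h2; split=> // q sz.
  by apply: c; rewrite /= sz.
apply: (le_trans (lerD IH0 IH1)); rewrite -mulrDl mulrA ler_wpM2r ?exprn_ge0 //; lra.
Qed.

Definition outcome W P m (G : memory -> Prop) (tp : seq bool) : Prop :=
  exists s' k, exec W P (with_tape m tp) s' k /\ G (mem_of s').

(** Turns the frequency guarantee of a given algorithm into a tree: branch on each coin until the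
    run stops, and average the failure indicator over the leaves. *)
Lemma pw_of_tapes W P m t G T :
  (forall tp, size tp = T -> exists s' k, (k <= T)%N /\ exec W P (with_tape m tp) s' k) ->
  pw W P m t (fun m' t' (v : R) => (t' <= t + T)%N /\ v = (~~ `[< G m' >])%:R)
    ((count_tapes (fun tp => ~~ `[< outcome W P m G tp >]) T)%:R / 2 ^+ T).
Proof.
move=> hT; set bad := fun tp => ~~ _.
(* The subtree at the prefix q, with k coins left, is built under the condition that the run stops
   at no proper prefix of q. *)
suff H: forall k q, (size q + k = T)%N ->
    (forall p s x, q = p ++ s -> reaches W P m t p x -> s = [::]) ->
    pwr (fun x (v : R) => (x.2 <= t + T)%N /\ v = (~~ `[< G x.1 >])%:R)
      (fun p => reaches W P m t (q ++ p))
      ((count_tapes (fun r => bad (q ++ r)) k)%:R / 2 ^+ k).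
  by apply: (H T [::]) => // p s x; case: s => //; case: p.
elim=> [|k IH] q hq hpre.
  have [s' [k [hk hs]]] := hT q ltac:(lia).
  have [p [ep sp hp]] := exec_prefix hs.
  have hr : reaches W P m t p (mem_of s', (t + k)%N) by exists k.
  have es := hpre _ _ _ ep hr.
  rewrite /= es cats0 in ep; rewrite /= in ep; subst p.
  apply: (@PwLeaf _ _ _ _ (mem_of s', (t + k)%N) (~~ `[< G (mem_of s') >])%:R).
  - by rewrite cats0.
  - by split=> //=; lia.
  rewrite count_tapes0 cats0 expr0 divr1 ler_nat /bad.
  suff -> : `[< outcome W P m G q >] = `[< G (mem_of s') >] by [].
  apply: asbool_equiv_eq; split; last by move=> ?; exists s', k.
  by case=> s2 [k2 [h2]]; have [-> _] := exec_det h2 hs.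
(* If the run stops exactly at q, all extensions of q share its outcome and the tree ends in a leaf;
   otherwise one more coin is tossed. *)
case: (pselect (exists x, reaches W P m t q x)) => [[[m' t'] hx]|hno].
  have [s' [k' [hk hs]]] := hT (q ++ nseq k.+1 false) ltac:(by rewrite size_cat size_nseq).
  case: (hx) => j /= et hj.
  have [e1 e2] := exec_det hs (hj _).
  apply: (@PwLeaf _ _ _ _ (m', t') (~~ `[< G m' >])%:R).
  - by rewrite cats0.
  - by split=> //=; lia.
  rewrite (@eq_count_tapes _ (fun _ => ~~ `[< G m' >])) => [|r sr].
    case: (`[< G m' >]) => /=; first by rewrite divr_ge0 // exprn_ge0.
    have -> : count_tapes (fun=> true) k.+1 = (2 ^ k.+1)%N.
      rewrite /count_tapes -card_bool -card_tuple -cardsT.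
      by apply: eq_card => r; rewrite !inE.
    by rewrite natrX divff // expf_neq0 // pnatr_eq0.
  rewrite /bad; congr (~~ _); apply: asbool_equiv_eq; split.
    case=> s2 [k2 [h2]]; have [-> _] := exec_det h2 (hj _).
    by case: (m').
  move=> hG; exists (with_tape m' r), j; split; first exact: hj.
  by case: (m') hG.
have step b : pwr (fun x (v : R) => (x.2 <= t + T)%N /\ v = (~~ `[< G x.1 >])%:R)
      (fun p => reaches W P m t (rcons q b ++ p))
      ((count_tapes (fun r => bad (rcons q b ++ r)) k)%:R / 2 ^+ k).
  apply: IH; first by rewrite size_rcons; lia.
  move=> p s x; case/lastP: s => // s b'; rewrite -rcons_cat => /rcons_inj[e _] hr.
  have es := hpre _ _ _ e hr.
  by case: hno; exists x; rewrite e es cats0.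
apply: (PwNode (v0 := (count_tapes (fun r => bad (rcons q false ++ r)) k)%:R / 2 ^+ k)
  (v1 := (count_tapes (fun r => bad (rcons q true ++ r)) k)%:R / 2 ^+ k)).
- apply: (pwr_map (step false)) => p x r h1 h2; exists x => //.
  by rewrite -cat_rcons.
- apply: (pwr_map (step true)) => p x r h1 h2; exists x => //.
  by rewrite -cat_rcons.
rewrite count_tapesS natrD exprS.
under eq_count_tapes => r _ do rewrite cat_rcons.
under [X in (_ + X%:R / _ <= _)]eq_count_tapes => r _ do rewrite cat_rcons.
have h2 : 2 ^+ k != 0 :> R by rewrite expf_neq0 // pnatr_eq0.
by rewrite le_eqVlt; apply/orP; left; apply/eqP; field.
Qed.

(** The way back, for the new algorithm. Leaf values only have to dominate the failure indicator, so
    values above 1, which arise from union bounds, do no harm. *)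
Lemma tapes_of_pw W P m G T (v : R) :
  pw W P m 0 (fun m' t' r => [/\ (t' <= T)%N, 0 <= r & G m' \/ 1 <= r]) v ->
  (forall tp, size tp = T -> exists s' k, (k <= T)%N /\ exec W P (with_tape m tp) s' k) /\
  (count_tapes (fun tp => ~~ `[< exists s' k, [/\ exec W P (with_tape m tp) s' k, (k <= T)%N &
      G (mem_of s')] >]) T)%:R <= v * 2 ^+ T.
Proof.
move=> h.
have hs p x (r : R) : reaches W P m 0 p x ->
    [/\ (x.2 <= T)%N, 0 <= r & G x.1 \/ 1 <= r] -> (size p <= T)%N.
  case: x => m' t' [k /= -> hk] [kT _ _].
  have [p' [/= e sp _]] := exec_prefix (hk [::]).
  by rewrite !cats0 in e; rewrite e; lia.
split=> [tp sz|].
  have [p [q [[m' t'] [r [-> [k /= -> hk] [kT _ _]]]]]] := pwr_total h hs sz.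
  by exists (with_tape m' q), k; split.
apply: (pwr_count h) => p x r hr hP; split; [exact: hs hr hP | by case: hP | ].
case: x hr hP => m' t' [k /= -> hk] [kT r0 [hG|//]] q sz /asboolPn[].
exists (with_tape m' q), k; split=> //.
by case: (m') hG.
Qed.

End Tapes.

(** * Running a program in a memory region *)

(* rb holds the address of the region; rt is a scratch register. *)
Fixpoint relocate (off rb rt : nat) (c : com) : com :=
  match c with
  | Skip => Skip
  | Const x v => Const (off + x) v
  | Op o x y z => Op o (off + x) (off + y) (off + z)
  | Read x y => Seq (Op OpAdd rt rb (off + y)) (Read (off + x) rt)
  | Write x y => Seq (Op OpAdd rt rb (off + x)) (Write rt (off + y))
  | Flip x => Flip (off + x)
  | Seq c1 c2 => Seq (relocate off rb rt c1) (relocate off rb rt c2)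
  | If x c1 c2 => If (off + x) (relocate off rb rt c1) (relocate off rb rt c2)
  | While x c => While (off + x) (relocate off rb rt c)
  end.

Section Relocate.
Variables (off rb rt W W' base : nat).
Hypotheses (rb_off : rb < off) (rt_off : rt < off) (rbt : rb != rt).
Hypothesis baseW : base + W <= W'.

Definition relocated (m m1 : memory) : Prop :=
  [/\ forall x, mr m1 (off + x) = mr m x,
      forall a, a < W -> mc m1 (base + a) = mc m a & mr m1 rb = base].

Definition same_outside (m m' : memory) : Prop :=
  (forall y, y < off -> y != rt -> mr m' y = mr m y) /\
  (forall a, ~~ (base <= a < base + W) -> mc m' a = mc m a).

Lemma same_outside_trans m1 m2 m3 :
  same_outside m1 m2 -> same_outside m2 m3 -> same_outside m1 m3.
Proof.
move=> [a b] [c d]; split=> [y h1 h2|y h]; first by rewrite c // a.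
by rewrite d // b.
Qed.

Lemma relocated_wr m m1 x v : relocated m m1 -> relocated (put_reg m x v) (put_reg m1 (off + x)
    v).
Proof.
move=> [h1 h2 h3]; split=> //=.
  by move=> y; rewrite /upd eqn_add2l; case: eqP.
by rewrite /upd; case: eqP => // e; lia.
Qed.

Lemma same_outside_wr m x v : same_outside m (put_reg m (off + x) v).
Proof. by split=> //= y hy _; rewrite /upd; case: eqP => // e; lia. Qed.

Lemma relocated_wr_rt m m1 v : relocated m m1 -> relocated m (put_reg m1 rt v).
Proof.
move=> [h1 h2 h3]; split=> //=.
  by move=> y; rewrite /upd; case: eqP => // e; lia.
by rewrite /upd (negbTE rbt).
Qed.

Lemma same_outside_wr_rt m v : same_outside m (put_reg m rt v).
Proof. by split=> //= y hy hr; rewrite /upd (negbTE hr). Qed.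

Lemma relocated_wc m m1 a v : a < W ->
  relocated m m1 -> relocated (put_cell m a v) (put_cell m1 (base + a) v).
Proof.
move=> ha [h1 h2 h3]; split=> //= b hb.
by rewrite /upd eqn_add2l; case: eqP => // _; exact: h2.
Qed.

Lemma same_outside_wc m a v : a < W -> same_outside m (put_cell m (base + a) v).
Proof. by move=> ha; split=> //= b hb; rewrite /upd; case: eqP => // e; lia. Qed.

(** All registers stay below W because every written word does, so every computed address falls into
    the W cells at [base]; this confines the writes of the program. A memory access costs one extra
    addition, hence the factor 2 in time. *)
Lemma exec_relocate c s s' t : exec W c s s' t -> (forall x, reg s x < W) ->
  forall m1, relocated (mem_of s) m1 ->
  (forall x, reg s' x < W) /\
  exists m2 k, [/\ k <= 2 * t, exec W' (relocate off rb rt c) (with_tape m1 (tape s))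
      (with_tape m2 (tape s')) k, relocated (mem_of s') m2 & same_outside m1 m2].
Proof.
have upd_lt (f : nat -> nat) x v : (forall y, f y < W) -> v < W -> forall y, upd f x v y < W.
  by move=> hf hv y; rewrite /upd; case: eqP.
have WW' : W <= W' by lia.
elim=> {c s s' t} /=.
- by move=> s hs m1 hr; split=> //; exists m1, 1; split=> //; exact: ExecSkip.
- move=> x v s hv hs m1 hr; split; first exact: upd_lt.
  exists (put_reg m1 (off + x) v), 1; split=> //; last exact: same_outside_wr.
    by apply: ExecConst; exact: leq_trans hv WW'.
  exact: (relocated_wr _ _ hr).
- move=> o x y z s hv hs m1 hr; split; first exact: upd_lt.
  set v := eval_binop _ _ _ in hv *.
  have ev : v = eval_binop o (mr m1 (off + y)) (mr m1 (off + z)) by have [e1 _ _] := hr;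
      rewrite !e1.
  exists (put_reg m1 (off + x) v), 1; split=> //; last exact: same_outside_wr.
    rewrite ev; apply: (ExecOp _ (s := with_tape m1 (tape s))) => /=.
    by rewrite -ev; exact: leq_trans hv WW'.
  exact: (relocated_wr _ _ hr).
- move=> x y s hv hs m1 hr; split; first exact: upd_lt.
  have [e1 e2 e3] := hr; have hy := hs y.
  exists (put_reg (put_reg m1 rt (base + reg s y)) (off + x) (cells s (reg s y))), 2.
  split=> //.
  + rewrite -[2]/(1 + 1).
    apply: (@ExecSeq _ _ _ _ (with_tape (put_reg m1 rt (base + reg s y)) (tape s))).
      have -> : base + reg s y = eval_binop OpAdd (mr m1 rb) (mr m1 (off + y)).
        by rewrite /= e3 e1.
      apply: (ExecOp _ (s := with_tape m1 (tape s))) => /=; rewrite e3 e1 /=; lia.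
    have h := @ExecRead W' (off + x) rt (with_tape (put_reg m1 rt (base + reg s y)) (tape s)).
    have er : upd (mr m1) rt (base + reg s y) rt = base + reg s y by rewrite /upd eqxx.
    rewrite /= /set_reg /= er e2 // in h.
    by apply: h; exact: leq_trans hv WW'.
  + by apply: (relocated_wr _ _ (relocated_wr_rt _ hr)).
  + exact: same_outside_trans (same_outside_wr_rt _ _) (same_outside_wr _ _ _).
- move=> x y s hx hy hs m1 hr; split=> //.
  have [e1 e2 e3] := hr.
  exists (put_cell (put_reg m1 rt (base + reg s x)) (base + reg s x) (reg s y)), 2.
  split=> //.
  + rewrite -[2]/(1 + 1).
    apply: (@ExecSeq _ _ _ _ (with_tape (put_reg m1 rt (base + reg s x)) (tape s))).
      have -> : base + reg s x = eval_binop OpAdd (mr m1 rb) (mr m1 (off + x)).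
        by rewrite /= e3 e1.
      apply: (ExecOp _ (s := with_tape m1 (tape s))) => /=; rewrite e3 e1 /=; lia.
    have h := @ExecWrite W' rt (off + y) (with_tape (put_reg m1 rt (base + reg s x)) (tape s)).
    have er : upd (mr m1) rt (base + reg s x) (off + y) = reg s y.
      by rewrite /upd ifN ?e1 //; lia.
    have et : upd (mr m1) rt (base + reg s x) rt = base + reg s x by rewrite /upd eqxx.
    rewrite /= /set_mem /= er et in h.
    by apply: h; lia.
  + exact: (relocated_wc _ hx (relocated_wr_rt _ hr)).
  + apply: same_outside_trans (same_outside_wr_rt _ _) (same_outside_wc _ _ hx).
- move=> x r m b l hb hs m1 hr; split; first exact: upd_lt.
  exists (put_reg m1 (off + x) b), 1; split=> //; last exact: same_outside_wr.
    by apply: ExecFlip; exact: leq_trans hb WW'.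
  exact: (relocated_wr _ _ hr).
- move=> c1 c2 s1 s2 s3 t1 t2 _ IH1 _ IH2 hs m1 hr.
  have [hs2 [m2 [k1 [l1 x1 r2 o2]]]] := IH1 hs _ hr.
  have [hs3 [m3 [k2 [l2 x2 r3 o3]]]] := IH2 hs2 _ r2.
  split=> //; exists m3, (k1 + k2); split=> //; first lia.
    exact: ExecSeq x1 x2.
  exact: same_outside_trans o2 o3.
- move=> x c1 c2 s s' t hx _ IH hs m1 hr.
  have [hs2 [m2 [k1 [l1 x1 r2 o2]]]] := IH hs _ hr.
  split=> //; exists m2, k1.+1; split=> //; first lia.
  by apply: ExecIfTrue => //=; case: hr => ->.
- move=> x c1 c2 s s' t hx _ IH hs m1 hr.
  have [hs2 [m2 [k1 [l1 x1 r2 o2]]]] := IH hs _ hr.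
  split=> //; exists m2, k1.+1; split=> //; first lia.
  by apply: ExecIfFalse => //=; case: hr => ->.
- move=> x c s1 s2 s3 t1 t2 hx _ IH1 _ IH2 hs m1 hr.
  have [hs2 [m2 [k1 [l1 x1 r2 o2]]]] := IH1 hs _ hr.
  have [hs3 [m3 [k2 [l2 x2 r3 o3]]]] := IH2 hs2 _ r2.
  split=> //; exists m3, (k1 + k2).+1; split=> //; first lia.
    by apply: ExecWhileTrue x1 x2 => /=; case: hr => ->.
  exact: same_outside_trans o2 o3.
- move=> x c s hx hs m1 hr; split=> //.
  exists m1, 1; split=> //; apply: ExecWhileFalse => /=.
  by case: hr => ->.
Qed.

Lemma pw_relocate (R : realFieldType) P m t (Phi Psi : memory -> nat -> R -> Prop) v m1 :
  pw W P m t Phi v -> (forall x, mr m x < W) -> relocated m m1 ->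
  (forall m' t' r m2 t2, Phi m' t' r -> relocated m' m2 -> same_outside m1 m2 ->
     (forall x, reg_bound P <= x -> mr m' x = mr m x) -> t2 + t <= 2 * t' -> Psi m2 t2 r) ->
  pw W' (relocate off rb rt P) m1 t Psi v.
Proof.
move=> h hm hr hP; apply: (pwr_map h) => p [m' t'] r [k /= -> hk] hPhi.
have [_ [m2 [k2 [l2 x2 r2 o2]]]] := exec_relocate (hk [::]) hm hr.
have [p' [/= ep _ hp]] := exec_prefix x2.
rewrite !cats0 in ep; subst p'.
exists (m2, t + k2) => /=.
  by exists k2 => // l; exact: hp l.
apply: hP hPhi _ o2 _ _; last lia.
  exact: r2.
by move=> x hx; have := exec_reg_frame (hk [::]) hx.
Qed.

End Relocate.

(** * Averages over random sequences *)

Section Averages.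
Variable R : realFieldType.
Local Open Scope ring_scope.

Definition avg (B : nat) (f : nat -> R) : R := (\sum_(x < B) f x) / B%:R.

(** [Y] is the part already drawn; new entries are prepended, so the first draw ends up last. *)
Fixpoint avg_seq (B n : nat) (f : seq nat -> R) (Y : seq nat) : R :=
  if n is n'.+1 then avg B (fun x => avg_seq B n' f (x :: Y)) else f Y.

Lemma avg_cst B a : (0 < B)%N -> avg B (fun=> a) = a.
Proof.
by move=> hB; rewrite /avg sumr_const card_ord -[a *+ B]mulr_natr mulfK // pnatr_eq0 -lt0n.
Qed.

Lemma avg_le B f g : (forall x, (x < B)%N -> f x <= g x) -> avg B f <= avg B g.
Proof. by move=> h; rewrite /avg ler_wpM2r ?invr_ge0 // ler_sum // => i _; apply: h. Qed.

Lemma eq_avg B f g : (forall x, (x < B)%N -> f x = g x) -> avg B f = avg B g.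
Proof. by move=> h; rewrite /avg; congr (_ / _); apply: eq_bigr => i _; apply: h. Qed.

Lemma avgZ B a f : avg B (fun x => a * f x) = a * avg B f.
Proof. by rewrite /avg -mulr_sumr mulrA. Qed.

Lemma avgD B f g : avg B (fun x => f x + g x) = avg B f + avg B g.
Proof. by rewrite /avg big_split mulrDl. Qed.

Lemma avg_double B f :
  avg (B + B) f = (avg B f + avg B (fun x => f (B + x)%N)) / 2.
Proof.
rewrite /avg big_split_ord /= -mulrDl natrD.
have -> : (B%:R + B%:R)^-1 = B%:R^-1 / 2 :> R by rewrite -mulr2n -[_ *+ 2]mulr_natr invfM.
by rewrite mulrA.
Qed.

Lemma avg_seq_add B m n f Y :
  avg_seq B (m + n) f Y = avg_seq B n (fun Z => avg_seq B m f Z) Y.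
Proof.
by elim: n Y => [|n IH] Y; rewrite ?addn0 // addnS /=; apply: eq_avg => x _; exact: IH.
Qed.


Lemma eq_avg_seq B n f g Y : f =1 g -> avg_seq B n f Y = avg_seq B n g Y.
Proof.
by move=> h; elim: n Y => [|n IH] Y /=; [exact: h | apply: eq_avg => x _; exact: IH].
Qed.

Lemma avg_seq_le B n f g Y : (forall X, f X <= g X) ->
  avg_seq B n f Y <= avg_seq B n g Y.
Proof.
by move=> h; elim: n Y => [|n IH] Y /=; [exact: h | apply: avg_le => x _; exact: IH].
Qed.

Lemma avg_seqZ B n a f Y : avg_seq B n (fun X => a * f X) Y = a * avg_seq B n f Y.
Proof.
by elim: n Y => //= n IH Y; rewrite -avgZ; apply: eq_avg => x _; exact: IH.
Qed.

Lemma avg_seqD B n f g Y :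
  avg_seq B n (fun X => f X + g X) Y = avg_seq B n f Y + avg_seq B n g Y.
Proof.
by elim: n Y => //= n IH Y; rewrite -avgD; apply: eq_avg => x _; exact: IH.
Qed.

Lemma avg_seq_cst B n a Y : (0 < B)%N -> avg_seq B n (fun=> a) Y = a.
Proof.
move=> hB; elim: n Y => //= n IH Y.
by rewrite (@eq_avg _ _ (fun=> a)) ?avg_cst // => x _; exact: IH.
Qed.

Lemma avg_seq_sum B n I (r : seq I) (P : pred I) (F : I -> seq nat -> R) Y : (0 < B)%N ->
  avg_seq B n (fun X => \sum_(i <- r | P i) F i X) Y =
  \sum_(i <- r | P i) avg_seq B n (F i) Y.
Proof.
move=> hB; elim: r => [|i r IH].
  under eq_avg_seq => X do rewrite big_nil.
  by rewrite big_nil avg_seq_cst.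
rewrite big_cons -IH; case hP: (P i).
  by rewrite -avg_seqD; apply: eq_avg_seq => X; rewrite big_cons hP.
by apply: eq_avg_seq => X; rewrite big_cons hP.
Qed.

(** With S the support of a vector, this is the entry of that vector in the random column t, the AND
    of k coordinates. *)
Definition block_in (S : pred nat) (k : nat) (X : seq nat) (t : nat) : bool :=
  all (fun h => S (nth 0 X (t * k + h))%N) (iota 0 k).

Definition no_block_in (S : pred nat) (k L : nat) (X : seq nat) : bool :=
  all (fun t => ~~ block_in S k X t) (iota 0 L).

(** Independence: whatever follows the block is already fixed when the block is drawn, so [a]
    factors out of the average. *)
Lemma avg_seq_block B S k (a : seq nat -> R) Z :
  avg_seq B k (fun X => a (drop k X) * (block_in S k X 0)%:R) Z =
  a Z * (avg B (fun x => (S x)%:R)) ^+ k.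
Proof.
elim: k a Z => [|k IH] a Z /=; first by rewrite drop0 /block_in expr0.
(* The entry drawn first stands last in the block, next to the remainder. Its factor is moved into
   the function of the remainder so that the induction hypothesis applies. *)
pose a' W := a (behead W) * (S (head 0%N W))%:R.
under eq_avg => x _.
  under eq_avg_seq => X.
    have -> : a (drop k.+1 X) * (block_in S k.+1 X 0)%:R =
              a' (drop k X) * (block_in S k X 0)%:R.
      have e1 : block_in S k.+1 X 0 = block_in S k X 0 && S (head 0%N (drop k X)).
        by rewrite /block_in -addn1 iotaD all_cat /= andbT -nth0 nth_drop addn0.
      have e2 : behead (drop k X) = drop k.+1 X by rewrite -drop1 drop_drop.
      rewrite e1 /a' e2.
      by case: (block_in _ _ _ _); case: (S _); rewrite /= ?mulr1 ?mulr0.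
    over.
  rewrite IH /a' /= [a Z * _]mulrC -mulrA mulrC; over.
by rewrite avgZ exprSr mulrA.
Qed.

Lemma avg_seq_no_block B S k L Y : (0 < B)%N ->
  avg_seq B (L * k) (fun X => (no_block_in S k L X)%:R) Y =
  (1 - avg B (fun x => (S x)%:R) ^+ k) ^+ L.
Proof.
move=> hB; elim: L Y => [|L IH] Y; first by rewrite mul0n expr0 /no_block_in.
rewrite mulSn avg_seq_add.
set q := _ ^+ k.
rewrite (@eq_avg_seq _ _ _ (fun Z => (1 - q) * (no_block_in S k L Z)%:R)).
  by rewrite avg_seqZ IH exprS.
move=> Z.
pose a W := (no_block_in S k L W)%:R : R.
rewrite (@eq_avg_seq _ _ _ (fun X => a (drop k X) + (-1) * (a (drop k X) * (block_in S k X
    0)%:R))).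
  rewrite avg_seqD avg_seqZ avg_seq_block.
  have -> : avg_seq B k (fun X => a (drop k X)) Z = a Z.
    (* With the full predicate the block factor is 1, which gives the average of [a] alone. *)
    have := avg_seq_block B xpredT k a Z.
    rewrite avg_cst // expr1n mulr1 => <-; apply: eq_avg_seq => X.
    by rewrite /block_in all_predT mulr1.
  by rewrite /a -/q; ring.
move=> X; rewrite /a /no_block_in /= -[1%N]addn0 iotaDl all_map.
rewrite -mulN1r.
have -> : all (preim (addn 1) (fun t => ~~ block_in S k X t)) (iota 0 L) =
    all (fun t => ~~ block_in S k (drop k X) t) (iota 0 L).
  apply: eq_all => t /=; congr (~~ _); apply: eq_all => h.
  by rewrite nth_drop; congr (S (nth _ _ _)); lia.
by case: (block_in _ _ _ _); case: (all _ _) => /=; ring.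
Qed.

Lemma bernoulli (q : R) n : 0 <= q <= 1 -> 1 - n%:R * q <= (1 - q) ^+ n.
Proof.
move=> /andP[q0 q1]; elim: n => [|n IH]; first by rewrite mul0r subr0.
rewrite exprS; apply: (@le_trans _ _ ((1 - q) * (1 - n%:R * q))).
  by rewrite -natr1; have n0 : 0 <= n%:R :> R by []; nra.
by rewrite ler_wpM2l // subr_ge0.
Qed.

(** Multiply by (1 + q)^n, which is at least 1 + n q >= 2, and use (1 - q)(1 + q) <= 1. This avoids
    the exponential function. *)
Lemma expr1B_le_half (q : R) n : 0 <= q <= 1 -> 1 <= n%:R * q -> (1 - q) ^+ n <= 2^-1.
Proof.
move=> /andP[q0 q1] hn.
have h1 : 1 + n%:R * q <= (1 + q) ^+ n.
  elim: n {hn} => [|n IH]; first by rewrite mul0r addr0.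
  rewrite exprS; apply: (@le_trans _ _ ((1 + q) * (1 + n%:R * q))).
    by rewrite -natr1; have n0 : 0 <= n%:R :> R by []; nra.
  by rewrite ler_wpM2l // addr_ge0.
have h2 : (1 - q) ^+ n * (1 + q) ^+ n <= 1.
  rewrite -exprMn exprn_ile1 //; nra.
have h3 : 0 <= (1 - q) ^+ n by rewrite exprn_ge0 // subr_ge0.
nra.
Qed.

End Averages.

(** * The random instance *)

Lemma bigminn_le (I : eqType) (r : seq I) (P : pred I) (F : I -> nat) x i :
  i \in r -> P i -> \big[minn/x]_(j <- r | P j) F j <= F i.
Proof.
move=> hr hP; elim: r hr => // j r IH; rewrite inE big_cons => /orP[/eqP<-|/IH{}IH].
  by rewrite hP geq_minl.
by case: (P j) => //; rewrite geq_min IH orbT.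
Qed.

Lemma bigminn_attained (I : Type) (r : seq I) (P : pred I) (F : I -> nat) x :
  \big[minn/x]_(j <- r | P j) F j = x \/
  exists i, P i /\ \big[minn/x]_(j <- r | P j) F j = F i.
Proof.
elim/big_rec: _ => [|i y hi IH]; first by left.
by case: (leqP (F i) y) => _ //; right; exists i.
Qed.

Section Instance.
Variables (d k : nat).

Definition row_entry (side L : nat) (X : seq nat) (v : seq bool) (q : nat) : bool :=
  if q < d + d then nth false v (q %% d) && (q %/ d == side)
  else block_in (nth false v) k X (q - (d + d)).

(* The first 2d coordinates never meet; they only keep the new vectors
   distinct, as [OV] takes sets. *)
Definition row (side L : nat) (X : seq nat) (v : bitvec d) : bitvec (d + d + L) :=
  mktuple (fun q : 'I_(d + d + L) => row_entry side L X v q).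

Definition common (a b : bitvec d) : pred nat := fun x => nth false a x && nth false b x.

Lemma block_in_common a b X t :
  block_in (common a b) k X t = block_in (nth false a) k X t && block_in (nth false b) k X t.
Proof. by rewrite /block_in -all_predI. Qed.

Lemma ip_row L X a b :
  (ip (row 0 L X a) (row 1 L X b) == 0) = no_block_in (common a b) k L X.
Proof.
rewrite /ip sum_nat_eq0; apply/forallP/allP => [h t|h q].
  rewrite mem_iota add0n => /andP[_ ht].
  have hq : d + d + t < d + d + L by rewrite ltn_add2l.
  have := h (Ordinal hq); rewrite !tnth_mktuple /= /row_entry.
  rewrite ltnNge leq_addr /= addKn -block_in_common.
  by case: block_in.
rewrite /= !tnth_mktuple /row_entry; case: ltnP => hq.
  by case: (q %/ d) => [|m]; rewrite /= ?andbF.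
rewrite -block_in_common.
have /h/negbTE -> // : q - (d + d) \in iota 0 L.
by rewrite mem_iota add0n; have := ltn_ord q; lia.
Qed.

(** Coordinate [side * d + i] of a row is coordinate i of its vector, so the padding separates rows
    whatever the random columns are; cardinalities and listings carry over. *)
Lemma row_inj side L X : side < 2 -> injective (row side L X).
Proof.
move=> hs v w e; apply: eq_from_tnth => i.
have hd : 0 < d by case: (d) i => // -[].
have hq2 : side * d + i < d + d.
  by have := ltn_ord i; case: side hs {e} => [|[]] //; lia.
have hq : side * d + i < d + d + L by lia.
have := congr1 (fun u => tnth u (Ordinal hq)) e.
rewrite !tnth_mktuple /row_entry /= hq2 modnMDl divnMDl // divn_small // addn0.
rewrite modn_small // eqxx !andbT.
by rewrite !(tnth_nth false).
Qed.

Lemma ip_le_dim (a b : bitvec d) : ip a b <= d.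
Proof.
rewrite -[leqRHS]card_ord -sum1_card; apply: leq_sum => i _; exact: leq_b1.
Qed.

Lemma minIP_le (A B : {set bitvec d}) a b : a \in A -> b \in B -> minIP A B <= ip a b.
Proof.
move=> ha hb; rewrite /minIP.
have h1 := @bigminn_le _ (index_enum (bitvec d)) (fun a => a \in A)
  (fun a => \big[minn/d]_(b in B) ip a b) d a (mem_index_enum a) ha.
have h2 := @bigminn_le _ (index_enum (bitvec d)) (fun b => b \in B)
  (ip a) d b (mem_index_enum b) hb.
exact: leq_trans h1 h2.
Qed.

Lemma minIP_attained (A B : {set bitvec d}) : A != set0 -> B != set0 ->
  exists a b, [/\ a \in A, b \in B & minIP A B = ip a b].
Proof.
move=> /set0Pn[a0 ha0] /set0Pn[b0 hb0].
(* If the fold returns its neutral element d, every pair attains the minimum, as no inner product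
   exceeds d. *)
have hd : minIP A B = d -> exists a b, [/\ a \in A, b \in B & minIP A B = ip a b].
  move=> e; exists a0, b0; split=> //; apply/eqP.
  by rewrite eqn_leq minIP_le //= e ip_le_dim.
have [e|[a [ha ea]]] := bigminn_attained (index_enum (bitvec d)) (fun a => a \in A)
  (fun a => \big[minn/d]_(b in B) ip a b) d; first exact: hd e.
have [e|[b [hb eb]]] := bigminn_attained (index_enum (bitvec d)) (fun b => b \in B)
  (ip a) d; first by apply: hd; rewrite /minIP ea e.
by exists a, b; split=> //; rewrite /minIP ea eb.
Qed.

End Instance.

(** * Survival probabilities of near and far pairs *)

Section Sampling.
Variables (R : realFieldType) (d k q : nat).
Hypotheses (k2 : 1 < k) (dq : d <= q).
Local Open Scope ring_scope.

(** Coordinates from d on hit nothing, since [nth] returns its default there; enlarging the range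
    from d to q only rescales the hit probability. *)
Lemma avg_common (a b : bitvec d) :
  avg q (fun x => (common a b x)%:R) = (ip a b)%:R / q%:R :> R.
Proof.
rewrite /avg; congr (_ / _); rewrite -natr_sum; congr (_%:R).
rewrite -(subnKC dq) big_split_ord /= [X in (_ + X)%N]big1 ?addn0 => [|i _].
  by apply: eq_bigr => i _; rewrite /common !(tnth_nth false).
by rewrite /common nth_default // size_tuple leq_addr.
Qed.

Definition has_hitless_pair (A B : {set bitvec d}) L X : bool :=
  [exists a in A, exists b in B, no_block_in (common a b) k L X].

Variables (s l : nat).
Hypotheses (s0 : (0 < s)%N) (sq : (s <= q)%N).
(** Rounded strictly up, so that N (s/q)^k > 1, while s <= q keeps N below 2 (q/s)^k. This factor 2
    is why the exponent in L is k - 2 and not k - 1. *)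
Let N := ((q ^ k) %/ (s ^ k)).+1.
Let L := (2 ^ (k - 2) * l * N)%N.

Let q0 : (0 < q)%N. Proof. exact: leq_trans sq. Qed.

(** The columns form [2 ^ (k - 2) * l] groups of N. With p = <a,b>/q >= s/q one has N p^k >= 1, so
    each group misses the pair with probability at most 1/2. *)
Lemma avg_hitless_far (a b : bitvec d) : (s <= ip a b)%N ->
  avg_seq q (L * k) (fun X => (no_block_in (common a b) k L X)%:R) [::]
    <= 2^-1 ^+ (2 ^ (k - 2) * l) :> R.
Proof.
move=> hs; rewrite avg_seq_no_block // avg_common.
have -> : L = (N * (2 ^ (k - 2) * l))%N by rewrite /L mulnC.
rewrite exprM.
set p := _ / _.
have q0' : 0 < q%:R :> R by rewrite ltr0n.
have p0 : 0 <= p by rewrite divr_ge0.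
have p1 : p <= 1 by rewrite ler_pdivrMr // mul1r ler_nat (leq_trans (ip_le_dim _ _)).
have pk01 : 0 <= p ^+ k <= 1 by rewrite exprn_ge0 // exprn_ile1.
have hp : 1 - p ^+ k >= 0 by rewrite subr_ge0; case/andP: pk01.
rewrite lerXn2r ?nnegrE ?invr_ge0 ?exprn_ge0 //.
apply: expr1B_le_half => //.
rewrite expr_div_n mulrA ler_pdivlMr ?exprn_gt0 // mul1r -!natrX -natrM ler_nat.
apply: (@leq_trans (N * s ^ k)); last by rewrite leq_mul2l leq_exp2r ?hs ?orbT //; lia.
by rewrite ltnW // ltn_ceil // expn_gt0 s0.
Qed.

(** The columns form l groups of [N * 2 ^ (k - 2)]. From N <= 2 (q/s)^k and <a,b> <= s/2 the
    expected number of hits in a group is at most 2 * 2^(k-2) / 2^k = 1/2, and Bernoulli's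
    inequality lets a group miss with probability at least 1/2. *)
Lemma avg_hitless_near (a b : bitvec d) : (2 * ip a b <= s)%N ->
  2^-1 ^+ l <= avg_seq q (L * k) (fun X => (no_block_in (common a b) k L X)%:R) [::] :> R.
Proof.
move=> hs; rewrite avg_seq_no_block // avg_common.
have -> : L = (N * 2 ^ (k - 2) * l)%N by rewrite /L; lia.
rewrite exprM.
set p := _ / _.
have q0' : 0 < q%:R :> R by rewrite ltr0n.
have p0 : 0 <= p by rewrite divr_ge0.
have p1 : p <= 1 by rewrite ler_pdivrMr // mul1r ler_nat (leq_trans (ip_le_dim _ _)).
have pk01 : 0 <= p ^+ k <= 1 by rewrite exprn_ge0 // exprn_ile1.
have hp : 1 - p ^+ k >= 0 by rewrite subr_ge0; case/andP: pk01.
rewrite lerXn2r ?nnegrE ?invr_ge0 ?exprn_ge0 //.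
apply: le_trans (bernoulli _ pk01).
suff: (N * 2 ^ (k - 2))%:R * p ^+ k <= 2^-1 :> R by lra.
rewrite expr_div_n mulrA ler_pdivrMr ?exprn_gt0 // ler_pdivlMl // -!natrX -!natrM ler_nat.
have hN : (N * s ^ k <= 2 * q ^ k)%N.
  rewrite /N mulSn addnC mul2n -addnn leq_add ?leq_trunc_div //.
  by rewrite leq_exp2r //; lia.
have hi : (2 ^ k * ip a b ^ k <= s ^ k)%N by rewrite -expnMn leq_exp2r //; lia.
have ek : (2 ^ k = 4 * 2 ^ (k - 2))%N by rewrite -{1}(subnKC k2) expnD.
have sk0 : (0 < s ^ k)%N by rewrite expn_gt0 s0.
rewrite -(leq_pmul2r sk0).
apply: (@leq_trans (2 * (2 ^ (k - 2) * ip a b ^ k) * (2 * q ^ k))).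
  have -> : (2 * (N * 2 ^ (k - 2) * ip a b ^ k) * s ^ k =
     2 * (2 ^ (k - 2) * ip a b ^ k) * (N * s ^ k))%N by ring.
  by rewrite leq_mul2l hN orbT.
have -> : (2 * (2 ^ (k - 2) * ip a b ^ k) * (2 * q ^ k) = q ^ k * (2 ^ k * ip a b ^ k))%N.
  by rewrite ek; ring.
by rewrite leq_mul2l hi orbT.
Qed.

(** Union bound over the n^2 pairs, all of which are far. *)
Lemma avg_has_hitless_far (A B : {set bitvec d}) n : #|A| = n -> #|B| = n ->
  (s <= minIP A B)%N ->
  avg_seq q (L * k) (fun X => (has_hitless_pair A B L X)%:R) [::]
    <= (n * n)%:R * 2^-1 ^+ (2 ^ (k - 2) * l) :> R.
Proof.
move=> hA hB hm.
pose F (u : bitvec d * bitvec d) X : R := (no_block_in (common u.1 u.2) k L X)%:R.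
apply: (@le_trans _ _ (avg_seq q (L * k) (fun X => \sum_(u in setX A B) F u X) [::])).
  apply: avg_seq_le => X; case hX: (has_hitless_pair A B L X).
    move/existsP: hX => [a /andP[ha /existsP[b /andP[hb h]]]].
    rewrite (bigD1 (a, b)) ?inE ?ha //= {1}/F /= h lerDl.
    by apply: sumr_ge0 => u _; rewrite ler0n.
  by apply: sumr_ge0 => u _; rewrite ler0n.
rewrite avg_seq_sum //.
apply: (@le_trans _ _ (\sum_(u in setX A B) 2^-1 ^+ (2 ^ (k - 2) * l))).
  apply: ler_sum => -[a b]; rewrite inE => /andP[/= ha hb].
  by apply: avg_hitless_far; exact: leq_trans hm (minIP_le ha hb).
by rewrite sumr_const cardsX hA hB -[_ *+ (n * n)]mulr_natl.
Qed.

(** One pair attaining the minimum is enough: if no pair survives, this one is hit. *)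
Lemma avg_has_hitless_near (A B : {set bitvec d}) : A != set0 -> B != set0 ->
  (2 * minIP A B <= s)%N ->
  avg_seq q (L * k) (fun X => (~~ has_hitless_pair A B L X)%:R) [::] <= 1 - 2^-1 ^+ l :> R.
Proof.
move=> hA hB; have [a [b [ha hb ->]]] := minIP_attained hA hB => hs.
have h := avg_hitless_near hs.
have h1 : avg_seq q (L * k) (fun X => 1 + -1 * (no_block_in (common a b) k L X)%:R) [::] <=
   1 - 2^-1 ^+ l :> R.
  by rewrite avg_seqD avg_seqZ avg_seq_cst //; lra.
apply: le_trans h1; apply: avg_seq_le => X; rewrite mulN1r.
case hn: (no_block_in _ _ _ _); last by rewrite subr0; case: has_hitless_pair.
suff -> : has_hitless_pair A B L X by rewrite subrr.
apply/existsP; exists a; rewrite ha /=.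
by apply/existsP; exists b; rewrite hb.
Qed.

End Sampling.

(** * Programs *)

Definition keeps (rs : seq nat) (m m' : memory) : Prop :=
  forall y, y \notin rs -> mr m' y = mr m y.

Lemma keeps_trans rs m1 m2 m3 : keeps rs m1 m2 -> keeps rs m2 m3 -> keeps rs m1 m3.
Proof. by move=> h1 h2 y hy; rewrite h2 // h1. Qed.

Lemma keeps_sub rs rs' m m' : {subset rs <= rs'} -> keeps rs m m' -> keeps rs' m m'.
Proof. by move=> h hk y hy; apply: hk; apply: contra hy; exact: h. Qed.

Lemma keeps_wr rs m m' x v : x \in rs -> keeps rs m m' -> keeps rs m (put_reg m' x v).
Proof.
move=> hx hk y hy; rewrite /= /upd; case: eqP => [e|_]; last exact: hk.
by rewrite e hx in hy.
Qed.

Lemma keeps_wc rs m m' a v : keeps rs m m' -> keeps rs m (put_cell m' a v).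
Proof. by []. Qed.

Lemma keeps_refl rs m : keeps rs m m.
Proof. by []. Qed.

Ltac keeps_tac := repeat first [assumption | exact: keeps_refl | apply: keeps_wr; first by [] |
    apply: keeps_wc].

Section Steps.
Variable R : realFieldType.
Local Open Scope ring_scope.

Lemma pw_opv W o x y z m t (Phi : memory -> nat -> R -> Prop) v a :
  eval_binop o (mr m y) (mr m z) = a -> (a < W)%N ->
  Phi (put_reg m x a) t.+1 v -> pw W (Op o x y z) m t Phi v.
Proof. by move=> <-; exact: pw_op. Qed.

Lemma pw_readv W x y m t (Phi : memory -> nat -> R -> Prop) v a :
  mc m (mr m y) = a -> (a < W)%N -> Phi (put_reg m x a) t.+1 v ->
  pw W (Read x y) m t Phi v.
Proof. by move=> <-; exact: pw_read. Qed.

Lemma pw_writev W x y m t (Phi : memory -> nat -> R -> Prop) v a c :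
  mr m x = a -> mr m y = c -> (a < W)%N -> (c < W)%N -> Phi (put_cell m a c) t.+1 v ->
  pw W (Write x y) m t Phi v.
Proof. by move=> <- <-; exact: pw_write. Qed.

End Steps.

Ltac regs := rewrite /= /upd /=.

Fixpoint block (cs : seq com) : com :=
  if cs is c :: cs' then (if cs' is [::] then c else Seq c (block cs')) else Skip.

Notation rN := 0 (only parsing).
Notation rD := 1 (only parsing).
Notation rBase := 2 (only parsing).
Notation rTmp := 3 (only parsing).
Notation rOne := 4 (only parsing).
Notation rZero := 5 (only parsing).
Notation rStride := 6 (only parsing).
Notation rRange := 7 (only parsing).
Notation rL := 16 (only parsing).
Notation rDim := 17 (only parsing).
Notation rDD := 18 (only parsing).
Notation rX := 21 (only parsing).
Notation rY := 22 (only parsing).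
Notation rCoin := 23 (only parsing).
Notation rCond := 24 (only parsing).
Notation rU := 25 (only parsing).
Notation rE := 26 (only parsing).
Notation rI := 27 (only parsing).
Notation rCol := 28 (only parsing).
Notation rRow := 29 (only parsing).
Notation rVal := 30 (only parsing).
Notation rAddr := 31 (only parsing).
Notation rFlag := 33 (only parsing).
Notation rZ := 34 (only parsing).
Notation rAux := 35 (only parsing).
Notation rK := 38 (only parsing).

(** * Drawing the coordinates and writing the instance *)

Definition draw : com := block
  [:: Const rX 0; Const rY 1; Op OpLt rCond rY rRange;
      While rCond (block
        [:: Flip rCoin; Op OpAdd rX rX rX; Op OpAdd rX rX rCoin;
            Op OpAdd rY rY rY; Op OpLt rCond rY rRange])].

Definition draw_regs := [:: rX; rY; rCoin; rCond].

(** [v] bounds the failure of the rest of the run for each drawn value. The bound before the draw is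
    their exact average, since fair coins produce a range that is a power of two without
    rejection. *)
Lemma pw_draw (R : realFieldType) W m t (Phi : memory -> nat -> R -> Prop) (v : nat -> R) b :
  mr m rRange = 2 ^ b -> 2 ^ b < W ->
  (forall x m' t', x < 2 ^ b -> keeps draw_regs m m' -> mc m' = mc m -> mr m' rX = x ->
     t' <= t + (6 * b + 4) -> Phi m' t' (v x)) ->
  pw W draw m t Phi (avg (2 ^ b) v).
Proof.
move=> hq hW hPhi.
have b0 : 0 < 2 ^ b by rewrite expn_gt0.
(* After b - i coins [rX] holds the leading bits, and the current bound averages v over their 2^i
   completions. *)
pose Inv i (m' : memory) t' (r : R) := [/\ keeps draw_regs m m' /\ mc m' = mc m,
  i <= b, mr m' rY = 2 ^ (b - i), mr m' rCond = (0 < i) &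
  [/\ mr m' rX < 2 ^ (b - i), t' <= t + 3 + 6 * (b - i) &
      r = avg (2 ^ i) (fun z => v (mr m' rX * 2 ^ i + z))]].
apply: pw_seq; apply: pw_const; first lia.
apply: pw_seq; apply: pw_const; first lia.
apply: pw_seq; apply: (@pw_opv _ _ _ _ _ _ _ _ _ _ (0 < b)).
- by regs; rewrite hq /=; case: (b) => // b'; rewrite expnS; lia.
- by case: (0 < b); lia.
apply: (@pw_while _ _ _ _ Inv _ _ _ b); first last.
- split; rewrite ?subnn //; first by split=> //; keeps_tac.
  by split=> //; regs; lia.
- move=> m' t' r [[hk hc] _ hy hcond [hx ht hr]]; split; first by rewrite hcond.
  rewrite hr expn0 /avg big_ord1 divr1 muln1 addn0.
  by apply: hPhi => //; rewrite ?subn0 in hx ht *; lia.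
move=> i m' t' r [[hk hc] hi hy hcond [hx ht hr]]; split; first by rewrite hcond.
have ei : b - i = (b - i.+1).+1 by lia.
have hq' : mr m' rRange = 2 ^ b by rewrite hk.
have hpow : 2 * 2 ^ (b - i.+1) <= 2 ^ b by rewrite -expnS -ei leq_exp2l // leq_subr.
set p := 2 ^ (b - i.+1) in hy hx hpow.
pose x := mr m' rX; rewrite -/x in hx hr.
apply: pw_seq; apply: (@pw_flip _ _ _ _ _ _ _
  (avg (2 ^ i) (fun z => v ((x + x) * 2 ^ i + z)))
  (avg (2 ^ i) (fun z => v ((x + x + 1) * 2 ^ i + z)))); first lia; last first.
- rewrite hr expnS mul2n -addnn avg_double.
  set a1 := avg _ _; set a2 := avg _ _; set a3 := avg _ _; set a4 := avg _ _.
  have -> : a1 = a3 by apply: eq_avg => z _; congr v; lia.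
  have -> : a2 = a4 by apply: eq_avg => z _; congr v; lia.
  lra.
- apply: pw_seq; apply: (@pw_opv _ _ _ _ _ _ _ _ _ _ (x + x)); [by regs|lia|].
  apply: pw_seq; apply: (@pw_opv _ _ _ _ _ _ _ _ _ _ (x + x + 1)); [by regs|lia|].
  apply: pw_seq; apply: (@pw_opv _ _ _ _ _ _ _ _ _ _ (2 ^ (b - i))).
  + by regs; rewrite hy ei expnS -/p; lia.
  + by rewrite ei expnS -/p; lia.
  apply: (@pw_opv _ _ _ _ _ _ _ _ _ _ (0 < i)); first 1 last.
  + by case: (0 < i); lia.
  + split=> //; [by split=> //; keeps_tac | exact: ltnW | ].
    by split; regs; rewrite ?ei ?expnS -/p //; lia.
  regs; rewrite hq' ltn_exp2l //; congr nat_of_bool; lia.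
- apply: pw_seq; apply: (@pw_opv _ _ _ _ _ _ _ _ _ _ (x + x)); [by regs|lia|].
  apply: pw_seq; apply: (@pw_opv _ _ _ _ _ _ _ _ _ _ (x + x)); [by regs; lia|lia|].
  apply: pw_seq; apply: (@pw_opv _ _ _ _ _ _ _ _ _ _ (2 ^ (b - i))).
  + by regs; rewrite hy ei expnS -/p; lia.
  + by rewrite ei expnS -/p; lia.
  apply: (@pw_opv _ _ _ _ _ _ _ _ _ _ (0 < i)); first 1 last.
  + by case: (0 < i); lia.
  + split=> //; [by split=> //; keeps_tac | exact: ltnW | ].
    by split; regs; rewrite ?ei ?expnS -/p //; lia.
  regs; rewrite hq' ltn_exp2l //; congr nat_of_bool; lia.
Qed.

Definition fill : com := block
  [:: Op OpMul rU rL rK;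
      While rU (block
        [:: Op OpSub rU rU rOne; draw; Op OpAdd rAddr rStride rU; Write rAddr rX])].

Definition fill_regs := [:: rX; rY; rCoin; rCond; rU; rAddr].

Lemma pw_fill (R : realFieldType) W m t (Phi : memory -> nat -> R -> Prop)
    (v : seq nat -> R) b s L k :
  mr m rRange = 2 ^ b -> mr m rOne = 1 -> mr m rStride = s -> mr m rL = L -> mr m rK = k ->
  2 ^ b < W -> s + L * k < W ->
  (forall X m' t', size X = L * k -> all (fun x => x < 2 ^ b) X -> keeps fill_regs m m' ->
     (forall a, mc m' a = if s <= a < s + L * k then nth 0 X (a - s) else mc m a) ->
     t' <= t + (6 * b + 9) * (L * k).+1 -> Phi m' t' (v X)) ->
  pw W fill m t Phi (avg_seq (2 ^ b) (L * k) v [::]).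
Proof.
move=> hq h1 hs hL hk hW hW2 hPhi; set u := L * k in hW2 hPhi *.
(* Cells are filled from the last one down, to agree with the order of [avg_seq]; Y lists the
   entries already written. *)
pose Inv i (m' : memory) t' (r : R) := exists2 Y : seq nat,
  [/\ keeps fill_regs m m', i <= u, mr m' rU = i &
    forall a, mc m' a = if s + i <= a < s + u then nth 0 Y (a - (s + i)) else mc m a] &
  [/\ size Y = u - i, all (fun x => x < 2 ^ b) Y, t' <= t + 1 + (6 * b + 8) * (u - i) &
      r = avg_seq (2 ^ b) i v Y].
apply: pw_seq; apply: (@pw_opv _ _ _ _ _ _ _ _ _ _ u).
- by regs; rewrite hL hk.
- lia.
apply: (@pw_while _ _ _ _ Inv _ _ _ u); first last.
- exists [::]; split; rewrite ?subnn //; last lia; first by keeps_tac.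
  by move=> a; rewrite ifF //; lia.
- move=> m' t' r [Y [hkp _ hu hc] [sY hY ht ->]]; split=> //=.
  rewrite subn0 in sY ht; apply: hPhi => //; last by rewrite -/u; lia.
  by move=> a; rewrite hc addn0.
move=> i m' t' r [Y [hkp hi hu hc] [sY hY ht ->]]; split; first by rewrite hu.
apply: pw_seq; apply: (@pw_opv _ _ _ _ _ _ _ _ _ _ i).
- by regs; rewrite hu hkp // h1; lia.
- lia.
apply: pw_seq => /=.
apply: (@pw_draw _ _ _ _ _ (fun x => avg_seq (2 ^ b) i v (x :: Y)) b) => //.
  by regs; rewrite hkp.
move=> x m2 t2 hx hk2 hc2 ex ht2.
have hkp2 : keeps fill_regs m m2.
  have hk3 : keeps fill_regs (put_reg m' rU i) m2 by apply: keeps_sub hk2; apply/allP.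
  by apply: keeps_trans hk3; keeps_tac.
apply: pw_seq; apply: (@pw_opv _ _ _ _ _ _ _ _ _ _ (s + i)).
- by regs; rewrite hkp2 // hk2 //; regs; rewrite hs.
- lia.
apply: (@pw_writev _ _ _ _ _ _ _ _ (s + i) x); regs => //; try lia.
exists (x :: Y); split=> //=; try lia.
- keeps_tac.
- by regs; rewrite hk2.
- move=> a; rewrite /upd hc2 /=; case: (eqVneq a (s + i)) => [->|hne].
    by rewrite leqnn subnn ifT //=; lia.
  rewrite hc; case: ifP => h; last by rewrite ifF //; lia.
  rewrite ifT; last lia.
  by have -> : a - (s + i) = (a - (s + i.+1)).+1 by lia.
- have -> : u - i = (u - i.+1).+1 by lia.
  by rewrite mulnS; lia.
Qed.

(** In the padding, col / d + [i < n] = 1 holds exactly when the copy is the one that belongs to the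
    side of row i: the first copy for rows of A, the second for rows of B. *)
Definition build_entry (k : nat) : com := block
  [:: Op OpDiv rI rE rDim; Op OpMod rCol rE rDim; Op OpMul rRow rI rD; Op OpLt rFlag rCol rDD;
      If rFlag
        (block [:: Op OpMod rAddr rCol rD; Op OpAdd rAddr rRow rAddr; Read rVal rAddr;
                   Op OpDiv rFlag rCol rD; Op OpLt rAux rI rN; Op OpAdd rFlag rFlag rAux;
                   Op OpEq rFlag rFlag rOne; Op OpMul rVal rVal rFlag])
        (block [:: Const rVal 1; Op OpSub rZ rCol rDD; Op OpMul rZ rZ rK; Op OpAdd rZ rZ rStride;
                   iter_com k (block
                     [:: Read rX rZ; Op OpAdd rZ rZ rOne; Op OpLt rFlag rX rD;
                         Op OpAdd rAddr rRow rX; Read rAddr rAddr; Op OpMul rAddr rAddr rFlag;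
                         Op OpMul rVal rVal rAddr])]);
      Op OpAdd rAddr rBase rE; Write rAddr rVal].

Definition build (k : nat) : com := block
  [:: Op OpMul rE rN rDim; Op OpAdd rE rE rE;
      While rE (block [:: Op OpSub rE rE rOne; build_entry k])].

Definition build_regs := [:: rE; rI; rCol; rRow; rVal; rAddr; rFlag; rZ; rAux; rX].

Definition entry n d k L (X : seq nat) (vs : nat -> seq bool) (e : nat) : bool :=
  row_entry d k (n <= e %/ (d + d + L)) L X (vs (e %/ (d + d + L))) (e %% (d + d + L)).

Section Build.
Variables (R : realFieldType) (W n d k L s q base : nat) (X : seq nat) (vs : nat -> seq bool).
Let D := d + d + L.
Hypotheses (d0 : 0 < d) (svs : forall i, size (vs i) = d)
  (sX : size X = L * k) (hX : all (fun x => x < q) X)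
  (bin : (n + n) * d + q <= s) (bX : L * k <= s) (bD : (n + n) * D <= s)
  (bbase : s + s <= base) (bW : base + s <= W) (s2 : 1 < s).

Definition build_pre (m : memory) : Prop :=
  [/\ [/\ mr m rN = n, mr m rD = d, mr m rOne = 1 & mr m rStride = s],
      [/\ mr m rDim = D, mr m rDD = d + d, mr m rK = k & mr m rBase = base],
      forall i x, i < n + n -> x < d -> mc m (i * d + x) = nth false (vs i) x,
      forall a, a < s -> mc m a <= 1 &
      forall u, u < L * k -> mc m (s + u) = nth 0 X u].

Lemma pw_build_entry m t (Phi : memory -> nat -> R -> Prop) v e :
  build_pre m -> mr m rE = e -> e < (n + n) * D ->
  (forall m' t', keeps (behead build_regs) m m' ->
     mc m' = upd (mc m) (base + e) (entry n d k L X vs e) ->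
     t' <= t + (18 + 7 * k) -> Phi m' t' v) ->
  pw W (build_entry k) m t Phi v.
Proof.
move=> [[h0 h1 h4 h6] [h17 h18 h38 h2] hin hbit hXc] he eD hPhi.
have D0 : 0 < D by rewrite /D; lia.
set i := e %/ D; set col := e %% D.
have hi : i < n + n by rewrite /i ltn_divLR.
have hcol : col < D by rewrite ltn_mod.
have hid : i * d <= s by apply: leq_trans bin; nia.
have hDs : D <= s by apply: leq_trans bD; nia.
have his : i < s by apply: leq_trans bD; nia.
apply: pw_seq; apply: (@pw_opv _ _ _ _ _ _ _ _ _ _ i); [by regs; rewrite he h17 | lia | ].
apply: pw_seq; apply: (@pw_opv _ _ _ _ _ _ _ _ _ _ col); [by regs; rewrite he h17 | lia | ].
apply: pw_seq; apply: (@pw_opv _ _ _ _ _ _ _ _ _ _ (i * d)); [by regs; rewrite h1 | lia | ].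
apply: pw_seq; apply: (@pw_opv _ _ _ _ _ _ _ _ _ _ (col < d + d)); [by regs; rewrite h18 | by
    case: (col < d + d); lia | ].
have fin (b : bool) m1 t1 : keeps (behead build_regs) m m1 -> mc m1 = mc m -> mr m1 rVal = b ->
    b = entry n d k L X vs e -> t1 <= t + (16 + 7 * k) ->
    pw W (Seq (Op OpAdd rAddr rBase rE) (Write rAddr rVal)) m1 t1 Phi v.
  move=> hk1 hc1 hv eb ht1; have bb : b <= 1 by case: (b).
  apply: pw_seq; apply: (@pw_opv _ _ _ _ _ _ _ _ _ _ (base + e)).
  - by regs; rewrite !hk1 // h2 he.
  - lia.
  apply: (@pw_writev _ _ _ _ _ _ _ _ (base + e) b); regs => //; try lia.
  apply: hPhi => /=; [by keeps_tac | by rewrite hc1 eb | lia].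
apply: pw_seq; apply: pw_if; regs => hc.
- have {}hc : col < d + d by move: hc; case: ltnP.
  have hmod : col %% d < d by rewrite ltn_mod.
  set bit : bool := nth false (vs i) (col %% d).
  apply: pw_seq; apply: (@pw_opv _ _ _ _ _ _ _ _ _ _ (col %% d)); [by regs; rewrite h1 | lia | ].
  apply: pw_seq; apply: (@pw_opv _ _ _ _ _ _ _ _ _ _ (i * d + col %% d)); [by regs | nia | ].
  apply: pw_seq; apply: (@pw_readv _ _ _ _ _ _ _ _ bit); [by regs; rewrite hin | by case:
      (bit); lia | ].
  have hdiv : col %/ d <= 1 by rewrite -ltnS ltn_divLR //; lia.
  apply: pw_seq; apply: (@pw_opv _ _ _ _ _ _ _ _ _ _ (col %/ d)); [by regs; rewrite h1 | lia | ].
  apply: pw_seq; apply: (@pw_opv _ _ _ _ _ _ _ _ _ _ (i < n)); [by regs; rewrite h0 | by case: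
      (i < n); lia | ].
  apply: pw_seq; apply: (@pw_opv _ _ _ _ _ _ _ _ _ _ (col %/ d + (i < n))); [by regs | by case:
      (i < n); lia | ].
  apply: pw_seq; apply: (@pw_opv _ _ _ _ _ _ _ _ _ _ (col %/ d == (n <= i))).
  + regs; rewrite h4; congr nat_of_bool; case: (ltnP i n) => _; move: (col %/ d) hdiv => [|[]] //.
  + by case: (_ == _); lia.
  apply: (@pw_opv _ _ _ _ _ _ _ _ _ _ (bit && (col %/ d == (n <= i)))).
  + by regs; rewrite mulnb.
  + by case: (_ && _); lia.
  apply: (fin (bit && (col %/ d == (n <= i)))) => //; [by keeps_tac | | lia].
  by rewrite /entry /row_entry -/D -/col -/i hc.
have {}hc : d + d <= col by move: hc; case: ltnP.
have hcL : col - (d + d) < L by rewrite /D in hcol; lia.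
set c := col - (d + d) in hcL *.
have hck : c * k <= L * k by rewrite leq_mul2r ltnW ?orbT.
apply: pw_seq; apply: pw_const; first lia.
apply: pw_seq; apply: (@pw_opv _ _ _ _ _ _ _ _ _ _ c); [by regs; rewrite h18 | lia | ].
apply: pw_seq; apply: (@pw_opv _ _ _ _ _ _ _ _ _ _ (c * k)); [by regs; rewrite h38 | lia | ].
apply: pw_seq; apply: (@pw_opv _ _ _ _ _ _ _ _ _ _ (c * k + s)); [by regs; rewrite h6 | lia | ].
pose bits j := all (fun h => nth false (vs i) (nth 0 X (c * k + h))) (iota 0 j).
pose Inv j m1 t1 (r : R) := [/\ keeps (behead build_regs) m m1, mc m1 = mc m,
  [/\ mr m1 rVal = bits j, mr m1 rZ = c * k + s + j & mr m1 rRow = i * d] &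
  t1 <= t + (9 + 7 * j) /\ r = v].
apply: (@pw_iter_com _ _ _ _ Inv); first last.
- split=> //=; first by keeps_tac.
    by split; regs; rewrite ?addn0.
  by split=> //; lia.
- move=> m1 t1 r [hk1 hc1 [hv _ _] [ht1 ->]]; apply: (fin (bits k)) => //; last lia.
  by rewrite /entry /row_entry -/D -/col -/i ltnNge hc /=.
move=> j m1 t1 r hj [hk1 hc1 [hv hz hr] [ht1 ->]].
have hcj : c * k + j < L * k by apply: (@leq_trans (c.+1 * k)); [lia | rewrite leq_mul2r hcL
    orbT].
set x := nth 0 X (c * k + j).
have hx : x < q by apply: (allP hX); rewrite mem_nth // sX.
apply: pw_seq; apply: (@pw_readv _ _ _ _ _ _ _ _ x); [by regs; rewrite hc1 hz addnAC [_ +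
    s]addnC hXc | lia | ].
apply: pw_seq; apply: (@pw_opv _ _ _ _ _ _ _ _ _ _ (c * k + s + j.+1)); [by regs; rewrite hz
    hk1 // h4 addn1 addnS | lia | ].
apply: pw_seq; apply: (@pw_opv _ _ _ _ _ _ _ _ _ _ (x < d)); [by regs; rewrite hk1 // h1 | by
    case: (x < d); lia | ].
apply: pw_seq; apply: (@pw_opv _ _ _ _ _ _ _ _ _ _ (i * d + x)); [by regs; rewrite hr | lia | ].
have hix : i * d + x < s.
  have : i * d + d <= (n + n) * d by rewrite -mulSnr leq_mul2r hi orbT.
  lia.
(* For x >= d this cell may belong to another row or lie past the input. It is still a bit at an
   address below s, and the flag [x < d] cancels it. *)
have hb : mc m (i * d + x) <= 1 by exact: hbit.
apply: pw_seq; apply: (@pw_readv _ _ _ _ _ _ _ _ (mc m (i * d + x))); [by regs; rewrite hc1 |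
    lia | ].
set bit : bool := nth false (vs i) x.
apply: pw_seq; apply: (@pw_opv _ _ _ _ _ _ _ _ _ _ bit).
- regs; case: (ltnP x d) => hxd; first by rewrite hin // muln1.
  by rewrite muln0 /bit nth_default // svs.
- by case: (bit); lia.
apply: (@pw_opv _ _ _ _ _ _ _ _ _ _ (bits j.+1)).
- by regs; rewrite hv mulnb /bits -addn1 iotaD all_cat /= andbT.
- by case: (bits _); lia.
split=> //=; first by keeps_tac.
split=> //; lia.
Qed.

Lemma pw_build m t (Phi : memory -> nat -> R -> Prop) v :
  build_pre m ->
  (forall m' t', keeps build_regs m m' ->
     (forall a, mc m' a = if base <= a < base + (n + n) * D
                          then entry n d k L X vs (a - base) : nat else mc m a) ->
     t' <= t + (20 + 7 * k) * ((n + n) * D).+1 -> Phi m' t' v) ->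
  pw W (build k) m t Phi v.
Proof.
move=> hpre hPhi; have [[h0 h1 h4 h6] [h17 h18 h38 h2] hin hbit hXc] := hpre.
have bE := bD; set E := (n + n) * D in bE hPhi *.
apply: pw_seq; apply: (@pw_opv _ _ _ _ _ _ _ _ _ _ (n * D)).
- by regs; rewrite h0 h17.
- by have := bD; rewrite /E mulnDl; lia.
apply: pw_seq; apply: (@pw_opv _ _ _ _ _ _ _ _ _ _ E).
- by regs; rewrite /E mulnDl.
- lia.
pose Inv e (m' : memory) t' (r : R) := [/\ keeps build_regs m m', e <= E, mr m' rE = e,
  forall a, mc m' a = if base + e <= a < base + E
                      then entry n d k L X vs (a - base) : nat else mc m a &
  t' <= t + 2 + (20 + 7 * k) * (E - e) /\ r = v].
apply: (@pw_while _ _ _ _ Inv _ _ _ E); first last.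
- split=> //=; first by keeps_tac.
    by move=> a; rewrite ifF //; lia.
  by rewrite subnn; split=> //; lia.
- move=> m' t' r [hk _ he hc [ht ->]]; split=> //.
  apply: hPhi => //; last by rewrite subn0 in ht; lia.
  by move=> a; rewrite hc addn0.
move=> e m' t' r [hk heE he hc [ht ->]]; split; first by rewrite he.
apply: pw_seq; apply: (@pw_opv _ _ _ _ _ _ _ _ _ _ e).
- by regs; rewrite he hk // h4; lia.
- lia.
have hlow a : a < base -> mc m' a = mc m a by move=> ha; rewrite hc ifF //; lia.
apply: (@pw_build_entry _ _ _ _ e) => //.
  split=> //=.
  - by split; regs; rewrite hk.
  - by split; regs; rewrite hk.
  - move=> i x hi hx; rewrite hlow ?hin //.
    have : i * d + d <= (n + n) * d by rewrite -mulSnr leq_mul2r hi orbT.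
    lia.
  - by move=> a ha; rewrite hlow ?hbit //; lia.
  - by move=> u hu; rewrite hlow ?hXc //; lia.
move=> m2 t2 hk2 hc2 ht2; split=> //.
- have hk3 : keeps build_regs (put_reg m' rE e) m2 by apply: keeps_sub hk2; apply/allP.
  by apply: keeps_trans hk3; keeps_tac.
- exact: ltnW.
- by rewrite hk2 //; regs.
- move=> a; rewrite hc2 /upd /=; case: (eqVneq a (base + e)) => [->|hne].
    by rewrite leqnn addKn ifT //; lia.
  rewrite hc; case: ifP => h; last by rewrite ifF //; lia.
  by rewrite ifT //; lia.
- split=> //; have -> : E - e = (E - e.+1).+1 by lia.
  by rewrite mulnS; lia.
Qed.

End Build.

(** * Input layout and the guarantee of the given algorithm *)

Lemma nth_flatten_uniform (T : Type) (x : T) (ss : seq (seq T)) w i c :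
  (forall r, r < size ss -> size (nth [::] ss r) = w) -> i < size ss -> c < w ->
  nth x (flatten ss) (i * w + c) = nth x (nth [::] ss i) c.
Proof.
elim: ss i => // r ss IH [|i] hw hi hc /=.
  by rewrite nth_cat (hw 0 isT) hc.
rewrite nth_cat (hw 0 isT) mulSn -addnA ltnNge leq_addr /= addKn.
by apply: IH => // j hj; exact: (hw j.+1).
Qed.

Lemma nth_input (d : nat) (s : seq (bitvec d)) v0 i x : i < size s -> x < d ->
  nth 0 [seq nat_of_bool b | b <- flatten (map val s)] (i * d + x) = nth false (nth v0 s i) x.
Proof.
move=> hi hx.
have hsz j : j < size (map val s) -> size (nth [::] (map val s) j) = d.
  by rewrite size_map => hj; rewrite (nth_map v0) // size_tuple.
have hlen : size (flatten (map val s)) = size s * d.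
  rewrite size_flatten /shape -map_comp (@eq_map _ _ _ (fun=> d)); last first.
    by move=> v /=; rewrite size_tuple.
  by elim: (s) => //= _ s' ->; rewrite mulSn.
rewrite (nth_map false) ?(nth_flatten_uniform _ hsz) ?size_map //.
  by rewrite (nth_map v0).
rewrite hlen; apply: (@leq_trans (i.+1 * d)); last by rewrite leq_mul2r hi orbT.
by rewrite mulSn; lia.
Qed.

Lemma nth_input_default (d : nat) (s : seq (bitvec d)) a : size s * d <= a ->
  nth 0 [seq nat_of_bool b | b <- flatten (map val s)] a = 0.
Proof.
move=> ha; rewrite nth_default // size_map size_flatten /shape -map_comp.
rewrite (@eq_map _ _ _ (fun=> d)); last by move=> v /=; rewrite size_tuple.
by apply: leq_trans ha; elim: (s) => //= _ s' IH; rewrite mulSn leq_add2l.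
Qed.

Lemma pw_of_solves (R : realFieldType) P (Pi : problem) n d W T (A B : {set bitvec d}) sA sB t :
  solves P Pi n d W T -> #|A| = n -> #|B| = n -> listing sA A -> listing sB B ->
  pw W P (mem_of (input n sA sB [::])) t
    (fun m' t' (v : R) => t' <= t + T /\ v = (~~ `[< Pi d A B (mr m' 0) >])%:R%R) (3^-1)%R.
Proof.
move=> hs hA hB lA lB; have [h1 h2] := hs A B sA sB hA hB lA lB.
set m := mem_of _.
have hinp r : input n sA sB r = with_tape m r by [].
apply: (@pw_conseq _ _ _ _ _ _ _ _ _ (@pw_of_tapes R W P m t (fun m' => Pi d A B (mr m' 0)) T _)).
- move=> tp /eqP sz; have [out [s' [k [hk kT _]]]] := h1 (Tuple sz).
  by exists s', k.
- set bad := count_tapes _ _.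
  have hc := count_tapesC (fun tp => `[< outcome W P m (fun m' => Pi d A B (mr m' 0)) tp >]) T.
  rewrite -/bad in hc.
  have hg : #|[set r : T.-tuple bool |
      `[< exists2 out, run W T P (input n sA sB r) out & Pi d A B out >]]| <=
      count_tapes (fun tp => `[< outcome W P m (fun m' => Pi d A B (mr m' 0)) tp >]) T.
    apply: subset_leq_card; apply/subsetP => r; rewrite !inE.
    move=> /asboolP[out [s' [k [hk kT ho]] hP]]; apply/asboolP.
    by exists s', k; split=> //=; rewrite ho.
  have : 3 * bad <= 2 ^ T by lia.
  rewrite -(ler_nat R) natrM natrX => hb.
  by rewrite ler_pdivrMr ?exprn_gt0 // ler_pdivlMl.
- by [].
Qed.

(** * Repeated calls and majority vote *)

Notation rRho2 := 10 (only parsing).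
Notation rCnt := 19 (only parsing).
Notation rRep := 20 (only parsing).
(* The registers from low_regs on are those of the relocated program. *)
Notation low_regs := 40 (only parsing).

Definition clear (mx : nat) : com :=
  foldr (fun i c => Seq (Const (low_regs + i) 0) c) Skip (iota 0 mx).

Lemma pw_clear (R : realFieldType) W mx m t (Phi : memory -> nat -> R -> Prop) v : 0 < W ->
  (forall m', (forall y, mr m' y = if low_regs <= y < low_regs + mx then 0 else mr m y) ->
     mc m' = mc m -> Phi m' (t + mx).+1 v) ->
  pw W (clear mx) m t Phi v.
Proof.
move=> hW.
suff H j i m1 t1 : (forall m', (forall y, mr m' y =
      if low_regs + i <= y < low_regs + i + j then 0 else mr m1 y) ->
      mc m' = mc m1 -> Phi m' (t1 + j).+1 v) ->
    pw W (foldr (fun i c => Seq (Const (low_regs + i) 0) c) Skip (iota i j)) m1 t1 Phi v.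
  by move=> h; apply: H => m' h1 h2; apply: h => // y; rewrite h1 addn0.
elim: j i m1 t1 => [|j IH] i m1 t1 h /=.
  apply: pw_skip; rewrite -[t1]addn0; apply: h => // y.
  by rewrite ifF //; lia.
apply: pw_seq; apply: pw_const => //; apply: IH => m' h1 h2.
rewrite addSnnS; apply: h => // y; rewrite h1 /= /upd.
case: (eqVneq y (low_regs + i)) => [->|hy]; first by rewrite ifF ?ifT //; lia.
by case: ifP => h3; [rewrite ifT //; lia | rewrite ifF //; lia].
Qed.

Definition keeps_low (rs : seq nat) (m m' : memory) : Prop :=
  forall y, y < low_regs -> y \notin rs -> mr m' y = mr m y.

Lemma keeps_low_wr rs m m' x v : x \in rs -> keeps_low rs m m' -> keeps_low rs m (put_reg m' x v).
Proof.
move=> hx hk y hy hyr; rewrite /= /upd; case: eqP => [e|_]; last exact: hk.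
by rewrite e hx in hyr.
Qed.

Lemma keeps_low_sub rs rs' m m' : {subset rs <= rs'} -> keeps_low rs m m' -> keeps_low rs' m m'.
Proof. by move=> h hk y hy hyr; apply: hk => //; apply: contra hyr; exact: h. Qed.

Lemma keeps_low_trans rs m1 m2 m3 :
  keeps_low rs m1 m2 -> keeps_low rs m2 m3 -> keeps_low rs m1 m3.
Proof. by move=> h1 h2 y hy hyr; rewrite h2 // h1. Qed.

Definition num_regs (P : com) : nat := maxn 2 (reg_bound P).

(** The stride is the word bound of the relocated program, so a new region meets no cell that an
    earlier call could have written. The vote tests for the answer 1, because a failing run may
    return any number. *)
Definition call (k : nat) (P : com) : com := block
  [:: Op OpAdd rBase rBase rStride; build k; clear (num_regs P);
      Op OpAdd low_regs rN rZero; Op OpAdd low_regs.+1 rDim rZero;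
      relocate low_regs rBase rTmp P;
      Op OpEq rAux low_regs rOne; Op OpAdd rCnt rCnt rAux].

Definition call_regs := [:: rBase; rTmp; rCnt] ++ build_regs.

Definition amplify (k : nat) (P : com) : com := block
  [:: Const rCnt 0; Op OpAdd rRep rRho2 rZero;
      While rRep (block [:: Op OpSub rRep rRep rOne; call k P])].

Definition call_cost k n D T P :=
  (20 + 7 * k) * ((n + n) * D).+1 + 2 * T + num_regs P + 6.

Section Call.
Variables (R : realFieldType) (P : com) (W n d k L s q T : nat) (X : seq nat).
Variables (A B : {set bitvec d}) (sA sB : seq (bitvec d)).
Let D := d + d + L.
Hypotheses (cA : #|A| = n) (cB : #|B| = n) (lA : listing sA A) (lB : listing sB B).
Hypothesis hsolves : solves P OV n D s T.
Hypotheses (d0 : 0 < d) (n0 : 0 < n)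
  (sX : size X = L * k) (hX : all (fun x => x < q) X)
  (bin : (n + n) * d + q <= s) (bX : L * k <= s) (bD : (n + n) * D <= s) (s2 : 1 < s).

Let v0 : bitvec d := [tuple of nseq d false].
Let vs i : seq bool := nth v0 (sA ++ sB) i.

Let size_sA : size sA = n.
Proof. by case: lA => u h; rewrite -cA -(card_uniqP u); apply: eq_card => x; rewrite h. Qed.

Let size_sB : size sB = n.
Proof. by case: lB => u h; rewrite -cB -(card_uniqP u); apply: eq_card => x; rewrite h. Qed.

Let svs i : size (vs i) = d.
Proof. by rewrite size_tuple. Qed.

Definition input_cells (a : nat) : nat :=
  nth 0 [seq nat_of_bool b | b <- flatten (map val (sA ++ sB))] a.

Lemma input_cells_le1 a : input_cells a <= 1.
Proof.
rewrite /input_cells; set r := flatten _.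
case: (ltnP a (size r)) => h; last by rewrite nth_default ?size_map.
by rewrite (nth_map false) //; case: nth.
Qed.

(** [base] is the region used last: the cells from [base + s] on are still zero, and so are the
    registers beyond those of P, which [clear] does not reset. *)
Definition call_pre base (m : memory) : Prop :=
  [/\ [/\ mr m rN = n, mr m rD = d, mr m rOne = 1, mr m rZero = 0 & mr m rStride = s],
      [/\ mr m rDim = D, mr m rDD = d + d, mr m rK = k & mr m rBase = base],
      [/\ forall a, a < s -> mc m a = input_cells a,
        forall u, u < L * k -> mc m (s + u) = nth 0 X u &
        forall a, base + s <= a -> mc m a = 0] &
      forall y, low_regs + num_regs P <= y -> mr m y = 0].

Let sA' := map (row k 0 L X) sA.
Let sB' := map (row k 1 L X) sB.

Lemma input_row_cells e : e < (n + n) * D ->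
  nth 0 [seq nat_of_bool b | b <- flatten (map val (sA' ++ sB'))] e = entry n d k L X vs e.
Proof.
move=> he; have D0 : 0 < D by rewrite /D; lia.
rewrite {1}(divn_eq e D).
have hi : e %/ D < n + n by rewrite ltn_divLR.
have hc : e %% D < D by rewrite ltn_mod.
rewrite (nth_input (row k 0 L X v0)) //; last first.
  by rewrite size_cat !size_map size_sA size_sB.
rewrite /entry -/D; set i := e %/ D in hi *; set c := e %% D in hc *.
rewrite nth_cat size_map size_sA; congr nat_of_bool.
case: (ltnP i n) => hin /=.
  rewrite /vs nth_cat size_sA hin (nth_map v0) ?size_sA //.
  by rewrite (_ : c = Ordinal hc :> nat) // -tnth_nth tnth_mktuple.
rewrite /vs nth_cat size_sA ltnNge hin /= (nth_map v0) ?size_sB; last lia.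
by rewrite (_ : c = Ordinal hc :> nat) // -tnth_nth tnth_mktuple.
Qed.

Lemma OV_rows out : OV (row k 0 L X @: A) (row k 1 L X @: B) out <->
  out = has_hitless_pair k A B L X.
Proof.
rewrite /OV.
suff -> : [exists a in row k 0 L X @: A, exists b in row k 1 L X @: B, ip a b == 0] =
  has_hitless_pair k A B L X by [].
apply/existsP/existsP => [[a' /andP[/imsetP[a ha ->] /existsP[b' /andP[/imsetP[b hb ->]]]]]|].
  by rewrite ip_row => h; exists a; rewrite ha; apply/existsP; exists b; rewrite hb.
move=> [a /andP[ha /existsP[b /andP[hb h]]]].
exists (row k 0 L X a); rewrite imset_f //=; apply/existsP; exists (row k 1 L X b).
by rewrite imset_f //= ip_row.
Qed.

Lemma listing_rows side (C : {set bitvec d}) sC : side < 2 -> listing sC C ->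
  listing (map (row k side L X) sC) (row k side L X @: C).
Proof.
move=> hs [u h]; split; first by rewrite map_inj_uniq //; exact: row_inj.
move=> x; apply/mapP/imsetP => -[y hy ->]; exists y => //; first by rewrite -h.
by rewrite h.
Qed.

(** [vg] and [vb] bound the continuation after a right and a wrong vote. Leaving them arbitrary lets
    a sequence of votes be tracked by a potential, with no separate notion of independent trials. *)
Lemma pw_call base m t (Phi : memory -> nat -> R -> Prop) vg vb :
  call_pre base m -> s <= base -> base + s + s + s <= W -> mr m rCnt + 1 < W ->
  (vg <= vb)%R ->
  (forall m' t' (ans : bool) r, call_pre (base + s) m' -> keeps_low call_regs m m' ->
     mr m' rCnt = mr m rCnt + ans ->
     t' <= t + call_cost k n D T P ->
     ((if ans == has_hitless_pair k A B L X then vg else vb) <= r)%R -> Phi m' t' r) ->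
  pw W (call k P) m t Phi (vg + (vb - vg) * 3^-1)%R.
Proof.
move=> [[h0 h1 h4 h5 h6] [h17 h18 h38 h2] [hin hXc hz] hhi] hb hW hcnt hv hPhi.
have hsW : s < W by lia.
apply: pw_seq; apply: (@pw_opv _ _ _ _ _ _ _ _ _ _ (base + s)); [by regs; rewrite h2 h6 | lia | ].
apply: pw_seq; apply: (@pw_build R W n d k L s q (base + s) X vs) => //.
- lia.
- lia.
- split=> //=.
  + move=> i x hi hx; rewrite hin; last first.
      have : i * d + d <= (n + n) * d by rewrite -mulSnr leq_mul2r hi orbT.
      lia.
    by apply: nth_input => //; rewrite size_cat size_sA size_sB.
  + by move=> a ha; rewrite hin // input_cells_le1.
move=> m2 t2 hk2 hc2 ht2.
apply: pw_seq; apply: pw_clear; first lia.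
move=> m3 hr3 hc3.
have r3 y : y < low_regs -> y \notin rBase :: build_regs -> mr m3 y = mr m y.
  move=> hy; rewrite inE => /norP[hy2 hyb].
  by rewrite hr3 ifF; [rewrite hk2 //= /upd (negbTE hy2) | lia].
have r3b : mr m3 rBase = base + s by rewrite hr3 hk2.
apply: pw_seq; apply: (@pw_opv _ _ _ _ _ _ _ _ _ _ n).
- by regs; rewrite !r3 // h0 h5 addn0.
- by nia.
apply: pw_seq; apply: (@pw_opv _ _ _ _ _ _ _ _ _ _ D).
- by regs; rewrite !r3 // h17 h5 addn0.
- by nia.
set m4 := put_reg _ _ _.
have hmx : 2 <= num_regs P by rewrite leq_maxl.
(* To the relocated program the new region is a freshly loaded input: the rows just built, zeros
   elsewhere, and cleared registers. *)
have hrel : relocated low_regs rBase s (base + s) (mem_of (input n sA' sB' [::])) m4.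
  split.
  - move=> [|[|x]]; regs => //.
    rewrite hr3; case: ifP => h; first by case: x {h}.
    rewrite hk2; first by regs; rewrite hhi ?nth_nil //; lia.
    by rewrite !inE.
  - move=> a ha; rewrite /= hc3 hc2.
    case: ifP => h; first by rewrite input_row_cells; [rewrite addKn | lia].
    rewrite /= hz; last lia.
    rewrite nth_input_default // size_cat !size_map size_sA size_sB.
    by move: h; rewrite -/D; lia.
  - by regs.
apply: pw_seq.
have hn : n < s by nia.
have hD : D < s by nia.
have hor := @pw_of_solves R P OV n D s T _ _ sA' sB' (t2 + num_regs P).+3 hsolves
  (etrans (card_imset _ (row_inj (side := 0) isT)) cA)
  (etrans (card_imset _ (row_inj (side := 1) isT)) cB)
  (listing_rows (side := 0) isT lA) (listing_rows (side := 1) isT lB).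
have hvb : (0 <= vb - vg)%R by rewrite subr_ge0.
have {}hor := pw_affine vg hvb hor.
apply: (@pw_relocate low_regs rBase rTmp s W (base + s) _ _ _ _ R P _ _ _ _ _ m4 hor) => //.
- lia.
- by move=> [|[|x]] //=; rewrite nth_nil; lia.
move=> m5 t5 r m6 t6. move=> [r' [/= ht5 hr'] er] [e1 e2 e3] [o1 o2] hfr ht6.
set good : Prop := OV _ _ _ in hr'.
apply: pw_seq; apply: (@pw_opv _ _ _ _ _ _ _ _ _ _ (mr m5 0 == 1)).
- by rewrite -(e1 0) /= (o1 rOne) //= /upd /= r3 // h4.
- by case: (_ == _); lia.
have hcnt6 : mr m6 rCnt = mr m rCnt by rewrite o1 //= /upd /= r3.
apply: (@pw_opv _ _ _ _ _ _ _ _ _ _ (mr m rCnt + (mr m5 0 == 1))).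
- by regs; rewrite hcnt6.
- by case: (_ == _); lia.
set m7 := put_reg _ rCnt _.
have low y : y < low_regs -> y \notin call_regs -> mr m7 y = mr m y.
  move=> hy hyc; rewrite /m7 /= /upd.
  have hne z : z \in call_regs -> (y == z) = false.
    by move=> hz'; apply/negP => /eqP e; rewrite e hz' in hyc.
  rewrite !hne // o1 ?hne //= /upd.
  rewrite !ifN; try lia.
  apply: r3 => //; apply: contra hyc; rewrite !inE => /orP[->//|h].
  by rewrite h !orbT.
apply: (hPhi _ _ (mr m5 0 == 1)) => //.
- split.
  + by rewrite !low.
  + by split; [rewrite low | rewrite low | rewrite low | rewrite /m7; regs].
  + have hlow a : a < base + s -> mc m6 a = mc m a.
      by move=> ha; rewrite o2 ?hc3 ?hc2 ?ifF //=; lia.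
    split.
    * by move=> a ha; rewrite hlow ?hin //; lia.
    * by move=> u hu; rewrite hlow ?hXc //; lia.
    * move=> a ha; rewrite o2 /=; last lia.
      rewrite hc3 hc2 ifF; first by apply: hz; lia.
      by rewrite -/D; lia.
  + move=> y hy; have ey : y = low_regs + (y - low_regs) by lia.
    rewrite /m7 /= /upd !ifN; try lia.
    rewrite ey e1 hfr; last by move: hy; rewrite /num_regs; lia.
    have : 2 <= y - low_regs by lia.
    by case: (y - low_regs) => [|[|z]] //=; rewrite nth_nil.
- rewrite /call_cost; lia.
rewrite er hr'; case: (pselect good) => hg.
  rewrite (asboolT hg) /= mulr0 addr0.
  by move/OV_rows: hg => ->; case: has_hitless_pair => /=; exact: lexx.
rewrite (asboolF hg) /= mulr1 addrC subrK.
by case: ifP.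
Qed.

(* The potential is the expectation of 2 ^ (number of wrong votes), which grows by
   a factor 2/3 + 2/3 per vote; the majority is wrong only if it reaches 2 ^ rho. *)
Lemma pw_amplify rho base m t (Phi : memory -> nat -> R -> Prop) vg vb :
  call_pre base m -> mr m rRho2 = 2 * rho -> s <= base ->
  base + (2 * rho) * s + s + s + s <= W -> 2 * rho + 1 < W -> (vg <= vb)%R ->
  (forall m' t' (yes : bool) r, call_pre (base + (2 * rho) * s) m' ->
     keeps_low (rRep :: call_regs) m m' -> (rho < mr m' rCnt) = yes ->
     mr m' rCnt <= 2 * rho ->
     t' <= t + 3 + (2 * rho) * (call_cost k n D T P + 2) ->
     ((if yes == has_hitless_pair k A B L X then vg else vb) <= r)%R -> Phi m' t' r) ->
  pw W (amplify k P) m t Phi (vg + (vb - vg) * (8 / 9) ^+ rho)%R.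
Proof.
move=> hpre hrho hb hW hW2 hv hPhi.
set hp := has_hitless_pair k A B L X in hPhi *.
have [[h0 h1 h4 h5 h6] _ _ _] := hpre.
pose V (i w : nat) : R := (vg + (vb - vg) * ((4 / 3) ^+ i * 2 ^+ w / 2 ^+ rho))%R.
have d0' : (0 <= vb - vg)%R by rewrite subr_ge0.
have two0 j : (0 < 2 ^+ j :> R)%R by rewrite exprn_gt0.
have c0 j : (0 <= (4 / 3) ^+ j :> R)%R by rewrite exprn_ge0 // divr_ge0.
pose Inv i (m' : memory) t' (r : R) := exists cnt,
  [/\ [/\ call_pre (base + (2 * rho - i) * s) m', keeps_low (rRep :: call_regs) m m',
      i <= 2 * rho, mr m' rRep = i & mr m' rCnt = cnt], cnt <= 2 * rho - i,
      t' <= t + 2 + (2 * rho - i) * (call_cost k n D T P + 2) &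
      (V i (if hp then 2 * rho - i - cnt else cnt)%N <= r)%R].
apply: pw_seq; apply: pw_const; first lia.
apply: pw_seq; apply: (@pw_opv _ _ _ _ _ _ _ _ _ _ (2 * rho)); [by regs; rewrite hrho h5 addn0
    | lia | ].
apply: (@pw_while _ _ _ _ Inv _ _ _ (2 * rho)); first last.
- exists 0; rewrite subnn; split=> //; last first.
  (* (4/3)^(2 rho) / 2^rho = (16/18)^rho = (8/9)^rho. *)
  + rewrite /V if_same expr0 mulr1 exprM lerD2l ler_wpM2l // -expr_div_n le_eqVlt.
    by apply/orP; left; apply/eqP; congr (_ ^+ _)%R; field.
  + lia.
  split=> //; last by do 2 (apply: keeps_low_wr; first by []).
  have [_ [a1 a2 a3 a4] [b1 b2 b3] b4] := hpre.
  rewrite mul0n addn0; split=> //.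
  by move=> y hy; rewrite /= /upd !ifN ?b4 //; lia.
- move=> m' t' r [cnt [[hp1 hk _ hrep hcnt] hc ht hV]]; split=> //.
  rewrite subn0 in hp1 hc ht hV.
  apply: (hPhi _ _ (rho < cnt)) => //; rewrite ?hcnt //; first lia.
  apply: le_trans hV; rewrite /V expr0 mul1r.
  case: eqP => he.
    by rewrite lerDl mulr_ge0 // divr_ge0 // ltW.
  (* A wrong majority contains at least rho wrong votes; equality can occur for a wrong no, since a
     tie counts as no. *)
  have hw : rho <= (if hp then 2 * rho - cnt else cnt).
    by move: he; case: (hp); case: (ltnP rho cnt) => //; lia.
  rewrite -[leLHS](subrK vg) addrC lerD2l ler_peMr // ler_pdivlMr // mul1r.
  by rewrite ler_eXn2l // ltr1n.
move=> i m' t' r [cnt [[hp1 hk hi hrep hcnt] hc ht hV]]; split; first by rewrite hrep.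
apply: pw_seq; apply: (@pw_opv _ _ _ _ _ _ _ _ _ _ i).
- by have [[_ _ g4 _ _] _ _ _] := hp1; regs; rewrite hrep g4; lia.
- lia.
set w := (if hp then _ else _) in hV.
have h43 : (V i w <= V i w.+1)%R.
  rewrite /V lerD2l ler_wpM2l //.
  apply: ler_wpM2r; first by rewrite invr_ge0 ltW.
  rewrite ler_wpM2l //.
  by rewrite ler_eXn2l // ltr1n.
have hmul : (2 * rho - i.+1) * s + s <= 2 * rho * s by nia.
(* A vote keeps w with weight 2/3 and doubles 2^w with weight 1/3, which is the factor 4/3 between V
   at i and at i + 1. *)
apply: (pw_conseq (v := (V i w + (V i w.+1 - V i w) * 3^-1)%R)); first 1 last.
- apply: le_trans hV; rewrite /V !exprS le_eqVlt; apply/orP; left; apply/eqP; field.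
  by rewrite gt_eqF.
- by move=> m1 t1 r1 h; exact: h.
apply: (@pw_call (base + (2 * rho - i.+1) * s)) => //; try by clear -hmul hW; lia.
- have [[a0 a1 a2 a3 a4] [a5 a6 a7 a8] [b1 b2 b3] b4] := hp1; split=> //.
  by move=> y hy; rewrite /= /upd ifN ?b4 //; lia.
- exact: leq_trans hb (leq_addr _ _).
- by regs; rewrite hcnt; lia.
move=> m2 t2 ans r2 hp2 hk2 hcnt2 ht2 hr2.
have e1 : 2 * rho - i = (2 * rho - i.+1).+1 by clear -hi; lia.
exists (cnt + ans); split.
- split=> //.
  + have -> // : base + (2 * rho - i) * s = base + (2 * rho - i.+1) * s + s.
    by rewrite e1 mulSn; clear; lia.
  + apply: keeps_low_trans (keeps_low_sub _ hk2); first exact: keeps_low_wr hk.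
    by move=> y hy; rewrite inE hy orbT.
  + exact: ltnW.
  + by rewrite hk2.
  + by rewrite hcnt2 /= /upd /= hcnt.
- by clear -hc e1; case: ans; lia.
- by rewrite e1 mulSn; clear -ht ht2; lia.
apply: le_trans hr2.
suff -> : (if hp then 2 * rho - i - (cnt + ans) else cnt + ans) =
   if ans == hp then w else w.+1 by case: (ans == hp).
by rewrite /w; clear -hc e1; case: (hp); case: (ans) => /=; lia.
Qed.

End Call.

(** * The search for the threshold *)

Notation rLev := 8 (only parsing).
Notation rG := 9 (only parsing).
Notation rNw := 11 (only parsing).
Notation rOut := 12 (only parsing).
Notation rJ := 13 (only parsing).
Notation rTau := 14 (only parsing).
Notation rS := 15 (only parsing).
Notation rT := 32 (only parsing).
Notation rQk := 36 (only parsing).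
Notation rSk := 37 (only parsing).
Notation rK2 := 39 (only parsing).

(** The counter runs down, so tau = j / nw decreases and nw consecutive attempts share each tau. The
    last success, the one with the smallest tau, determines the output. *)
Definition attempt (k : nat) (P : com) : com := block
  [:: Op OpSub rJ rJ rOne; Op OpDiv rTau rJ rNw; Op OpAdd rS rTau rTau; Op OpAdd rS rS rOne;
      Const rSk 1; iter_com k (Op OpMul rSk rSk rS);
      Op OpDiv rL rQk rSk; Op OpAdd rL rL rOne; Op OpMul rL rL rLev; Op OpMul rL rL rK2;
      Op OpAdd rDim rDD rL;
      fill; amplify k P;
      Op OpAdd rT rCnt rCnt; Op OpLt rCond rRho2 rT; If rCond (Op OpAdd rOut rTau rTau) Skip].

Lemma pw_pow (R : realFieldType) W acc x e m t (Phi : memory -> nat -> R -> Prop) v :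
  acc != x -> mr m acc = 1 -> mr m x ^ e < W -> 0 < mr m x ->
  (forall m', keeps [:: acc] m m' -> mc m' = mc m -> mr m' acc = mr m x ^ e ->
     Phi m' (t + e).+1 v) ->
  pw W (iter_com e (Op OpMul acc acc x)) m t Phi v.
Proof.
move=> hne h1 hW x0 hPhi.
pose Inv i (m' : memory) t' (r : R) := [/\ keeps [:: acc] m m', mc m' = mc m,
   mr m' acc = mr m x ^ i & t' = t + i /\ r = v].
apply: (@pw_iter_com _ _ _ _ Inv); first last.
- by split=> //; rewrite addn0.
- by move=> m' t' r [hk hc ha [-> ->]]; exact: hPhi.
move=> i m' t' r hi [hk hc ha [-> ->]].
apply: (@pw_opv _ _ _ _ _ _ _ _ _ _ (mr m x ^ i.+1)).
- by rewrite /= ha hk ?expnSr // inE eq_sym.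
- by apply: leq_ltn_trans hW; rewrite leq_pexp2l.
split=> //; first by apply: keeps_wr => //; rewrite mem_head.
  by rewrite /= /upd eqxx.
by rewrite addnS.
Qed.

Section Attempts.
Variables (R : realFieldType) (P : com) (W n d k b l s T : nat).
Variables (A B : {set bitvec d}) (sA sB : seq (bitvec d)).
Variables (q nw j0 rho Lmax Dmax : nat).
Hypotheses (eq_q : q = 2 ^ b) (eq_nw : nw = 4 * 2 ^ l) (eq_j0 : j0 = nw * (d.+1 %/ 2))
  (eq_rho : rho = 128 * j0) (eq_Lmax : Lmax = 2 ^ (k - 2) * l * (q ^ k).+1)
  (eq_Dmax : Dmax = d + d + Lmax).
Hypotheses (cA : #|A| = n) (cB : #|B| = n) (lA : listing sA A) (lB : listing sB B).
Hypothesis hsolves : forall D, D <= Dmax -> solves P OV n D s T.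
Hypotheses (d2 : 1 < d) (n0 : 0 < n) (k2 : 1 < k) (dq : d <= q)
  (bin : (n + n) * d + q <= s) (bL : Lmax * k <= s) (bD : (n + n) * Dmax <= s)
  (bq : q ^ k <= s) (brho : 2 * rho <= s) (s3 : 3 < s) (bW : s * s * s + 4 * s < W).

Definition env base o j (m : memory) : Prop :=
  [/\ [/\ mr m rN = n, mr m rD = d, mr m rOne = 1, mr m rZero = 0 & mr m rStride = s],
      [/\ mr m rRange = q, mr m rLev = l, mr m rNw = nw, mr m rRho2 = 2 * rho & mr m rQk = q ^ k],
      [/\ mr m rK = k, mr m rK2 = 2 ^ (k - 2), mr m rDD = d + d, mr m rBase = base & mr m rOut
          = o] &
      [/\ mr m rJ = j, forall a, a < s -> mc m a = input_cells sA sB a,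
          forall a, base + s <= a -> mc m a = 0 &
          forall y, low_regs + num_regs P <= y -> mr m y = 0]].

(* For s = 2 tau + 1 and p = (s / q)^k, the last factor N is at least 1 / p, hence
   (1 - p)^N <= 1/2; for near pairs p is 2^k times smaller and
   (1 - p)^(2^(k-2) N) >= 1/2, so that they survive with probability 2^-l. *)
Definition columns (tau : nat) : nat :=
  2 ^ (k - 2) * l * ((q ^ k) %/ ((tau + tau).+1 ^ k)).+1.

Lemma columns_le tau : columns tau <= Lmax.
Proof. by rewrite eq_Lmax leq_mul2l ltnS leq_div orbT. Qed.

(** Gives 2 tau + 1 <= d <= q, so the sampling bounds apply to s = 2 tau + 1 and outputs never
    exceed d. *)
Lemma threshold_lt j : j < j0 -> j %/ nw + j %/ nw < d.
Proof.
move=> hj; have nw0 : 0 < nw by rewrite eq_nw muln_gt0 expn_gt0.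
have : j %/ nw < d.+1 %/ 2 by rewrite ltn_divLR // mulnC -eq_j0.
have := leq_trunc_div d.+1 2; clear; lia.
Qed.

Definition attempt_cost : nat :=
  (6 * b + 9) * (Lmax * k).+1 + 2 * rho * (call_cost k n Dmax T P + 2) + k + 30.

(** The bounds [vy] and [vn] may reach 2 because they contain accumulated error terms as well as a
    failure probability. A wrong majority then costs at most 2, whence the summand 2 (8/9)^rho. *)
Lemma pw_attempt base o j m t (Phi : memory -> nat -> R -> Prop) (vy vn : R) :
  env base o j.+1 m -> s <= base -> base + 2 * rho * s + 3 * s <= W -> j < j0 ->
  (0 <= vy <= 2)%R -> (0 <= vn <= 2)%R ->
  (forall m' t' (yes : bool) r,
     env (base + 2 * rho * s) (if yes then j %/ nw + j %/ nw else o) j m' ->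
     t' <= t + attempt_cost -> ((if yes then vy else vn) <= r)%R -> Phi m' t' r) ->
  pw W (attempt k P) m t Phi
    (avg_seq q (columns (j %/ nw) * k)
       (fun X => if has_hitless_pair k A B (columns (j %/ nw)) X then vy else vn) [::]
     + 2 * (8 / 9) ^+ rho)%R.
Proof.
move=> [[h0 h1 h4 h5 h6] [h7 h8 h11 h10 h36] [h38 h39 h18 h2 h12] [h13 hin hz hhi]] hb hW hj
  /andP[vy0 vy2] /andP[vn0 vn2] hPhi.
have sW : s < W by lia.
have sW' : s.+1 < W by lia.
have s2W : s + s < W by lia.
have nw0 : 0 < nw by rewrite eq_nw muln_gt0 expn_gt0.
have q0 : 0 < q by rewrite eq_q expn_gt0.
have js : j < s.
  by apply: leq_trans brho; apply: leq_trans hj _; rewrite eq_rho; lia.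
set tau := j %/ nw in hPhi *.
have taud : tau + tau < d by exact: threshold_lt.
set L := columns tau.
have hLmax : L <= Lmax by exact: columns_le.
have hD : d + d + L <= Dmax by rewrite eq_Dmax leq_add2l.
have k0 : 0 < k by lia.
have ds : d <= s by apply: leq_trans dq _; apply: leq_trans bin; rewrite leq_addl.
have hLs : Lmax <= s by apply: leq_trans bL; rewrite leq_pmulr.
have hDs : Dmax <= s by apply: leq_trans bD; rewrite leq_pmull // addn_gt0 n0.
have sk_le : (tau + tau).+1 ^ k <= s.
  apply: leq_trans bq; rewrite leq_exp2r //; exact: leq_trans dq.
have hN : ((q ^ k) %/ ((tau + tau).+1 ^ k)).+1 <= s.+1.
  by rewrite ltnS; apply: leq_trans bq; exact: leq_div.
have ss : s <= s * s by rewrite leq_pmulr //; lia.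
have sss : s * s <= s * s * s by rewrite leq_pmulr //; lia.
set N := ((q ^ k) %/ ((tau + tau).+1 ^ k)).+1 in hN.
have small x : x <= s -> x < W by move=> hx; exact: leq_ltn_trans hx sW.
have t2s : (tau + tau).+1 <= s by exact: leq_trans taud ds.
have ts : tau <= s by apply: leq_trans (ltnW t2s); exact: leq_addr.
have oneW : 1 < W by apply: small; exact: leq_trans s3.
apply: pw_seq; apply: (@pw_opv _ _ _ _ _ _ _ _ _ _ j).
- by regs; rewrite h13 h4 subn1.
- exact: small (ltnW js).
apply: pw_seq; apply: (@pw_opv _ _ _ _ _ _ _ _ _ _ tau); [by regs; rewrite h11 | exact: small | ].
apply: pw_seq; apply: (@pw_opv _ _ _ _ _ _ _ _ _ _ (tau + tau)); [by regs | exact: small (ltnW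
    t2s) | ].
apply: pw_seq; apply: (@pw_opv _ _ _ _ _ _ _ _ _ _ (tau + tau).+1); [by regs; rewrite h4 addn1
    | exact: small | ].
apply: pw_seq; apply: pw_const; first exact: oneW.
apply: pw_seq; apply: (@pw_pow _ _ rSk rS) => //; regs; first by apply: leq_ltn_trans sW.
set m0 := put_reg _ rSk 1 => m1 hk1 hc1 e1.
have e1' : mr m1 rTau = tau /\ mr m1 rJ = j by rewrite !hk1.
have {}hk1 : keeps [:: rSk; rS; rTau; rJ] m m1.
  apply: keeps_trans (keeps_sub _ hk1); first by rewrite /m0; keeps_tac.
  by apply/allP.
have {}hc1 : mc m1 = mc m by rewrite hc1.
case: e1' => [eTau eJ].
clear m0.
have eL : N * l * 2 ^ (k - 2) = L by rewrite /L /columns -/N; ring.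
have Nl : N * l <= s.
  apply: leq_trans hLs; rewrite eq_Lmax; apply: (@leq_trans ((q ^ k).+1 * l)).
    by rewrite leq_mul2r ltnS leq_div orbT.
  by rewrite mulnC leq_mul2r leq_pmull ?expn_gt0 // orbT.
have N0 : 0 < N by [].
have eN : (q ^ k) %/ ((tau + tau).+1 ^ k) = N.-1 by [].
clearbody L N tau.
apply: pw_seq; apply: (@pw_opv _ _ _ _ _ _ _ _ _ _ N.-1); [by rewrite /= hk1 // h36 e1 eN | by
    apply: small; case: (N) hN | ].
apply: pw_seq; apply: (@pw_opv _ _ _ _ _ _ _ _ _ _ N); [by regs; rewrite hk1 // h4 addn1 prednK
    | exact: leq_ltn_trans hN sW' | ].
apply: pw_seq; apply: (@pw_opv _ _ _ _ _ _ _ _ _ _ (N * l)); [by regs; rewrite hk1 // h8 |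
    exact: small | ].
apply: pw_seq; apply: (@pw_opv _ _ _ _ _ _ _ _ _ _ L); [by regs; rewrite hk1 // h39 eL | exact:
    small (leq_trans hLmax hLs) | ].
apply: pw_seq; apply: (@pw_opv _ _ _ _ _ _ _ _ _ _ (d + d + L)); [by regs; rewrite hk1 // h18 |
    exact: small (leq_trans hD hDs) | ].
set m2 := put_reg _ rDim _.
have hk2 : keeps [:: rSk; rS; rTau; rJ; rL; rDim] m m2.
  rewrite /m2; do 5 (apply: keeps_wr; first by []).
  by apply: keeps_sub hk1; apply/allP.
have eTau2 : mr m2 rTau = tau by rewrite /m2; regs.
have eJ2 : mr m2 rJ = j by rewrite /m2; regs.
have eL2 : mr m2 rL = L by rewrite /m2; regs.
have eD2 : mr m2 rDim = d + d + L by rewrite /m2; regs.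
have hc2 : mc m2 = mc m by [].
clearbody m2.
have hLk : L * k <= s by apply: leq_trans bL; rewrite leq_mul2r hLmax orbT.
have avgE : (avg_seq q (L * k) (fun X => if has_hitless_pair k A B L X then vy else vn) [::]
     + 2 * (8 / 9) ^+ rho)%R = avg_seq q (L * k) (fun X =>
     (if has_hitless_pair k A B L X then vy else vn) + 2 * (8 / 9) ^+ rho)%R [::].
  by rewrite avg_seqD avg_seq_cst.
rewrite avgE; apply: pw_seq.
have qs : q <= s by apply: leq_trans bq; rewrite -[leqLHS]expn1 leq_pexp2l.
rewrite eq_q; apply: (@pw_fill R W m2 _ _ _ b s L k); rewrite ?eL2 ?hk2 -?eq_q //.
- exact: small.
- by apply: leq_ltn_trans s2W; rewrite leq_add2l.
move=> X m3 t3 sX hX hk3 hc3 ht3.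
apply: pw_seq.
have low3 y : y < low_regs -> y \notin [:: rSk; rS; rTau; rJ; rL; rDim] ++ fill_regs ->
    mr m3 y = mr m y.
  by move=> _; rewrite mem_cat => /norP[y1 y2]; rewrite hk3 // hk2.
have hi3 y : low_regs <= y -> mr m3 y = mr m y.
  move=> hy; rewrite hk3; last by rewrite !inE; clear -hy; lia.
  by rewrite hk2 // !inE; clear -hy; lia.
have bDL : (n + n) * (d + d + L) <= s.
  by apply: leq_trans bD; rewrite leq_mul2l hD orbT.
have hsol : solves P OV n (d + d + L) s T by exact: hsolves.
have d0 : 0 < d by exact: ltnW.
have vg2 : ((if has_hitless_pair k A B L X then vy else vn) <=
   (if has_hitless_pair k A B L X then vy else vn) + 2 :> R)%R by rewrite lerDl.
apply: (@pw_conseq _ _ _ _ _ _ _ _ _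
  (@pw_amplify R P W n d k L s q T X A B sA sB cA cB lA lB hsol d0 n0 sX hX bin hLk bDL _
     rho base m3 t3 (fun m' t' r => pw W (block [:: Op OpAdd rT rCnt rCnt;
        Op OpLt rCond rRho2 rT; If rCond (Op OpAdd rOut rTau rTau) Skip]) m' t' Phi r)
     _ _ _ _ hb _ _ vg2 _)) => //.
- exact: leq_trans s3.
- split.
  + by rewrite !low3.
  + by split; [rewrite hk3 | rewrite low3 | rewrite low3 | rewrite low3].
  + split.
    * by move=> a ha; rewrite hc3 ifF ?hc2 ?hin //; clear -ha; lia.
    * by move=> u hu; rewrite hc3 ifT ?addKn //; clear -hu; lia.
    * by move=> a ha; rewrite hc3 ifF ?hc2 ?hz //; clear -ha hb hLk; lia.
  + by move=> y hy; rewrite hi3 ?hhi //; clear -hy; lia.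
- by rewrite low3.
- by clear -hW; lia.
- by clear -brho sW'; lia.
- move=> m4 t4 yes r [[a0 a1 a2 a3 a4] [a5 a6 a7 a8] [b1 b2 b3] b4] hk4 hyes hcnt ht4 hr.
  have low4 y : y < low_regs -> y \notin [:: rSk; rS; rTau; rJ; rL; rDim] ++ fill_regs ->
      y \notin rRep :: call_regs -> mr m4 y = mr m y.
    by move=> y1 y2 y3; rewrite hk4 // low3.
  have eTau4 : mr m4 rTau = tau by rewrite hk4 // hk3.
  have eJ4 : mr m4 rJ = j by rewrite hk4 // hk3.
  set cnt := mr m4 rCnt in hyes hcnt.
  apply: pw_seq; apply: (@pw_opv _ _ _ _ _ _ _ _ _ _ (cnt + cnt)); [by regs | clear -hcnt brho
      s2W; lia | ].
  apply: pw_seq; apply: (@pw_opv _ _ _ _ _ _ _ _ _ _ yes).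
  + by regs; rewrite low4 // h10 -hyes; congr nat_of_bool; clear; lia.
  + by case: (yes); rewrite // ltnW.
  have hcost : t4.+4 <= t + attempt_cost.
    have q1 : (6 * b + 9) * (L * k).+1 <= (6 * b + 9) * (Lmax * k).+1.
      by rewrite leq_mul2l ltnS leq_mul2r hLmax !orbT.
    have q2 : 2 * rho * (call_cost k n (d + d + L) T P + 2) <=
              2 * rho * (call_cost k n Dmax T P + 2).
      rewrite leq_mul2l leq_add2r /call_cost !leq_add2r; apply/orP; right.
      by rewrite leq_mul2l ltnS leq_mul2l hD !orbT.
    by rewrite /attempt_cost; clear -q1 q2 ht4 ht3; lia.
  have vle : ((if yes then vy else vn) <= r)%R.
    apply: le_trans hr; case: (yes); case: (has_hitless_pair k A B L X) => //=.
      by apply: le_trans vy2 _; rewrite lerDr.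
    by apply: le_trans vn2 _; rewrite lerDr.
  have hc4 : forall a, a < s -> mc m4 a = input_cells sA sB a by [].
  apply: pw_if; regs => hy.
  + have {}hy : yes by case: (yes) hy.
    rewrite hy in vle.
    apply: (@pw_opv _ _ _ _ _ _ _ _ _ _ (tau + tau)); [by regs; rewrite eTau4 | exact: small
        (ltnW t2s) | ].
    apply: (hPhi _ _ true) => //.
    split; split=> //; regs; rewrite ?low4 //.
    by move=> y hy'; rewrite !ifN ?b4 //; clear -hy'; lia.
  + have {}hy : yes = false by case: (yes) hy.
    rewrite hy in vle.
    apply: pw_skip; apply: (hPhi _ _ false) => //.
    split; split=> //; regs; rewrite ?low4 //.
    by move=> y hy'; rewrite !ifN ?b4 //; clear -hy'; lia.
- by rewrite addrAC subrr add0r.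
Qed.

Local Open Scope ring_scope.

Let mu := minIP A B.
Let miss : R := 2^-1 ^+ l.
Let err : R := (n * n)%:R * 2^-1 ^+ (2 ^ (k - 2) * l) + 2 * (8 / 9) ^+ rho.

(* Failure probability, apart from the wrong votes and false alarms, when j
   attempts remain and o is the current output. The attempts with tau = mu are those
   with mu * nw <= j < mu.+1 * nw; each of them fails with probability 1 - miss. *)
Definition failure (j o : nat) : R :=
  if (o < mu)%N then 1
  else if (o <= 2 * mu)%N && (j <= mu.+1 * nw)%N then 0
  else (1 - miss) ^+ minn nw (j - mu * nw).

Let miss01 : 0 <= miss <= 1.
Proof. by rewrite exprn_ge0 ?invr_ge0 // exprn_ile1 ?invr_ge0 // invf_le1 // ler1n. Qed.

Let hit01 : 0 <= 1 - miss <= 1.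
Proof. by case/andP: miss01 => m0 m1; rewrite subr_ge0 m1 lerBlDr lerDl. Qed.

Lemma failure01 j o : 0 <= failure j o <= 1.
Proof.
have /andP[h0 h1] := hit01.
rewrite /failure; case: ifP => _; first by rewrite ler01 lexx.
by case: ifP => _; [rewrite lexx ler01 | rewrite exprn_ge0 // exprn_ile1].
Qed.

Let err_rho : 2 * (8 / 9) ^+ rho <= err.
Proof. by rewrite /err lerDr mulr_ge0 ?exprn_ge0 ?invr_ge0. Qed.

(** The potential argument: one attempt raises the expected [failure] by at most [err], which
    collects the costs of wrong majorities and false alarms. The cases follow the position of tau
    relative to mu. *)
Lemma failure_step j o : (j < j0)%N ->
  avg_seq q (columns (j %/ nw) * k) (fun X => if has_hitless_pair k A B (columns (j %/ nw)) X
     then failure j (j %/ nw + j %/ nw) else failure j o) [::] + 2 * (8 / 9) ^+ rho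
  <= err + failure j.+1 o.
Proof.
move=> hj; set tau := (j %/ nw)%N.
have nw0 : (0 < nw)%N by rewrite eq_nw muln_gt0 expn_gt0.
have q0 : (0 < q)%N by rewrite eq_q expn_gt0.
have A0 : A != set0 by rewrite -card_gt0 cA.
have B0 : B != set0 by rewrite -card_gt0 cB.
have taud : (tau + tau < d)%N by exact: threshold_lt.
have tauq : ((tau + tau).+1 <= q)%N by exact: leq_trans dq.
have htau1 : (tau * nw <= j)%N by exact: leq_trunc_div.
have htau2 : (j < tau.+1 * nw)%N by exact: ltn_ceil.
set L := columns tau.
(* For the cases in which one c bounds the outcome of both answers; only the voting error has to be
   paid. *)
have simple c : 0 <= c -> failure j (tau + tau) <= c -> failure j o <= c ->
    c <= failure j.+1 o ->
    avg_seq q (L * k) (fun X => if has_hitless_pair k A B L X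
     then failure j (tau + tau) else failure j o) [::] + 2 * (8 / 9) ^+ rho
    <= err + failure j.+1 o.
  move=> c0 h1 h2 h3; rewrite addrC; apply: lerD => //.
  apply: le_trans h3; rewrite -[leRHS](avg_seq_cst (L * k) c [::] q0).
  by apply: avg_seq_le => X; case: ifP.
have fail01 j' o' := failure01 j' o'.
have [hd|hd] := ltnP o mu.
  apply: (simple 1) => //; [by case/andP: (fail01 j (tau + tau)%N) | by case/andP: (fail01 j o)
      | ].
  by rewrite /failure hd.
(* For tau > mu all nw attempts at mu are still to come and can overwrite whatever is answered
   now. *)
have [h1|h1] := ltnP mu tau.
  have hmu : (mu.+1 * nw <= j)%N by apply: leq_trans htau1; rewrite leq_mul2r h1 orbT.
  have hmin : (nw <= j - mu * nw)%N by rewrite mulSn in hmu; clear -hmu; lia.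
  have hmin' : (nw <= j.+1 - mu * nw)%N by rewrite mulSn in hmu; clear -hmu; lia.
  have /andP[t0 t1] := hit01.
  apply: (simple ((1 - miss) ^+ nw)); first by rewrite exprn_ge0.
  - rewrite /failure (minn_idPl hmin) ifN; last by rewrite -leqNgt; clear -h1; lia.
    by rewrite ifN // negb_and -ltnNge; apply/orP; left; clear -h1; lia.
  - rewrite /failure (minn_idPl hmin) ifN -?leqNgt //.
    by case: ifP => // _; rewrite exprn_ge0.
  - rewrite /failure (minn_idPl hmin') ifN -?leqNgt // ifN //.
    by rewrite negb_and -!ltnNge ltnS hmu orbT.
have hjm : (j < mu.+1 * nw)%N by apply: leq_trans htau2 _; rewrite leq_mul2r ltnS h1 orbT.
(* At tau = mu a yes makes the output 2 mu, which is valid; a no uses up one of the nw attempts and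
   has probability at most 1 - miss. *)
have [h2|h2] := ltnP tau mu; last first.
  have etau : tau = mu by apply/eqP; rewrite eqn_leq h1 h2.
  have f0 : failure j (tau + tau) = 0.
    rewrite /failure etau ifN -?leqNgt ?leq_addr // ifT // (ltnW hjm) andbT.
    by rewrite mul2n addnn.
  have [h3|h3] := leqP o (2 * mu).
    apply: (simple 0); rewrite ?f0 //.
      by rewrite /failure ifN -?leqNgt // h3 (ltnW hjm).
    by case/andP: (fail01 j.+1 o).
  have hlt : (mu * nw <= j)%N by rewrite -etau.
  have e1 : failure j o = (1 - miss) ^+ (j - mu * nw).
    rewrite /failure ifN -?leqNgt // leqNgt h3 /= (minn_idPr _) //.
    by rewrite mulSn in hjm; clear -hjm; lia.
  have e2 : failure j.+1 o = (1 - miss) ^+ (j - mu * nw).+1.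
    rewrite /failure ifN -?leqNgt // leqNgt h3 /= -subSn // (minn_idPr _) //.
    by rewrite mulSn in hjm; clear -hjm; lia.
  rewrite addrC; apply: lerD => //.
  rewrite f0 e1 e2 exprS.
  have hn := avg_has_hitless_near R k2 dq l (ltn0Sn _) tauq A0 B0.
  have {}hn : avg_seq q (L * k) (fun X => (~~ has_hitless_pair k A B L X)%:R) [::] <= 1 - miss.
    by apply: hn; rewrite -/mu etau addnn mul2n.
  have /andP[t0 t1] := hit01.
  rewrite mulrC; apply: le_trans (ler_wpM2l (exprn_ge0 _ t0) hn).
  rewrite -avg_seqZ; apply: avg_seq_le => X.
  by case: ifP => _; rewrite ?mulr0 ?mulr1.
(* For tau < mu the attempts at mu are over, and [failure] depends on the current output alone. *)
have hjm2 : (j.+1 <= mu * nw)%N by apply: leq_trans htau2 _; rewrite leq_mul2r h2 orbT.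
have same : failure j o = failure j.+1 o.
  have ho : (o < mu)%N = false by rewrite ltnNge hd.
  rewrite /failure ho (ltnW hjm) (leq_trans hjm2) ?leq_mul2r ?leqnSn ?orbT // !andbT.
  have -> : (j - mu * nw = 0)%N by clear -hjm2; lia.
  by have -> : (j.+1 - mu * nw = 0)%N by clear -hjm2; lia.
(* A yes with mu <= 2 tau < 2 mu still gives a valid output. *)
have [h3|h3] := leqP mu (tau + tau).
  apply: (simple (failure j o)); rewrite ?same //; first by case/andP: (fail01 j.+1 o).
  rewrite {1}/failure ifN -?leqNgt // ifT; first by case/andP: (fail01 j.+1 o).
  by rewrite (ltnW hjm) andbT; clear -h2; lia.
(* Now 2 tau + 1 <= mu, so all pairs are far and a yes is a false alarm, paid by the first term of
   [err]. *)
have f1 : failure j (tau + tau) = 1 by rewrite /failure h3.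
have hn := avg_has_hitless_far R k2 dq l (ltn0Sn _) tauq cA cB h3.
rewrite -/(columns tau) -/L in hn.
rewrite f1 /err [_ + failure _ _]addrC addrA; apply: lerD => //.
apply: (@le_trans _ _ (failure j.+1 o + avg_seq q (L * k)
   (fun X => (has_hitless_pair k A B L X)%:R) [::])); last by rewrite lerD2l.
rewrite -[failure j.+1 o](avg_seq_cst (L * k) _ [::] q0) -avg_seqD.
apply: avg_seq_le => X; rewrite same.
case: ifP => _ /=; last by rewrite addr0.
by rewrite lerDr; case/andP: (fail01 j.+1 o).
Qed.

Lemma pw_attempts m t (Phi : memory -> nat -> R -> Prop) :
  env s d j0 m -> j0%:R * err <= 4^-1 ->
  (forall m' t' (r : R), mr m' rZero = 0%N -> (mr m' rOut <= d)%N -> (t' <= (t + j0 *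
      attempt_cost.+1).+1)%N -> 0 <= r ->
     (mu <= mr m' rOut <= 2 * mu)%N \/ 1 <= r -> Phi m' t' r) ->
  pw W (While rJ (attempt k P)) m t Phi (3^-1).
Proof.
move=> henv herr hPhi.
have err0 : 0 <= err.
  by apply: le_trans err_rho; rewrite mulr_ge0 ?exprn_ge0 ?divr_ge0.
pose Inv j (m' : memory) t' (r : R) := exists o,
  [/\ env (s + (j0 - j) * (2 * rho * s)) o j m', (j <= j0)%N && (o <= d)%N,
      (t' <= t + (j0 - j) * attempt_cost.+1)%N & j%:R * err + failure j o <= r].
apply: (@pw_while _ _ _ _ Inv _ _ _ j0); first last.
- exists d; rewrite subnn mul0n addn0; split; [by [] | by rewrite !leqnn | by rewrite mul0n
    addn0 | ].
  have hmu : (mu <= d)%N.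
    have [a ha] : exists a, a \in A by apply/set0Pn; rewrite -card_gt0 cA.
    have [c hc] : exists c, c \in B by apply/set0Pn; rewrite -card_gt0 cB.
    exact: leq_trans (minIP_le ha hc) (ip_le_dim _ _).
  (* 1/4 + 1/16 < 1/3. *)
  suff : failure j0 d <= 16^-1 by move=> hf; lra.
  rewrite /failure ifN -?leqNgt //.
  (* If d <= 2 mu, the initial output d is valid and no threshold above mu is tried. Otherwise all
     nw = 4 * 2^l attempts at mu are scheduled, and any 2^l of them all fail with probability at
     most 1/2. *)
  have [h1|h1] := leqP d (2 * mu).
    rewrite /= ifT ?invr_ge0 // eq_j0 mulnC leq_mul2r; apply/orP; right.
    have := leq_trunc_div d.+1 2; clear -h1; lia.
  have h2 : (mu.+1 <= d.+1 %/ 2)%N by rewrite leq_divRL //; clear -h1; lia.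
  have h3 : (nw <= j0 - mu * nw)%N.
    have : (nw * mu.+1 <= j0)%N by rewrite eq_j0 leq_mul2l h2 orbT.
    by rewrite mulnS mulnC; clear; lia.
  rewrite /= (minn_idPl h3) eq_nw mulnC exprM.
  have hh : (1 - miss) ^+ (2 ^ l) <= 2^-1.
    by apply: expr1B_le_half => //; rewrite /miss natrX -exprMn divff ?pnatr_eq0 // expr1n.
  have /andP[t0 _] := hit01.
  apply: le_trans (lerXn2r 4 _ _ hh) _; rewrite ?nnegrE ?exprn_ge0 ?invr_ge0 //.
  by rewrite exprVn -natrX.
- move=> m' t' r [o [[[_ _ _ z0 _] _ [_ _ _ _ ho] [hJ _ _ _]] /andP[_ hod] ht hr]]; split=> //.
  rewrite mul0r add0r in hr; rewrite subn0 in ht.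
  apply: hPhi => //; first by rewrite ho.
    by apply: le_trans hr; case/andP: (failure01 0 o).
  rewrite ho; move: hr; rewrite /failure sub0n minn0 expr0 leq0n andbT.
  case: ltnP => h1 /=; first by right.
  by case: leqP => h2 hr; [left | right].
move=> j m' t' r [o [henv' /andP[hj hod] ht hr]]; split; first by case: henv' => _ _ _ [-> _ _ _].
have ej : (j0 - j = (j0 - j.+1).+1)%N by clear -hj; lia.
have jerr : j%:R * err <= 4^-1.
  by apply: le_trans herr; rewrite ler_wpM2r // ler_nat ltnW.
have jerr0 : 0 <= j%:R * err by rewrite mulr_ge0.
have range o' : 0 <= j%:R * err + failure j o' <= 2.
  by have /andP[f0 f1] := failure01 j o'; apply/andP; split; lra.
set base := (s + _)%N in henv'.
have hb : (s <= base)%N by rewrite leq_addr.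
have hbW : (base + 2 * rho * s + 3 * s <= W)%N.
  have h1 : ((j0 - j.+1) * (2 * rho * s) + 2 * rho * s <= s * s * s)%N.
    rewrite addnC -mulSn; apply: (@leq_trans (s * (s * s))); last by rewrite mulnA.
    apply: leq_mul; last by rewrite leq_mul2r brho orbT.
    apply: leq_trans brho; rewrite eq_rho; clear -hj; lia.
  by rewrite /base; clear -h1 bW; lia.
have henv2 : env base o j.+1 m' by [].
have H := @pw_attempt base o j m' t'.+1 (Inv j) _ _ henv2 hb hbW hj
  (range (j %/ nw + j %/ nw)%N) (range o).
apply: pw_conseq; [apply: H | | by move=> ? ? ?; exact].
- move=> m2 t2 yes r2 henv3 ht2 hr2.
  exists (if yes then j %/ nw + j %/ nw else o)%N; split.
  + have -> // : (s + (j0 - j) * (2 * rho * s) = base + 2 * rho * s)%N.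
    by rewrite /base ej mulSn; clear; lia.
  + rewrite (ltnW hj) /=; case: (yes) => //.
    by apply: ltnW; exact: threshold_lt.
  + by rewrite ej mulSn; clear -ht ht2; lia.
  + by case: (yes) hr2.
- apply: le_trans hr.
  have -> : j.+1%:R * err + failure j.+1 o = j%:R * err + (err + failure j.+1 o).
    by rewrite -[j.+1%:R]natr1; ring.
  have := failure_step o hj; set f := fun X => _; set g := fun X => _ => hs.
  have -> : avg_seq q (columns (j %/ nw) * k) g [::] =
     j%:R * err + avg_seq q (columns (j %/ nw) * k) f [::].
    rewrite -[j%:R * err in RHS](avg_seq_cst (columns (j %/ nw) * k) _ [::] (_ : (0 < q)%N)).
      by rewrite -avg_seqD; apply: eq_avg_seq => X; rewrite /g /f; case: ifP.
    by rewrite eq_q expn_gt0.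
  by rewrite -addrA lerD2l.
Qed.

End Attempts.

(** Logarithms are replaced by loops: the first finds the least power of two that is at least d, the
    second the least l with n < 2^(c l), computing 2^l along the way in [rG]. *)
Definition setup (k c e votes : nat) : com := block
  [:: Const rOne 1; Const rK k; Const rK2 (2 ^ (k - 2)); Op OpAdd rX rN rOne;
      Const rStride 1; iter_com e (Op OpMul rStride rStride rX);
      Const rRange 1; Op OpLt rCond rRange rD;
      While rCond (block [:: Op OpAdd rRange rRange rRange; Op OpLt rCond rRange rD]);
      Const rY 1; Const rG 1; Const rLev 0; Const rRow (2 ^ c); Op OpLt rCond rY rX;
      While rCond (block [:: Op OpMul rY rY rRow; Op OpAdd rG rG rG; Op OpAdd rLev rLev rOne;
                             Op OpLt rCond rY rX]);
      Const rT 4; Op OpMul rNw rT rG;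
      Op OpAdd rJ rD rOne; Const rT 2; Op OpDiv rJ rJ rT; Op OpMul rJ rNw rJ;
      Const rT (2 * votes); Op OpMul rRho2 rT rJ;
      Const rQk 1; iter_com k (Op OpMul rQk rQk rRange);
      Op OpAdd rDD rD rD; Op OpAdd rOut rD rZero; Op OpAdd rBase rStride rZero].

Definition setup_cost (k e b l : nat) : nat := 3 * b + 5 * l + e + k + 40.

Section Setup.
Variables (R : realFieldType) (P : com) (W n d k c e b l s : nat).
Variables (sA sB : seq (bitvec d)).
Variables (q nw j0 rho votes : nat).
Hypotheses (eq_q : q = 2 ^ b) (eq_nw : nw = 4 * 2 ^ l) (eq_j0 : j0 = nw * (d.+1 %/ 2))
  (eq_rho : rho = votes * j0) (eq_s : s = n.+1 ^ e).
Hypotheses (szA : size sA = n) (szB : size sB = n) (d0 : 0 < d)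
  (dq : d <= q) (qmin : forall i, i < b -> 2 ^ i < d)
  (nl : n < 2 ^ (c * l)) (lmin : forall i, i < l -> 2 ^ (c * i) <= n) (c0 : 0 < c)
  (bin : (n + n) * d <= s) (dd_s : d + d <= s) (ds : d < s) (qs : q <= s) (ns : n < s)
  (bq : q ^ k <= s) (b2c : 2 ^ (c * l) <= s) (nws : nw <= s) (js : j0 <= s)
  (brho : 2 * rho <= s) (s4 : 4 <= s) (votes_s : 2 * votes <= s) (ks : k <= s) (k2s : 2 ^ (k -
      2) <= s)
  (cs : 2 ^ c <= s) (sW : s < W).

Lemma pw_setup m t (Phi : memory -> nat -> R -> Prop) (v : R) :
  mr m rN = n -> mr m rD = d ->
  (forall y, (y == rZero) || (low_regs <= y) -> mr m y = 0) -> mc m = input_cells sA sB ->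
  (forall m' t', env P n k l s sA sB q nw rho s d j0 m' ->
     t' <= t + setup_cost k e b l -> Phi m' t' v) ->
  pw W (setup k c e votes) m t Phi v.
Proof.
move=> h0 h1 hz ec hPhi.
have small x : x <= s -> x < W by move=> hx; exact: leq_ltn_trans hx sW.
have lit x : x <= 4 -> x < W by move=> hx; apply: small; exact: leq_trans s4.
apply: pw_seq; apply: pw_const; first exact: lit.
apply: pw_seq; apply: pw_const; first exact: small.
apply: pw_seq; apply: pw_const; first exact: small.
apply: pw_seq; apply: (@pw_opv _ _ _ _ _ _ _ _ _ _ n.+1); [by regs; rewrite h0 addn1 | exact:
    small | ].
apply: pw_seq; apply: pw_const; first exact: lit.
apply: pw_seq; apply: (@pw_pow _ _ rStride rX) => //; regs; first by rewrite -eq_s.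
set mm := put_reg _ rStride 1 => m1 hk1 hc1 e1.
have {}hk1 : keeps [:: rOne; rK; rK2; rX; rStride] m m1 /\
  [/\ mr m1 rOne = 1, mr m1 rK = k, mr m1 rK2 = 2 ^ (k - 2) & mr m1 rX = n.+1].
  split; last by rewrite !hk1.
  by apply: keeps_trans (keeps_sub _ hk1); [rewrite /mm; keeps_tac | apply/allP].
have {}hc1 : mc m1 = mc m by rewrite hc1.
clear mm; case: hk1 => hk1 [k1 k2 k3 k4]; rewrite -eq_s in e1.
apply: pw_seq; apply: pw_const; first exact: lit.
apply: pw_seq; apply: (@pw_opv _ _ _ _ _ _ _ _ _ _ (0 < b)).
- regs; rewrite hk1 // h1; case: (posnP b) => hb.
    by move: dq; rewrite eq_q hb expn0; case: ltnP.
  by have := qmin hb; rewrite expn0 => ->.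
- by case: (0 < b); exact: lit.
pose S1 := [:: rOne; rK; rK2; rX; rStride; rRange; rCond].
have boolW (x : bool) : x < W by case: x; exact: lit.
pose Inv1 i (m' : memory) t' (r : R) := [/\ keeps S1 m m' /\ mc m' = mc m, i <= b,
   [/\ mr m' rOne = 1, mr m' rK = k, mr m' rK2 = 2 ^ (k - 2), mr m' rX = n.+1 & mr m' rStride =
       s],
   mr m' rRange = 2 ^ (b - i) /\ mr m' rCond = (0 < i) &
   t' <= t + (e + 8) + 3 * (b - i) /\ r = v].
apply: pw_seq; apply: (@pw_while _ _ _ _ Inv1 _ _ _ b); first last.
- split=> //; first by split=> //; do 2 (apply: keeps_wr; first by []); apply: keeps_sub hk1;
    apply/allP.
    by rewrite subnn.
  by split=> //; clear; lia.
- move=> m2 t2 r [[hk2 hc2] _ [g1 g2 g3 g4 g5] [g6 g7] [ht2 ->]]; split=> //.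
  rewrite subn0 -eq_q in g6; rewrite subn0 in ht2; clear k1 k2 k3 k4 e1 hk1 hc1 m1.
  apply: pw_seq; apply: pw_const; first exact: lit.
  apply: pw_seq; apply: pw_const; first exact: lit.
  apply: pw_seq; apply: pw_const; first exact: lit.
  apply: pw_seq; apply: pw_const; first exact: small.
  apply: pw_seq; apply: (@pw_opv _ _ _ _ _ _ _ _ _ _ (0 < l)); [ | exact: boolW | ].
    regs; rewrite g4 ltnS; case: (posnP l) => hl.
      by move: nl; rewrite hl muln0 expn0; case: ltnP.
    by have := lmin hl; rewrite muln0 expn0 => ->.
  pose S2 := [:: rOne; rK; rK2; rX; rStride; rRange; rCond; rY; rG; rLev; rRow].
  pose Inv2 i (m' : memory) t' (r : R) := [/\ keeps S2 m m' /\ mc m' = mc m, i <= l,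
   [/\ mr m' rOne = 1, mr m' rK = k, mr m' rK2 = 2 ^ (k - 2), mr m' rX = n.+1 & mr m' rStride =
       s],
   [/\ mr m' rRange = q, mr m' rCond = (0 < i), mr m' rY = 2 ^ (c * (l - i)),
     mr m' rG = 2 ^ (l - i) & mr m' rLev = l - i] &
   [/\ mr m' rRow = 2 ^ c, t' <= t + (e + 14) + 3 * b + 5 * (l - i) & r = v]].
  apply: pw_seq; apply: (@pw_while _ _ _ _ Inv2 _ _ _ l); first last.
  + split=> //.
    * by split=> //; do 5 (apply: keeps_wr; first by []); apply: keeps_sub hk2; apply/allP.
    * by split; regs; rewrite ?subnn ?muln0.
    * by split=> //; clear -ht2; lia.
  + move=> m3 t3 r3 [[hk3 hc3] _ [f1 f2 f3 f4 f5] [f6 f7 f8 f9 f10] [f11 ht3 ->]]; split=> //.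
    rewrite subn0 in f8 f9 f10 ht3; clear g1 g2 g3 g4 g5 g6 g7 hk2 hc2 m2.
    have d1s : d.+1 %/ 2 <= s by apply: leq_trans ds; exact: leq_div.
    apply: pw_seq; apply: pw_const; first exact: lit.
    apply: pw_seq; apply: (@pw_opv _ _ _ _ _ _ _ _ _ _ nw); [by regs; rewrite f9 | exact: small
        | ].
    apply: pw_seq; apply: (@pw_opv _ _ _ _ _ _ _ _ _ _ d.+1); [by regs; rewrite f1 hk3 // h1
        addn1 | exact: small | ].
    apply: pw_seq; apply: pw_const; first exact: lit.
    apply: pw_seq; apply: (@pw_opv _ _ _ _ _ _ _ _ _ _ (d.+1 %/ 2)); [by regs | exact: small | ].
    apply: pw_seq; apply: (@pw_opv _ _ _ _ _ _ _ _ _ _ j0); [by regs | exact: small | ].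
    apply: pw_seq; apply: pw_const; first exact: small.
    apply: pw_seq; apply: (@pw_opv _ _ _ _ _ _ _ _ _ _ (2 * rho)); [by rewrite eq_rho mulnA |
        exact: small | ].
    apply: pw_seq; apply: pw_const; first exact: lit.
    apply: pw_seq; apply: (@pw_pow _ _ rQk rRange) => //; regs; rewrite ?f6.
    * exact: small.
    * by rewrite eq_q expn_gt0.
    set mm := put_reg _ rQk 1 => m4 hk4 hc4 e4.
    have {}hk4 : [/\ keeps [:: rT; rNw; rJ; rRho2; rQk] m3 m4, mr m4 rNw = nw, mr m4 rJ = j0 &
        mr m4 rRho2 = 2 * rho].
      split; [ | by rewrite !hk4 | by rewrite !hk4 | by rewrite !hk4].
      by apply: keeps_trans (keeps_sub _ hk4); [rewrite /mm; keeps_tac | apply/allP].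
    have {}hc4 : mc m4 = mc m by rewrite hc4.
    clear mm; case: hk4 => hk4 x1 x2 x3.
    apply: pw_seq; apply: (@pw_opv _ _ _ _ _ _ _ _ _ _ (d + d)); [by regs; rewrite hk4 // hk3
        // h1 | exact: small | ].
    apply: pw_seq; apply: (@pw_opv _ _ _ _ _ _ _ _ _ _ d); [by regs; rewrite !hk4 // !hk3 // h1
        hz // addn0 | exact: small (ltnW ds) | ].
    apply: (@pw_opv _ _ _ _ _ _ _ _ _ _ s); [by regs; rewrite !hk4 // f5 hk3 // hz // addn0 |
        exact: small | ].
    apply: hPhi; last by rewrite /setup_cost; clear -ht3; lia.
    split.
    * by split; regs; rewrite hk4 ?f1 ?f5 //; rewrite hk3 ?h0 ?h1 ?hz.
    * by split; regs; rewrite ?x1 ?x2 ?x3 ?e4 //; rewrite hk4.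
    * by split; regs; rewrite ?hk4.
    split; first by regs.
    * by move=> a _; rewrite hc4 ec.
    * move=> a ha; rewrite hc4 ec /input_cells nth_input_default // size_cat szA szB.
      by apply: leq_trans bin _; clear -ha; lia.
    * move=> y hy; have y0 : low_regs <= y by clear -hy; lia.
      rewrite /= /upd !ifN; try by clear -y0; lia.
      rewrite hk4; last by rewrite !inE; clear -y0; lia.
      rewrite hk3; last by rewrite !inE; clear -y0; lia.
      by rewrite hz // y0 orbT.
  move=> i m3 t3 r3 [[hk3 hc3] hi [f1 f2 f3 f4 f5] [f6 f7 f8 f9 f10] [f11 ht3 ->]].
  split; first by rewrite f7.
  have ei : l - i = (l - i.+1).+1 by clear -hi; lia.
  have hpw : 2 ^ (c * (l - i)) <= s.
    by apply: leq_trans b2c; rewrite leq_exp2l // leq_mul2l leq_subr orbT.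
  have hpg : 2 ^ (l - i) <= s.
    by apply: leq_trans hpw; rewrite leq_exp2l // leq_pmull.
  apply: pw_seq; apply: (@pw_opv _ _ _ _ _ _ _ _ _ _ (2 ^ (c * (l - i)))).
  + by regs; rewrite f8 f11 -expnD ei mulnS addnC.
  + exact: small.
  apply: pw_seq; apply: (@pw_opv _ _ _ _ _ _ _ _ _ _ (2 ^ (l - i))).
  + by regs; rewrite f9 ei expnS mul2n addnn.
  + exact: small.
  apply: pw_seq; apply: (@pw_opv _ _ _ _ _ _ _ _ _ _ (l - i)).
  + by regs; rewrite f10 f1 ei addn1.
  + by apply: small; apply: leq_trans hpg; rewrite ltnW // ltn_expl.
  apply: (@pw_opv _ _ _ _ _ _ _ _ _ _ (0 < i)); [ | exact: boolW | ].
    regs; rewrite f4 ltnS; case: (posnP i) => hi0.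
      by rewrite hi0 subn0 leqNgt nl.
    by rewrite lmin //; clear -hi hi0; lia.
  split=> //.
  + by split=> //; keeps_tac.
  + exact: ltnW.
  + by split=> //; rewrite ei mulnS; clear -ht3; lia.
move=> i m2 t2 r [[hk2 hc2] hi [g1 g2 g3 g4 g5] [g6 g7] [ht2 ->]]; split; first by rewrite g7.
have ei : b - i = (b - i.+1).+1 by clear -hi; lia.
apply: pw_seq; apply: (@pw_opv _ _ _ _ _ _ _ _ _ _ (2 ^ (b - i))).
- by regs; rewrite g6 ei expnS mul2n addnn.
- by apply: small; apply: leq_trans qs; rewrite eq_q leq_exp2l // leq_subr.
apply: (@pw_opv _ _ _ _ _ _ _ _ _ _ (0 < i)); [ | exact: boolW | ].
  regs; rewrite hk2 // h1; case: (posnP i) => hi0.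
    by rewrite hi0 subn0 -eq_q ltnNge dq.
  by rewrite qmin //; clear -hi hi0; lia.
split=> //.
- by split=> //; keeps_tac.
- exact: ltnW.
- by split=> //; rewrite ei mulnS; clear -ht2; lia.
Qed.

End Setup.

(** * The two reductions *)

Definition tiny : com := block
  [:: Const rX 0; Read rY rX; Const rX 1; Read rX rX; Op OpMul rN rY rX].

Definition approx_min_ip (k c e votes : nat) (P : com) : com := block
  [:: Const rT 2; Op OpLt rCond rD rT;
      If rCond tiny
        (block [:: setup k c e votes; While rJ (attempt k P); Op OpAdd rN rOut rZero])].

Lemma solves_leW P Pi n d W W' T : W <= W' -> solves P Pi n d W T -> solves P Pi n d W' T.
Proof.
move=> hW h A B sA sB cA cB lA lB; have [h1 h2] := h A B sA sB cA cB lA lB.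
have hr r out : run W T P (input n sA sB r) out -> run W' T P (input n sA sB r) out.
  by move=> [s' [t [hx ht ho]]]; exists s', t; split=> //; exact: exec_leW hx.
split=> [r|]; first by have [out ho] := h1 r; exists out; exact: hr.
apply: leq_trans h2 _; rewrite leq_mul2l /=; apply: subset_leq_card.
apply/subsetP => r; rewrite !inE => /asboolP[out ho hP].
by apply/asboolP; exists out => //; exact: hr.
Qed.

Lemma solves_of_pw (R : realFieldType) P (Pi : problem) n d W T :
  (forall (A B : {set bitvec d}) sA sB, #|A| = n -> #|B| = n -> listing sA A -> listing sB B ->
     pw W P (mem_of (input n sA sB [::])) 0
       (fun m' t' (r : R) => [/\ t' <= T, (0 <= r)%R & Pi d A B (mr m' 0) \/ (1 <= r)%R])
       (3^-1)%R) ->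
  solves P Pi n d W T.
Proof.
move=> h A B sA sB cA cB lA lB.
have [h1 h2] := @tapes_of_pw R W P _ (fun m' => Pi d A B (mr m' 0)) T _ (h A B sA sB cA cB lA lB).
have hinp r : input n sA sB r = with_tape (mem_of (input n sA sB [::])) r by [].
split=> [r|].
  have [s' [k [hk hx]]] := h1 r (size_tuple r).
  by exists (reg s' 0), s', k.
set bad := count_tapes _ _ in h2.
pose f tp := `[< exists s' k, [/\ exec W P (with_tape (mem_of (input n sA sB [::])) tp) s' k,
  k <= T & Pi d A B (mr (mem_of s') 0)] >].
have hc : count_tapes f T + bad = 2 ^ T := count_tapesC f T.
have hb : 3 * bad <= 2 ^ T.
  rewrite -(ler_nat R) natrM natrX; have {}h2 := ler_wpM2l (ler0n R 3) h2.
  by rewrite mulrA divff ?mul1r // pnatr_eq0 in h2.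
have hle : count_tapes f T <= #|[set r : T.-tuple bool |
    `[< exists2 out, run W T P (input n sA sB r) out & Pi d A B out >]]|.
  apply: subset_leq_card; apply/subsetP => r; rewrite !inE => /asboolP[s' [k [hx hk hP]]].
  by apply/asboolP; exists (reg s' 0) => //; exists s', k.
lia.
Qed.

Lemma pw_oracle (R : realFieldType) P (Pi : problem) n d W T (A B : {set bitvec d}) sA sB t
    (Phi : memory -> nat -> R -> Prop) :
  solves P Pi n d W T -> #|A| = n -> #|B| = n -> listing sA A -> listing sB B ->
  (forall m' t' r, t' <= t + T -> (0 <= r)%R -> Pi d A B (mr m' 0) \/ (1 <= r)%R -> Phi m' t'
      r) ->
  pw W P (mem_of (input n sA sB [::])) t Phi (3^-1)%R.
Proof.
move=> hs cA cB lA lB h.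
apply: pw_conseq (pw_of_solves R t hs cA cB lA lB) (lexx _) _ => m' t' r [ht ->].
apply: h => //.
by case: (pselect (Pi d A B (mr m' 0))) => hP; [left | right; rewrite asboolF].
Qed.

Definition is_zero (P : com) : com := block [:: P; Const 1 0; Op OpEq 0 0 1].

Lemma minIP_eq0 d (A B : {set bitvec d}) : A != set0 -> B != set0 ->
  (minIP A B == 0) = [exists a in A, exists b in B, ip a b == 0].
Proof.
move=> hA hB; apply/idP/existsP => [h|[a /andP[ha /existsP[b /andP[hb h]]]]].
  have [a [b [ha hb e]]] := minIP_attained hA hB.
  by exists a; rewrite ha; apply/existsP; exists b; rewrite hb -e.
by rewrite -leqn0 (leq_trans (minIP_le ha hb)) // leqn0.
Qed.

Lemma solves_is_zero P n d W T : 0 < n -> 1 < W ->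
  solves P MA_MinIP n d W T -> solves (is_zero P) OV n d W (T + 2).
Proof.
move=> n0 W1 hs; apply: (@solves_of_pw rat) => A B sA sB cA cB lA lB.
have hA : A != set0 by rewrite -card_gt0 cA.
have hB : B != set0 by rewrite -card_gt0 cB.
apply: pw_seq; apply: (pw_oracle hs cA cB lA lB) => m' t' r ht r0 hr.
apply: pw_seq; apply: pw_const; first lia.
apply: pw_op; first by rewrite /=; case: (_ == _); lia.
split=> //=; first lia.
case: hr => [hr|]; [left | by right].
rewrite /OV -minIP_eq0 // /upd /=; congr nat_of_bool.
by move: hr; rewrite /MA_MinIP; case: (minIP A B) => [|x]; case: (mr m' 0).
Qed.

Lemma listing_size d (A : {set bitvec d}) sA : listing sA A -> size sA = #|A|.
Proof. by case=> u h; rewrite -(card_uniqP u); apply: eq_card => x; rewrite h. Qed.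

(** For d = 0 all cells are 0. For d = 1 there are only two vectors, so n <= 2: if n = 1 the two
    cells are the only pair, and if n = 2 both sets are full, the minimum is 0, and the first two
    cells are the distinct vectors of A, one of which is 0. *)
Lemma tiny_correct d (A B : {set bitvec d}) sA sB n : d < 2 -> 0 < n ->
  #|A| = n -> #|B| = n -> listing sA A -> listing sB B ->
  input_cells sA sB 0 * input_cells sA sB 1 = minIP A B.
Proof.
move=> d2 n0 cA cB lA lB.
have hA : A != set0 by rewrite -card_gt0 cA.
have hB : B != set0 by rewrite -card_gt0 cB.
have [a [b [ha hb em]]] := minIP_attained hA hB.
have szA : size sA = n by rewrite (listing_size lA).
have szB : size sB = n by rewrite (listing_size lB).
rewrite em.
case: d d2 A B sA sB cA cB lA lB hA hB a b ha hb em szA szB => [|[|//]] _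
  A B sA sB cA cB lA lB hA hB a b ha hb em szA szB.
  by rewrite /input_cells nth_input_default ?muln0 // mul0n /ip big_ord0.
have cell i v : nth v (sA ++ sB) i = v -> i < n + n ->
    input_cells sA sB i = tnth v ord0 :> nat.
  move=> hv hi; rewrite /input_cells -[i in LHS]addn0 -[i in LHS]muln1.
  by rewrite (nth_input v) ?size_cat ?szA ?szB // hv (tnth_nth false).
have n2 : n <= 2.
  by rewrite -cA (leq_trans (max_card _)) // card_tuple card_bool.
have tnth_inj (x y : bitvec 1) : tnth x ord0 = tnth y ord0 -> x = y.
  by move=> h; apply: eq_from_tnth => i; rewrite (ord1 i).
case: n n0 n2 cA cB szA szB cell => [|[|[|//]]] // _ _ cA cB szA szB cell.
  case: sA szA lA cell => [|x [|]] // _ lA cell.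
  case: sB szB lB cell => [|y [|]] // _ lB cell.
  have ea : a = x by apply/eqP; rewrite -mem_seq1 lA.2.
  have eb : b = y by apply/eqP; rewrite -mem_seq1 lB.2.
  by rewrite (cell 0 x) // (cell 1 y) // /ip big_ord1 -ea -eb mulnb.
case: sA szA lA cell => [|x [|x' [|]]] // _ lA cell.
have neq : x != x' by case: lA => /= /andP[]; rewrite inE.
rewrite (cell 0 x) // (cell 1 x') //.
have -> : ip a b = 0.
  have AT : A = [set: bitvec 1].
    by apply/eqP; rewrite eqEcard subsetT cA cardsT card_tuple card_bool.
  have h0 : [tuple of nseq 1 false] \in A by rewrite AT inE.
  apply/eqP; rewrite -leqn0 -em; apply: leq_trans (minIP_le h0 hb) _.
  by rewrite /ip big_ord1.
apply/eqP; apply: contraNT neq => h; apply/eqP; apply: tnth_inj.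
by move: h; case: (tnth x ord0); case: (tnth x' ord0).
Qed.

Lemma pw_tiny (R : realFieldType) W n d (A B : {set bitvec d}) sA sB t
    (Phi : memory -> nat -> R -> Prop) v :
  d < 2 -> 0 < n -> 1 < W -> #|A| = n -> #|B| = n -> listing sA A -> listing sB B ->
  forall m, mc m = input_cells sA sB ->
  (forall m', mr m' 0 = minIP A B -> Phi m' (t + 5) v) ->
  pw W tiny m t Phi v.
Proof.
move=> d2 n0 W1 cA cB lA lB m hc hPhi.
have c1 a : input_cells sA sB a < W by apply: leq_ltn_trans (input_cells_le1 sA sB a) W1.
have hp := tiny_correct d2 n0 cA cB lA lB.
apply: pw_seq; apply: pw_const; first exact: ltnW.
apply: pw_seq; apply: (@pw_readv _ _ _ _ _ _ _ _ (input_cells sA sB 0)); [by regs; rewrite hc |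
    by [] | ].
apply: pw_seq; apply: pw_const; first exact: W1.
apply: pw_seq; apply: (@pw_readv _ _ _ _ _ _ _ _ (input_cells sA sB 1)); [by regs; rewrite hc |
    by [] | ].
apply: (@pw_opv _ _ _ _ _ _ _ _ _ _ (minIP A B)).
- by regs; rewrite hp.
- rewrite -hp; apply: leq_ltn_trans W1.
  by rewrite -[1]muln1 leq_mul // input_cells_le1.
have -> : t.+4.+1 = t + 5 by lia.
by apply: hPhi; regs.
Qed.

Lemma solves_approx_tiny k c e votes P n d W T : d < 2 -> 0 < n -> 2 < W -> 8 <= T ->
  solves (approx_min_ip k c e votes P) MA_MinIP n d W T.
Proof.
move=> d2 n0 W2 hT; apply: (@solves_of_pw rat) => A B sA sB cA cB lA lB.
apply: pw_seq; apply: pw_const; first exact: W2.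
apply: pw_seq; apply: (@pw_opv _ _ _ _ _ _ _ _ _ _ 1); [by regs; rewrite d2 | lia | ].
apply: pw_if; regs => // _.
apply: (pw_tiny d2 n0 (ltnW W2) cA cB lA lB) => [|m' hm]; first by [].
split; [exact: leq_trans hT | by [] | left].
by rewrite /MA_MinIP hm leqnn leq_pmull.
Qed.

Section Solves.
Variables (P : com) (n d k c e b l s T : nat).
Let q := 2 ^ b.
Let j0 := 4 * 2 ^ l * (d.+1 %/ 2).
Let rho := 128 * j0.
Let Lmax := 2 ^ (k - 2) * l * (q ^ k).+1.
Let Dmax := d + d + Lmax.
Hypotheses (hsolves : forall D, D <= Dmax -> solves P OV n D s T)
  (d2 : 1 < d) (n0 : 0 < n) (k2 : 1 < k) (c0 : 0 < c) (eq_s : s = n.+1 ^ e)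
  (dq : d <= q) (qmin : forall i, i < b -> 2 ^ i < d)
  (nl : n < 2 ^ (c * l)) (lmin : forall i, i < l -> 2 ^ (c * i) <= n)
  (bin : (n + n) * d + q <= s) (bL : Lmax * k <= s) (bD : (n + n) * Dmax <= s)
  (bq : q ^ k <= s) (b2c : 2 ^ (c * l) <= s) (brho : 2 * rho <= s) (s256 : 256 <= s)
  (ks : k <= s) (k2s : 2 ^ (k - 2) <= s) (cs : 2 ^ c <= s).

Lemma solves_approx T' (herr : (j0%:R * ((n * n)%:R * 2^-1 ^+ (2 ^ (k - 2) * l) +
    2 * (8 / 9) ^+ rho) <= 4^-1 :> rat)%R) :
  setup_cost k e b l + j0 * (attempt_cost P n k b T rho Lmax Dmax).+1 + 10 <= T' ->
  solves (approx_min_ip k c e 128 P) MA_MinIP n d (s ^ 4) T'.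
Proof.
move=> hT'.
(* There are j0 <= s attempts of 2 rho <= s calls, each moving on by s cells, so addresses stay
   below s^3 + 4 s. *)
have bW : s * s * s + 4 * s < s ^ 4.
  have -> : s ^ 4 = s * (s * s * s) by rewrite !expnS expn0; ring.
  have h1 : 4 * s < (s - 1) * s by rewrite ltn_pmul2r; lia.
  have h2 : (s - 1) * s <= (s - 1) * (s * s * s).
    by rewrite leq_mul2l -mulnA leq_pmulr ?orbT // muln_gt0; apply/andP; split; lia.
  have h3 : s * (s * s * s) = s * s * s + (s - 1) * (s * s * s).
    by rewrite -mulSn; congr (_ * _); lia.
  lia.
have sW : s < s ^ 4.
  by rewrite -{1}[s]expn1 ltn_exp2l //; lia.
apply: (@solves_of_pw rat) => A B sA sB cA cB lA lB.
have d0 : 0 < d by exact: ltnW.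
have szA : size sA = n by rewrite (listing_size lA).
have szB : size sB = n by rewrite (listing_size lB).
have s2 : 2 < s ^ 4 by apply: ltn_trans sW; exact: leq_trans s256.
have ddn : (n + n) * d <= s by apply: leq_trans bin; exact: leq_addr.
have nnd : n + n <= s by apply: leq_trans ddn; exact: leq_pmulr.
have ddD : d + d <= Dmax by exact: leq_addr.
have dds : d + d <= s.
  by apply: leq_trans bD; apply: leq_trans ddD _; rewrite leq_pmull // addn_gt0 n0.
have ds : d < s by apply: leq_trans dds; rewrite -[d.+1]add1n leq_add2r.
have ns : n < s by apply: leq_trans nnd; rewrite -[n.+1]add1n leq_add2r.
have qs : q <= s by apply: leq_trans bin; exact: leq_addl.
have js : j0 <= s by apply: leq_trans brho; rewrite /rho mulnA leq_pmull.
have nws : 4 * 2 ^ l <= s.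
  by apply: leq_trans js; rewrite leq_pmulr // divn_gt0.
apply: pw_seq; apply: pw_const; first exact: s2.
apply: pw_seq; apply: (@pw_opv _ _ _ _ _ _ _ _ _ _ 0).
- by regs; rewrite ltnNge d2.
- exact: ltn_trans s2.
apply: pw_if; regs => // _.
apply: pw_seq.
apply: (@pw_setup rat P _ n d k c e b l s sA sB q _ j0 rho 128) => //.
- exact: leq_trans s256.
- move=> y /orP[/eqP -> //|hy]; regs.
  by rewrite !ifN ?[nth 0 [:: n; d] y]nth_default //=; clear -hy; lia.
move=> m1 t1 henv ht1; apply: pw_seq.
apply: (@pw_attempts rat P (s ^ 4) n d k b l s T A B sA sB q _ j0 rho Lmax Dmax) => //.
  exact: leq_trans s256.
move=> m2 t2 r hz hod ht2 r0 hr.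
apply: (@pw_opv _ _ _ _ _ _ _ _ _ _ (mr m2 rOut)).
- by regs; rewrite hz addn0.
- by apply: leq_ltn_trans sW; apply: leq_trans (ltnW ds).
split; [by apply: leq_trans hT'; clear -ht1 ht2; lia | exact: r0 | exact: hr].
Qed.

End Solves.

(** * Bounds on the parameters *)

Section Bounds.
Variables (n d k c b l g M e v : nat).
Let q := 2 ^ b.
Let j0 := 4 * 2 ^ l * (d.+1 %/ 2).
Let rho := v * j0.
Let Lmax := 2 ^ (k - 2) * l * (q ^ k).+1.
Let Dmax := d + d + Lmax.
Hypotheses (k_eq : k = g + 5) (c_eq : c = 2 ^ g) (d2 : 1 < d) (dM : d ^ M <= n)
  (M_k : 3 * k + 2 <= M) (n2d : n <= 2 ^ d)
  (qmin : forall i, i < b -> 2 ^ i < d)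
  (nl : n < 2 ^ (c * l)) (lmin : forall i, i < l -> 2 ^ (c * i) <= n).

Let d0 : 0 < d. Proof. exact: ltnW. Qed.

Let n_big : 2 ^ 17 <= n.
Proof.
apply: leq_trans dM; apply: (@leq_trans (2 ^ M)); first by rewrite leq_exp2l //; move: M_k
    k_eq; clear; lia.
by rewrite leq_exp2r //; move: M_k k_eq; clear; lia.
Qed.

Let n0 : 0 < n. Proof. by apply: leq_trans n_big; rewrite expn_gt0. Qed.

Let l0 : 0 < l.
Proof. by move: nl; case: (posnP l) => // ->; rewrite muln0 expn0 ltnNge n0. Qed.

Let c0 : 0 < c. Proof. by rewrite c_eq expn_gt0. Qed.

Lemma range_le : q <= 2 * d.
Proof.
rewrite /q; case: b qmin => [|b'] h; first by rewrite expn0; clear -d2; lia.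
by rewrite expnS leq_mul2l ltnW // h.
Qed.

Lemma log_range_le : b <= 2 * d.
Proof. by apply: leq_trans range_le; apply: ltnW; exact: ltn_expl. Qed.

Lemma level_pred : 2 ^ (c * l.-1) <= n.
Proof. by apply: lmin; rewrite prednK. Qed.

Lemma level_le : l <= d.+1.
Proof.
have h : 2 ^ (c * l.-1) <= 2 ^ d by exact: leq_trans level_pred n2d.
rewrite leq_exp2l // in h; rewrite -(prednK l0) ltnS; apply: leq_trans h.
by rewrite leq_pmull.
Qed.

Lemma exp_level_le : 2 ^ l <= 2 * n.
Proof.
rewrite -(prednK l0) expnS leq_mul2l /=; apply: leq_trans level_pred.
by rewrite leq_exp2l // leq_pmull.
Qed.

Lemma exp_clevel_le : 2 ^ (c * l) <= 2 ^ c * n.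
Proof. by rewrite -{1}(prednK l0) mulnS expnD leq_mul2l level_pred orbT. Qed.

(** Exponents of d, using 2 <= d: k - 2 for 2^(k-2), 2 for l, 2 k + 1 for q^k + 1, and one more to
    absorb the padding 2 d. *)
Lemma dim_le : Dmax <= d ^ (3 * k + 2).
Proof.
have dd : 2 * d <= d ^ 2 by rewrite expnS expn1 leq_mul2r d2 orbT.
have hl : l <= d ^ 2.
  by apply: leq_trans level_le _; apply: leq_trans dd; rewrite mul2n -addnn -add1n leq_add2r.
have hq : (q ^ k).+1 <= d ^ (2 * k + 1).
  apply: (@leq_trans (2 * d ^ (2 * k))).
    have h1 : q ^ k <= d ^ (2 * k).
      rewrite expnM leq_exp2r; last by rewrite k_eq; clear; lia.
      exact: leq_trans range_le dd.
    have h2 : 0 < d ^ (2 * k) by rewrite expn_gt0 d0.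
    by rewrite mul2n -addnn -add1n leq_add.
  by rewrite addn1 expnS leq_mul2r d2 orbT.
have hk : 2 ^ (k - 2) <= d ^ (k - 2).
  by rewrite leq_exp2r // k_eq; clear; lia.
have hL : Lmax <= d ^ (3 * k + 1).
  have -> : 3 * k + 1 = (k - 2) + 2 + (2 * k + 1) by rewrite k_eq; clear; lia.
  by rewrite expnD leq_mul // expnD leq_mul.
have hd : d + d <= d ^ (3 * k + 1).
  rewrite addnn -mul2n; apply: leq_trans dd _; rewrite leq_exp2l //; rewrite k_eq; clear; lia.
apply: (@leq_trans (2 * d ^ (3 * k + 1))); first by rewrite mul2n -addnn leq_add.
by rewrite (_ : 3 * k + 2 = (3 * k + 1).+1) ?expnS ?leq_mul2r ?d2 ?orbT //; clear; lia.
Qed.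

Lemma dim_le_n : Dmax <= n.
Proof.
apply: leq_trans dim_le _; apply: leq_trans dM.
by rewrite leq_exp2l.
Qed.

Lemma attempts_le : j0 <= 4 * 2 ^ l * d.
Proof. by rewrite leq_mul2l; apply/orP; right; have := leq_trunc_div d.+1 2; lia. Qed.

Lemma d_le_n : d <= n.
Proof. by apply: leq_trans dim_le_n; rewrite /Dmax -addnA leq_addr. Qed.

Lemma attempts_le_n : j0 <= 8 * (n * n).
Proof.
apply: leq_trans attempts_le _; apply: (@leq_trans (4 * (2 * n) * n)); last by lia.
by rewrite leq_mul ?d_le_n // leq_mul2l exp_level_le.
Qed.

Hypothesis e_ge : 4 * k + c + 30 <= e.
Let s := n.+1 ^ e.

Lemma le_stride x i : x <= n.+1 ^ i -> i <= e -> x <= s.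
Proof. by move=> h1 h2; apply: leq_trans h1 _; rewrite leq_exp2l. Qed.

Let n1 i : n <= n.+1 ^ i.+1.
Proof. by apply: leq_trans (leqnSn n) _; rewrite -{1}[n.+1]expn1 leq_exp2l. Qed.

Lemma stride_bounds : v = 128 ->
  [/\ [/\ (n + n) * d + q <= s, Lmax * k <= s, (n + n) * Dmax <= s & q ^ k <= s],
      [/\ 2 ^ (c * l) <= s, 2 * rho <= s, 256 <= s & k <= s] &
      2 ^ (k - 2) <= s /\ 2 ^ c <= s].
Proof.
move=> v_eq.
have two i : 2 ^ i <= n.+1 ^ i by case: i => // i; rewrite leq_exp2r //; lia.
have kk : k <= n.+1 ^ k by apply: leq_trans (two k); apply: ltnW; exact: ltn_expl.
have Ln : Lmax <= n by apply: leq_trans dim_le_n; exact: leq_addl.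
have q2n : q <= 2 * n by apply: leq_trans range_le _; rewrite leq_mul2l d_le_n.
have sq x : x <= 2 * n * n + 2 * n -> x <= n.+1 ^ 3.
  by move=> h; apply: leq_trans h _; rewrite !expnS expn0; nia.
split; split.
- apply: (@le_stride _ 3); last lia; apply: sq.
  by apply: leq_add => //; rewrite mul2n -addnn leq_mul2l d_le_n orbT.
- apply: (@le_stride _ k.+1); last lia.
  by rewrite expnS leq_mul // (leq_trans Ln).
- apply: (@le_stride _ 3); last lia; apply: sq; apply: leq_trans (leq_addr _ _).
  by rewrite mul2n -addnn leq_mul2l dim_le_n orbT.
- apply: (@le_stride _ (2 * k)); last lia.
  rewrite expnM leq_exp2r; last by rewrite k_eq; lia.
  by apply: leq_trans q2n _; rewrite !expnS expn0; nia.
- apply: (@le_stride _ c.+1); last lia.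
  by apply: leq_trans exp_clevel_le _; rewrite expnSr leq_mul.
- apply: (@le_stride _ 20); last lia.
  apply: (@leq_trans (n.+1 ^ 8 * (n.+1 ^ 3 * n.+1 ^ 2))); last by rewrite -!expnD leq_exp2l.
  have -> : 2 * rho = 2 ^ 8 * j0 by rewrite /rho v_eq mulnA.
  apply: leq_mul; first exact: two.
  apply: leq_trans attempts_le_n _; apply: leq_mul; first exact: (two 3).
  by rewrite expnS expn1 leq_mul.
- by apply: (@le_stride _ 8); [exact: (two 8) | lia].
- by apply: (@le_stride _ k); [exact: kk | lia].
- by apply: (@le_stride _ (k - 2)); [exact: two | lia].
- by apply: (@le_stride _ c); [exact: two | lia].
Qed.

(** Both terms are at most 1/8. For false alarms, j0 <= 8 n^2 gives 8 j0 n^2 <= 64 n^4 <= n^8 <=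
    2^(8 c l). For the votes, rho = 128 j0 gives (9/8)^rho >= 1 + 16 j0, hence 2 j0 (8/9)^rho <=
    1/8. *)
Lemma error_bound (R : realFieldType) : v = 128 ->
  (j0%:R * ((n * n)%:R * 2^-1 ^+ (2 ^ (k - 2) * l) + 2 * (8 / 9) ^+ rho) <= 4^-1 :> R)%R.
Proof.
move=> v_eq.
have h1 : 8 * (j0 * (n * n)) <= 2 ^ (2 ^ (k - 2) * l).
  have -> : 2 ^ (k - 2) * l = c * l * 8.
    have -> : 2 ^ (k - 2) = 8 * c.
      by rewrite k_eq c_eq (_ : g + 5 - 2 = 3 + g) ?expnD //; lia.
    by ring.
  rewrite expnM; apply: (@leq_trans (n ^ 8)); last by rewrite leq_exp2r // ltnW.
  apply: (@leq_trans (8 * (8 * (n * n) * (n * n)))).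
    by rewrite leq_mul2l leq_mul2r attempts_le_n !orbT.
  have -> : 8 * (8 * (n * n) * (n * n)) = 64 * n ^ 4 by rewrite !expnS expn0; ring.
  rewrite (expnD n 4 4) leq_mul2r; apply/orP; right.
  apply: (@leq_trans n); first by apply: leq_trans n_big; rewrite -[64]/(2 ^ 6) leq_exp2l.
  by rewrite -{1}[n]expn1 leq_pexp2l.
have h2 : (2 * (8 / 9) ^+ rho * j0%:R <= 8^-1 :> R)%R.
  have hb : (1 + rho%:R * 8^-1 <= (9 / 8) ^+ rho :> R)%R.
    elim: (rho) => [|r IH]; first by rewrite mul0r addr0.
    rewrite exprS -natr1; apply: (@le_trans _ _ (9 / 8 * (1 + r%:R * 8^-1))%R); last first.
      by rewrite ler_wpM2l // divr_ge0.
    have r0 : (0 <= r%:R :> R)%R by []; lra.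
  have e1 : ((8 / 9) ^+ rho * (9 / 8) ^+ rho = 1 :> R)%R.
    by rewrite -exprMn (_ : 8 / 9 * (9 / 8) = 1 :> R)%R ?expr1n //; lra.
  have p0 : (0 <= (8 / 9) ^+ rho :> R)%R by rewrite exprn_ge0 // divr_ge0.
  have hr : (rho%:R = 128 * j0%:R :> R)%R by rewrite /rho v_eq natrM.
  have j00 : (0 <= j0%:R :> R)%R by [].
  have h3 := ler_wpM2l p0 hb; rewrite e1 hr in h3.
  move: h3; set p := ((8 / 9) ^+ rho)%R; set j := (j0%:R : R)%R in j00 *.
  move=> h3; have h4 : (p * (1 + 128 * j * 8^-1) = p + 16 * (p * j))%R by field.
  rewrite h4 in h3; have -> : (2 * p * j = 2 * (p * j))%R by ring.
  by rewrite -/p in p0; lra.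
have h1' : (8 * (j0%:R * (n * n)%:R * 2^-1 ^+ (2 ^ (k - 2) * l)) <= 1 :> R)%R.
  rewrite exprVn -!natrM mulrA -natrM ler_pdivrMr ?exprn_gt0 // mul1r -natrX ler_nat.
  exact: h1.
rewrite mulrDr mulrA [(j0%:R * (2 * _))%R]mulrC; lra.
Qed.

Definition time_const (P : com) : nat :=
  4 * (17 * k.+1 + 8 * v * (70 + 21 * k + num_regs P) + k + 31) + e + k + 51.

(** There are O(2^l d) attempts of O(2^l d) calls each, and a call costs O(Dmax n + T) with Dmax <=
    d^(3k+2). The number of votes grows with the number of attempts, hence the square of 2^l. *)
Lemma time_bound P T : 0 < v ->
  setup_cost k e b l + j0 * (attempt_cost P n k b T rho Lmax Dmax).+1 + 10 <=
  time_const P * ((2 ^ l) ^ 2 * d ^ (3 * k + 4) * (n + T)) + 10.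
Proof.
move=> v0; rewrite leq_add2r.
set G := 2 ^ l; set U := d ^ (3 * k + 2); set F := n + T.
have G0 : 0 < G by rewrite expn_gt0.
have U0 : 0 < U by rewrite expn_gt0 d0.
have F0 : 0 < F by rewrite addn_gt0 n0.
have -> : d ^ (3 * k + 4) = d * d * U.
  by rewrite (_ : 3 * k + 4 = (3 * k + 2).+2) ?expnS ?mulnA //; clear; lia.
have hD : Dmax <= U := dim_le.
have hL : Lmax <= U by apply: leq_trans hD; exact: leq_addl.
set nr := num_regs P; set a1 := 70 + 21 * k + nr.
have UF0 : 0 < U * F by rewrite muln_gt0 U0.
have hcall : call_cost k n Dmax T P + 2 <= a1 * (U * F).
  have h1 : ((n + n) * Dmax).+1 <= 3 * (U * F).
    have : n * Dmax <= U * F by rewrite mulnC leq_mul // leq_addr.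
    by rewrite mulnDl; move: UF0; clear; lia.
  have h2 : T <= U * F by apply: leq_trans (leq_pmull _ U0); exact: leq_addl.
  rewrite /call_cost -/nr /a1.
  have h3 : (20 + 7 * k) * ((n + n) * Dmax).+1 <= (20 + 7 * k) * (3 * (U * F)).
    by rewrite leq_mul2l h1 orbT.
  have h4 : nr <= nr * (U * F) by rewrite leq_pmulr.
  by move: h2 h3 h4 UF0; clear; nia.
have hj : j0 <= 4 * G * d := attempts_le.
set X := G * d * (U * F).
have X0 : 0 < X by rewrite muln_gt0 UF0 andbT muln_gt0 G0 d0.
have hrho : 2 * rho <= 8 * v * (G * d).
  by rewrite /rho; have := leq_mul (leqnn v) hj; clear; lia.
have hatt : (attempt_cost P n k b T rho Lmax Dmax).+1 <=
    (17 * k.+1 + 8 * v * a1 + k + 31) * X.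
  have h1 : (6 * b + 9) * (Lmax * k).+1 <= 17 * k.+1 * X.
    apply: (@leq_trans ((17 * d) * (U * k.+1))).
      apply: leq_mul; first by move: log_range_le d2; clear; lia.
      by rewrite mulnS -add1n leq_add // leq_mul2r hL orbT.
    rewrite /X; have -> : 17 * d * (U * k.+1) = 17 * k.+1 * (d * U) by ring.
    rewrite leq_mul2l; apply/orP; right.
    have -> : G * d * (U * F) = d * U * (G * F) by ring.
    by rewrite leq_pmulr // muln_gt0 G0.
  have h2 : 2 * rho * (call_cost k n Dmax T P + 2) <= 8 * v * a1 * X.
    apply: leq_trans (leq_mul hrho hcall) _.
    by rewrite /X; apply: eq_leq; ring.
  have h3 : k + 31 <= (k + 31) * X by rewrite leq_pmulr.
  rewrite /attempt_cost; move: h1 h2 h3; clear; lia.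
set a2 := 17 * k.+1 + 8 * v * a1 + k + 31.
have -> : G ^ 2 * (d * d * U) * F = G * d * X by rewrite /X; ring.
have hs : setup_cost k e b l <= (e + k + 51) * (G * d * X).
  have Gd0 : 0 < G * d by rewrite muln_gt0 G0 d0.
  have GdX : 0 < G * d * X by rewrite muln_gt0 Gd0 X0.
  have h1 : l <= G * d * X.
    apply: (@leq_trans G); first by apply: ltnW; exact: ltn_expl.
    by rewrite -mulnA leq_pmulr // muln_gt0 d0 X0.
  have h2 : d <= G * d * X by rewrite mulnAC leq_pmull // muln_gt0 G0 X0.
  have h3 : (e + k + 40) <= (e + k + 40) * (G * d * X) by rewrite leq_pmulr.
  by rewrite /setup_cost; move: h1 h2 h3 log_range_le; clear; lia.
have ha : j0 * (attempt_cost P n k b T rho Lmax Dmax).+1 <= 4 * a2 * (G * d * X).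
  by apply: leq_trans (leq_mul hj hatt) _; apply: eq_leq; rewrite /a2; ring.
rewrite /time_const -/nr -/a1 -/a2; move: hs ha; clear; lia.
Qed.

End Bounds.

(** * Roots and powers of n *)

Section Powers.
Variable R : realType.
Local Open Scope ring_scope.

Lemma root_le (x n M : nat) : (0 < M)%N -> (x ^ M <= n)%N -> x%:R <= n%:R `^ (M%:R^-1) :> R.
Proof.
move=> M0 h; have Mr : M%:R != 0 :> R by rewrite pnatr_eq0 -lt0n.
have -> : x%:R = (x ^ M)%:R `^ (M%:R^-1) :> R.
  by rewrite natrX -powR_mulrn // -powRrM divff // powRr1.
by rewrite ge0_ler_powR ?nnegrE ?invr_ge0 ?ler_nat.
Qed.

Lemma le_root (x n M : nat) : (0 < M)%N -> x%:R <= n%:R `^ (M%:R^-1) :> R -> (x ^ M <= n)%N.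
Proof.
move=> M0 h; have Mr : M%:R != 0 :> R by rewrite pnatr_eq0 -lt0n.
rewrite -(ler_nat R) natrX -powR_mulrn //.
have -> : n%:R = (n%:R `^ (M%:R^-1)) `^ M%:R :> R by rewrite -powRrM mulVf // powRr1.
by rewrite ge0_ler_powR ?nnegrE ?powR_ge0.
Qed.

Lemma expr_root_le (x n M i : nat) (a : R) : (0 < M)%N -> (0 < n)%N -> (x ^ M <= n)%N ->
  i%:R / M%:R <= a -> x%:R ^+ i <= n%:R `^ a :> R.
Proof.
move=> M0 n0 h ha; apply: (@le_trans _ _ ((n%:R `^ (M%:R^-1)) ^+ i)).
  by rewrite lerXn2r ?nnegrE ?powR_ge0 // root_le.
by rewrite -powR_mulrn ?powR_ge0 // -powRrM mulrC ler_powR // ler1n.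
Qed.

Lemma powR_ge1 (x a : R) : 1 <= x -> 0 <= a -> 1 <= x `^ a.
Proof. by move=> x1 a0; have := ler_powR x1 a0; rewrite powRr0. Qed.

End Powers.

(** The time bound must be a function of n alone, valid for every admissible dimension; this integer
    root of n stands for the largest d with d^M <= n. *)
Definition max_root (M n : nat) : nat := \max_(i < n.+1 | i ^ M <= n) i.

Lemma max_root_le M n : 0 < M -> max_root M n ^ M <= n.
Proof.
move=> M0; rewrite /max_root; elim/big_ind: _ => [|x y hx hy|i //].
  by rewrite exp0n.
by case: (leqP x y).
Qed.

Lemma le_max_root M n x : 0 < M -> x ^ M <= n -> x <= max_root M n.
Proof.
move=> M0 h; have hx : x < n.+1.
  by rewrite ltnS; apply: leq_trans h; case: x => // x; rewrite -{1}[x.+1]expn1 leq_pexp2l.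
exact: (@leq_bigmax_cond _ (fun i : 'I_n.+1 => i ^ M <= n) (fun i => i) (Ordinal hx)).
Qed.

Lemma level_bounds n c : 0 < n -> 0 < c -> let l := (trunc_log 2 n %/ c).+1 in
  n < 2 ^ (c * l) /\ forall i, i < l -> 2 ^ (c * i) <= n.
Proof.
move=> n0 c0 l; have /andP[h1 h2] := trunc_log_bounds (isT : 1 < 2) n0.
split.
  by apply: leq_trans h2 _; rewrite leq_exp2l // mulnC ltn_ceil.
move=> i; rewrite ltnS => hi; apply: leq_trans h1; rewrite leq_exp2l //.
by rewrite mulnC -leq_divRL.
Qed.

Lemma pow2_range d : exists b, d <= 2 ^ b /\ forall i, i < b -> 2 ^ i < d.
Proof.
have ex : exists b, d <= 2 ^ b by exists d; apply: ltnW; exact: ltn_expl.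
case: (ex_minnP ex) => b hb hmin; exists b; split=> // i hi.
by rewrite ltnNge; apply/negP => /hmin; rewrite leqNgt hi.
Qed.

(** * The two implications and their constants *)

Lemma OV_of_MA (R : realType) :
  moderate_truly_subquadratic R MA_MinIP -> moderate_truly_subquadratic R OV.
Proof.
move=> [eps [delta [eps0 delta0 [P [k [T [C H]]]]]]].
(* With eps' <= 1 the power n^(2 - eps') is at least 1 and absorbs the two extra steps. *)
pose eps' := Num.min eps 1%R.
have e1 : (eps' <= eps)%R by rewrite ge_min lexx.
have e2 : (eps' <= 1)%R by rewrite ge_min lexx orbT.
exists eps', delta; split=> //; first by rewrite lt_min eps0 ltr01.
(* The larger exponent makes the word bound exceed 1 even if k = 0, so that the comparison may write
   its result. *)
exists (is_zero P), k.+1, (fun n => T n + 2), (`|C| + 2)%R => n n0.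
have [hT hs] := H n n0.
have n1 : (1 <= n%:R :> R)%R by rewrite ler1n.
have hp : (1 <= n%:R `^ (2 - eps'))%R.
  by apply: powR_ge1 => //; lra.
split.
  rewrite natrD mulrDl; apply: lerD; last by rewrite ler_peMr.
  apply: (le_trans hT); apply: (@le_trans _ _ (`|C| * n%:R `^ (2 - eps))%R).
    by rewrite ler_wpM2r ?powR_ge0 // ler_norm.
  by rewrite ler_wpM2l // ler_powR // lerD2l lerN2.
move=> d hd; apply: solves_is_zero => //.
  by apply: (@leq_trans (n.+1 ^ 1)); [rewrite expn1 ltnS | rewrite leq_exp2l].
by apply: solves_leW (hs d hd); rewrite leq_exp2l.
Qed.

Lemma MA_of_OV (R : realType) :
  moderate_truly_subquadratic R OV -> moderate_truly_subquadratic R MA_MinIP.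
Proof.
move=> [eps0 [delta [eps00 delta0 [P [k0 [T [C H]]]]]]].
(* With eps <= 1 the time n for writing an instance is at most n^(2 - eps). *)
pose eps := Num.min eps0 1%R.
have e1 : (eps <= eps0)%R by rewrite ge_min lexx.
have e2 : (eps <= 1)%R by rewrite ge_min lexx orbT.
have e0 : (0 < eps)%R by rewrite lt_min eps00 ltr01.
(* Then c = 2^g > g > 8 / eps, so (2^l)^2, which is at most 4 n^(2/c), stays below 4 n^(eps/4). *)
pose g := (Num.truncn (8 / eps)%R).+1; pose c := 2 ^ g; pose k := g + 5.
have c0 : 0 < c by rewrite expn_gt0.
have k2 : 1 < k by rewrite /k; lia.
have c_eps : (2%:R / c%:R <= eps / 4 :> R)%R.
  have h1 : (8 / eps < c%:R :> R)%R.
    apply: (lt_le_trans (truncnS_gt _)); rewrite ler_nat; apply: ltnW; exact: ltn_expl.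
  rewrite ltr_pdivrMr // in h1.
  by rewrite ler_pdivrMr ?ltr0n //; lra.
(* The three summands ensure d^(3k+2) <= n, d^(3k+2) <= n^delta, so that the new dimension is
   moderate for the given algorithm, and d^(3k+4) <= n^(eps/4) for the overhead in time. *)
pose M := 3 * k + 2 + (Num.truncn ((3 * k + 2)%:R / delta)%R).+1 +
  (Num.truncn ((3 * k + 4)%:R * 4 / eps)%R).+1.
have M0 : 0 < M by rewrite /M; lia.
have Mr : (0 < M%:R :> R)%R by rewrite ltr0n.
have M_k : 3 * k + 2 <= M by rewrite /M; lia.
have M_delta : ((3 * k + 2)%:R / M%:R <= delta :> R)%R.
  rewrite ler_pdivrMr // mulrC -ler_pdivrMr //.
  by apply: (le_trans (ltW (truncnS_gt _))); rewrite ler_nat /M -addnA addnCA leq_addr.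
have M_eps : ((3 * k + 4)%:R / M%:R <= eps / 4 :> R)%R.
  have h : ((3 * k + 4)%:R * 4 / eps <= M%:R :> R)%R.
    by apply: (le_trans (ltW (truncnS_gt _))); rewrite ler_nat /M leq_addl.
  rewrite ler_pdivrMr // in h; rewrite ler_pdivrMr //. lra.
(* The summand k0 makes the stride at least the word bound of the given algorithm. *)
pose e := 4 * k + c + 30 + k0.
have he : 4 * k + c + 30 <= e by exact: leq_addr.
pose l n := (trunc_log 2 n %/ c).+1.
pose T' n := time_const k e 128 P * ((2 ^ l n) ^ 2 * max_root M n ^ (3 * k + 4) * (n + T n)) + 10.
exists (eps / 2)%R, (M%:R^-1)%R; split; [by rewrite divr_gt0 | by rewrite invr_gt0 | ].
exists (approx_min_ip k c e 128 P), (e * 4), T',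
  ((time_const k e 128 P)%:R * (4 * (1 + `|C|)) + 10)%R => n n0.
have [hT hs] := H n n0.
have [nl lmin] := level_bounds n0 c0.
have n1 : (1 <= n%:R :> R)%R by rewrite ler1n.
split.
  have hp : (1 <= n%:R `^ (2 - eps / 2))%R.
    by apply: powR_ge1 => //; lra.
  rewrite /T' natrD mulrDl; apply: lerD; last by rewrite ler_peMr.
  rewrite natrM -mulrA ler_wpM2l //.
  (* One eps/4 pays for (2^l)^2, the other for the powers of d; half of the saving remains. *)
  have -> : ((2 - eps / 2) = eps / 4 + (eps / 4 + (2 - eps)))%R by lra.
  have nz : (n%:R == 0 :> R)%R = false by rewrite pnatr_eq0 -leqn0 leqNgt n0.
  have powD x y : (n%:R `^ (x + y) = n%:R `^ x * n%:R `^ y :> R)%R.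
    by rewrite powRD // nz implybT.
  have cast x y z : ((x * y * z)%N%:R = x%:R * y%:R * z%:R :> R)%R by rewrite !natrM.
  rewrite 2!powD cast.
  have h1 : (((2 ^ l n) ^ 2)%N%:R <= 4 * n%:R `^ (eps / 4) :> R)%R.
    rewrite /l [2 ^ _.+1]expnS expnMn natrM ler_wpM2l // natrX.
    apply: (@expr_root_le R _ _ c) => //.
    by rewrite -expnM mulnC; apply: lmin.
  have h2 : ((max_root M n ^ (3 * k + 4))%N%:R <= n%:R `^ (eps / 4) :> R)%R.
    by rewrite natrX; apply: (@expr_root_le R _ _ M) => //; exact: max_root_le.
  have h3 : ((n + T n)%N%:R <= (1 + `|C|) * n%:R `^ (2 - eps) :> R)%R.
    rewrite natrD mulrDl mul1r; apply: lerD.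
      by rewrite -{1}[(n%:R)%R]powRr1 // ler_powR //; lra.
    apply: (le_trans hT); apply: (@le_trans _ _ (`|C| * n%:R `^ (2 - eps0))%R).
      by rewrite ler_wpM2r ?powR_ge0 // ler_norm.
    by rewrite ler_wpM2l // ler_powR // lerD2l lerN2.
  have h12 := ler_pM (ler0n _ _) (ler0n _ _) h1 h2.
  have h123 := ler_pM (mulr_ge0 (ler0n _ _) (ler0n _ _)) (ler0n _ _) h12 h3.
  apply: (le_trans h123); rewrite le_eqVlt; apply/orP; left; apply/eqP; ring.
move=> d hd.
rewrite expnM.
have W2 : 2 < (n.+1 ^ e) ^ 4.
  have h2 : 2 <= n.+1 ^ e.
    by apply: (@leq_trans (n.+1 ^ 1)); [rewrite expn1 | rewrite leq_exp2l // /e; lia].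
  by apply: (@leq_trans (2 ^ 4)) => //; rewrite leq_exp2r.
have [d2|d2] := ltnP d 2.
  apply: (solves_approx_tiny _ _ _ _ _ d2 n0 W2).
  by apply: (@leq_trans 10) => //; exact: leq_addl.
have dM : d ^ M <= n by apply: (@le_root R).
(* For n > 2^d there are no sets of n vectors, and the claim is vacuous. *)
have [n2d|n2d] := leqP n (2 ^ d); last first.
  move=> A B sA sB cA _ _ _; exfalso; move: n2d.
  by rewrite -cA ltnNge (leq_trans (max_card _)) // card_tuple card_bool.
have [b [dq qmin]] := pow2_range d.
have kE : k = g + 5 by [].
have cE : c = 2 ^ g by [].
have hdim := dim_le kE cE d2 dM M_k n2d qmin nl lmin.
have [[b1 b2 b3 b4] [b5 b6 b7 b8] [b9 b10]] :=
  stride_bounds kE cE d2 dM M_k n2d qmin nl lmin he (erefl 128).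
have d0 : 0 < d by exact: ltnW.
apply: (@solves_approx P n d k c e b (l n) (n.+1 ^ e) (T n)) => //.
- move=> D hD; apply: (@solves_leW _ _ _ _ (n.+1 ^ k0)).
    by rewrite leq_exp2l // /e leq_addl.
  apply: hs; apply: (@le_trans _ _ (d%:R ^+ (3 * k + 2))%R).
    by rewrite -natrX ler_nat (leq_trans hD).
  exact: (expr_root_le M0 n0 dM M_delta).
- exact: (error_bound kE cE d2 dM M_k n2d qmin nl lmin he _ (erefl 128)).
- apply: leq_trans (time_bound e kE cE d2 dM M_k n2d qmin nl lmin P (T n) (isT : 0 < 128)) _ =>
    //.
  rewrite /T' leq_add2r leq_mul2l; apply/orP; right.
  rewrite leq_mul2r; apply/orP; right; rewrite leq_mul2l; apply/orP; right.
  by rewrite leq_exp2r ?le_max_root // addn_gt0 orbT.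
Qed.

Theorem theorem1p5 (R : realType) :
  moderate_truly_subquadratic R OV <-> moderate_truly_subquadratic R MA_MinIP.
Proof. by split; [exact: MA_of_OV | exact: OV_of_MA]. Qed.
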